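(* Let $A$ be a subfinite algebra over a Noetherian Jacobson ring $R$ and let $s$ be a positive integer. (a) If $s \le \dim A$, there exists a sequence $a_1,\ldots,a_s \in A$ that is independent over $R$ with respect to every monomial preorder. (b) If $s > \dim A$, every sequence $a_1,\ldots,a_s \in A$ is dependent over $R$ with respect to every monomial preorder.
   Context: All rings and algebras are commutative with identity; $\dim$ denotes Krull dimension. A ring $R$ is a Jacobson ring if every prime ideal of $R$ is an intersection of maximal ideals. An $R$-algebra is called subfinite if it is a subalgebra of a finitely generated $R$-algebra. A strict weak order on a set $M$ is a binary relation $\prec$ such that for all $f,g,h \in M$ with $f \prec g$: (i) $f \prec h$ or $h \prec g$, and (ii) $g \not\prec f$. A monomial preorder is a strict weak order $\prec$ on the set of monomials in the variables $x_1,x_2,\ldots$ such that (iii) $1 \prec f$ for all monomials $f \neq 1$, and (iv) for all monomials $f,g,h$: $f \prec g$ if and only if $fh \prec gh$. For a polynomial $f$ over $R$, $\operatorname{in}_\prec(f)$ is the sum of all terms of $f$ whose monomials are minimal with respect to $\prec$ among the monomials appearing in $f$ (with $\operatorname{in}_\prec(0)=0$). A sequence $a_1,\ldots,a_s$ of elements of an $R$-algebra $A$ is dependent over $R$ with respect to $\prec$ if there exists a polynomial $f \in R[x_1,\ldots,x_s]$ with $f(a_1,\ldots,a_s)=0$ in $A$ such that $\operatorname{in}_\prec(f)$ has at least one coefficient that is invertible in $R$; otherwise it is independent over $R$ with respect to $\prec$. (Coefficients are taken with respect to all monomials, so $0$ counts as a coefficient; this matters only if $R$ is the zero ring.) *)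

(* Defs.v *)
From HB Require Import structures.
From mathcomp Require Import all_boot all_order all_algebra.
From mathcomp Require Import finmap.
From mathcomp.multinomials Require Import monalg.
From mathcomp Require Import boolp classical_sets constructive_ereal.

Set Implicit Arguments.
Unset Strict Implicit.
Unset Printing Implicit Defensive.

Import Order.TTheory GRing.Theory Num.Theory.

Local Open Scope classical_set_scope.
Local Open Scope ring_scope.

(* Rings are [comPzRingType]s, so that the zero ring is included; this excludes
   [GRing.unit], the ideals of [ring_quotient] and the algebra structures of
   [ssralg], all of which assume 1 != 0. An R-algebra is a ring A together with
   its structure morphism R -> A. *)

Definition invertible (R : comPzRingType) (c : R) : Prop :=
  exists d : R, c * d = 1.

Section Ideals.
Variable R : comPzRingType.
Implicit Types I J M P : set R.

Definition ideal I : Prop :=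
  [/\ I 0, forall x y, I x -> I y -> I (x + y) & forall r x, I x -> I (r * x)].

Definition prime_ideal P : Prop :=
  [/\ ideal P, ~ P 1 & forall x y, P (x * y) -> P x \/ P y].

Definition maximal_ideal M : Prop :=
  [/\ ideal M, ~ M 1 & forall J, ideal J -> M `<=` J -> J = M \/ J = setT].

End Ideals.

Definition noetherian (R : comPzRingType) : Prop :=
  forall I : set R, ideal I ->
    exists g : seq R, I = smallest (@ideal R) [set x | x \in g].

Definition jacobson (R : comPzRingType) : Prop :=
  forall P : set R, prime_ideal P ->
    exists2 F : set (set R), F `<=` @maximal_ideal R & P = \bigcap_(M in F) M.

Definition prime_chain (R : comPzRingType) (n : nat) (P : nat -> set R) : Prop :=
  (forall i, (i <= n)%N -> prime_ideal (P i)) /\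
  (forall i, (i < n)%N -> P i `<` P i.+1).

(* The supremum in {-oo} + int + {+oo} of the lengths of chains of prime
   ideals; the zero ring has dimension -oo. *)
Definition krull_dim (R : comPzRingType) : \bar int :=
  supremum -oo%E
    [set (n%:Z)%:E | n in [set n | exists P, @prime_chain R n P]].

(* Polynomials are finitely supported families of coefficients indexed by
   monomials. [malg] provides no ring structure on them when R may be zero, but
   only coefficients and evaluation are needed. *)
Definition mpeval (n : nat) (R A : comPzRingType) (phi : {rmorphism R -> A})
    (a : 'I_n -> A) (f : {malg R[{cmonom 'I_n}]}) : A :=
  \sum_(m <- msupp f) phi f@_m * \prod_(i < n) a i ^+ m i.

Definition finitely_generated_algebra (R B : comPzRingType)
    (psi : {rmorphism R -> B}) : Prop :=
  exists (n : nat) (b : 'I_n -> B), forall y : B,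
    exists f : {malg R[{cmonom 'I_n}]}, mpeval psi b f = y.

Definition subfinite (R A : comPzRingType) (phi : {rmorphism R -> A}) : Prop :=
  exists (B : comPzRingType) (psi : {rmorphism R -> B})
         (iota : {rmorphism A -> B}),
    [/\ finitely_generated_algebra psi, injective iota
      & forall r : R, iota (phi r) = psi r].

Definition strict_weak_order (M : Type) (lt : rel M) : Prop :=
  forall f g h : M, lt f g -> (lt f h \/ lt h g) /\ ~ lt g f.

(* [{cmonom nat}] is the monoid of monomials in countably many variables, the
   variable x_(i+1) having index i. *)
Definition monomial_preorder (lt : rel {cmonom nat}) : Prop :=
  [/\ strict_weak_order lt,
      forall f, f <> mone -> lt mone f
    & forall f g h, lt f g <-> lt (mmul f h) (mmul g h)].

(* A monomial in s variables viewed as a monomial in countably many ones. *)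
Definition widen_cmonom (s : nat) (m : {cmonom 'I_s}) : {cmonom nat} :=
  \big[mmul/mone]_(i < s) expcmn (ucm (i : nat)) (m i).

Definition initial_form (s : nat) (R : comPzRingType) (lt : rel {cmonom nat})
    (f : {malg R[{cmonom 'I_s}]}) : {malg R[{cmonom 'I_s}]} :=
  \sum_(m <- msupp f |
        all (fun m' => ~~ lt (widen_cmonom m') (widen_cmonom m)) (msupp f))
     << f@_m *g m >>.

Definition dependent (R A : comPzRingType) (phi : {rmorphism R -> A})
    (lt : rel {cmonom nat}) (s : nat) (a : 'I_s -> A) : Prop :=
  exists2 f : {malg R[{cmonom 'I_s}]},
    mpeval phi a f = 0 & exists m, invertible ((initial_form lt f)@_m).

Definition independent (R A : comPzRingType) (phi : {rmorphism R -> A})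
    (lt : rel {cmonom nat}) (s : nat) (a : 'I_s -> A) : Prop :=
  ~ dependent phi lt a.

(* Main.v *)
(* Let C be a Noetherian ring, a a sequence in C, and < a total monomial order
   refining the given preorder. The elements c of C for which some c a^v is a
   combination of monomials larger than a^v form an ideal E; if C = R[a] and E = C,
   then a is dependent over R. By Noetherianity the order may be replaced by a positive
   integral weight (ties broken by <) without enlarging E; hence, if p is a prime
   minimal over E, the length of C_p / p^N grows at least like N^s, where s is the
   length of a. On the other hand it grows at most like N^n if p is minimal over
   n elements, and at most like N^(n-1) if moreover these n elements satisfy a
   relation whose initial form has a coefficient outside p.

   (a) A chain of length s in A contracts to a finitely generated subalgebra C, so
   C contains a sequence of n >= s elements, each avoiding the minimal primes over
   the previous ones, and a prime p minimal over it. For the lexicographic order E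
   lies in p, so the growth is at least N^n; hence no relation exists.

   (b) If a is independent, take C = R[a]. A prime p minimal over E is minimal over
   n elements chosen as in (a), and the growth gives n >= s, so C has a chain of
   length s. As C inherits the Jacobson property from R, the chain can be moved
   away from any given g outside the minimal primes; for a suitable g it then lifts
   to the finitely generated algebra containing A, and contracts to A. *)

Require Import Defs.
From HB Require Import structures.
From mathcomp Require Import all_boot all_order all_algebra.
From mathcomp Require Import finmap ring lra zify.
From mathcomp.multinomials Require Import monalg.
From mathcomp Require Import boolp classical_sets constructive_ereal.

Set Implicit Arguments.
Unset Strict Implicit.
Unset Printing Implicit Defensive.

Import Order.TTheory GRing.Theory Num.Theory.

Local Open Scope classical_set_scope.
Local Open Scope ring_scope.

(** * Ideals of Noetherian rings *)

(** No localization or quotient is ever formed: ideals are subsets of [C], [loc p] stands for the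
    localization at [p], and [lenle] bounds the number of strict steps in chains, so a lower bound
    on a length comes from exhibiting one chain. The weight is needed because the lexicographic
    order, for instance, gives no filtration indexed by integers, while powers of [p] go linearly
    into the filtration by a positive weight. A weight that agrees with the order on relations
    exists because the homogenized ideal of relations is controlled by finitely many leading terms,
    each imposing finitely many linear inequalities. Krull's height theorem is not assumed; it falls
    out of the two growth estimates. The obstacle in (b) is that [A] need not be Noetherian and that
    primes of [C] need not be contracted from it. A chain of [C] lifts to the finitely generated
    algebra only if its top avoids a certain [g]. Making it avoid [g] may cost the last prime; the
    Jacobson property, in the form [goldman], then supplies a new last prime that avoids [g]
    again. *)

Section IdealTheory.
Variable C : comPzRingType.
Implicit Types (I J p q P Q : set C) (x y z e : C).

Lemma ideal0 I : ideal I -> I 0. Proof. by case. Qed.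

Lemma idealD I x y : ideal I -> I x -> I y -> I (x + y).
Proof. by case=> _ + _; apply. Qed.

Lemma idealM I x y : ideal I -> I y -> I (x * y).
Proof. by case=> _ _; apply. Qed.

Lemma idealMr I x y : ideal I -> I x -> I (x * y).
Proof. by rewrite mulrC; exact: idealM. Qed.

Lemma idealN I x : ideal I -> I x -> I (- x).
Proof. by move=> iI Ix; rewrite -mulN1r; apply: idealM. Qed.

Lemma idealB I x y : ideal I -> I x -> I y -> I (x - y).
Proof. by move=> iI Ix Iy; apply: idealD => //; apply: idealN. Qed.

Lemma ideal_subr I x y : ideal I -> I (x - y) -> I y -> I x.
Proof. by move=> iI Ixy Iy; rewrite -(subrK y x); apply: idealD. Qed.

Lemma ideal_sum (T : Type) (r : seq T) (A : pred T) (F : T -> C) I :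
  ideal I -> (forall i, A i -> I (F i)) -> I (\sum_(i <- r | A i) F i).
Proof.
move=> iI IF; elim/big_ind: _ => //; first exact: ideal0.
by move=> x y; apply: idealD.
Qed.

Lemma ideal1 I : ideal I -> I 1 -> forall x, I x.
Proof. by move=> iI I1 x; rewrite -(mulr1 x); apply: idealM. Qed.

Lemma idealT : ideal (setT : set C).
Proof. by split. Qed.

Lemma ideal_set0 : ideal [set (0 : C)].
Proof.
by split=> // [x y /= -> ->|r x /= ->]; [exact: addr0 | exact: mulr0].
Qed.

Lemma ideal_setI I J : ideal I -> ideal J -> ideal (I `&` J).
Proof.
move=> iI iJ; split; first by split; apply: ideal0.
  by move=> x y [? ?] [? ?]; split; apply: idealD.
by move=> r x [? ?]; split; apply: idealM.
Qed.

Lemma ideal_colon I y : ideal I -> ideal [set x | I (x * y)].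
Proof.
move=> iI; split=> [|a b|r a] /=; first by rewrite mul0r; apply: ideal0.
  by rewrite mulrDl; apply: idealD.
by rewrite -mulrA; apply: idealM.
Qed.

Definition addI I J : set C := [set x | exists2 j, J j & I (x - j)].

Lemma addI_ideal I J : ideal I -> ideal J -> ideal (addI I J).
Proof.
move=> iI iJ; split.
- by exists 0; [exact: ideal0 | rewrite subrr; apply: ideal0].
- move=> x y [j Jj Ij] [k Jk Ik]; exists (j + k); first exact: idealD.
  have -> : x + y - (j + k) = (x - j) + (y - k) by ring.
  exact: idealD.
- move=> r x [j Jj Ij]; exists (r * j); first exact: idealM.
  by rewrite -mulrBr; apply: idealM.
Qed.

Lemma addI_subl I J : ideal J -> I `<=` addI I J.
Proof. by move=> iJ x Ix; exists 0; [exact: ideal0 | rewrite subr0]. Qed.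

Lemma addI_subr I J : ideal I -> J `<=` addI I J.
Proof. by move=> iI x Jx; exists x => //; rewrite subrr; apply: ideal0. Qed.

Definition addp I y : set C := [set x | exists c, I (x - c * y)].

Lemma addp_ideal I y : ideal I -> ideal (addp I y).
Proof.
move=> iI; split.
- by exists 0; rewrite mul0r subrr; apply: ideal0.
- move=> x z [j Ij] [k Ik]; exists (j + k).
  have -> : x + z - (j + k) * y = (x - j * y) + (z - k * y) by ring.
  exact: idealD.
- move=> r x [j Ij]; exists (r * j).
  by rewrite -mulrA -mulrBr; apply: idealM.
Qed.

Lemma addp_sub I y : I `<=` addp I y.
Proof. by move=> x Ix; exists 0; rewrite mul0r subr0. Qed.

Lemma addp_mem I y : ideal I -> addp I y y.
Proof. by move=> iI; exists 1; rewrite mul1r subrr; apply: ideal0. Qed.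

Definition idl (S : set C) : set C := smallest (@ideal C) S.

Lemma idl_ideal (S : set C) : ideal (idl S).
Proof.
split=> [I [iI _]|x y Hx Hy I IS|r x Hx I IS]; first exact: ideal0.
  by case: (IS) => iI _; apply: idealD => //; [apply: Hx | apply: Hy].
by case: (IS) => iI _; apply: idealM => //; apply: Hx.
Qed.

Lemma idl_sub (S : set C) : S `<=` idl S.
Proof. exact: sub_gen_smallest. Qed.

Lemma idl_min (S I : set C) : ideal I -> S `<=` I -> idl S `<=` I.
Proof. exact: smallest_sub. Qed.

Opaque idl.

Lemma idlS (S T : set C) : S `<=` T -> idl S `<=` idl T.
Proof.
move=> ST; apply: idl_min; first exact: idl_ideal.
by move=> x /ST; apply: idl_sub.
Qed.

Lemma idlMl (S T : set C) z :
  (forall x, S x -> T (z * x)) -> forall x, idl S x -> idl T (z * x).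
Proof.
move=> ST x Hx; rewrite mulrC.
apply: (idl_min (ideal_colon z (idl_ideal T)) _ Hx) => y Sy /=.
by rewrite mulrC; apply: idl_sub; apply: ST.
Qed.

Lemma idl_fin (S : set C) x : idl S x ->
  exists2 t : seq C, (forall y, y \in t -> S y) & idl [set y | y \in t] x.
Proof.
pose U : set C := [set x | exists2 t : seq C,
  (forall y, y \in t -> S y) & idl [set y | y \in t] x].
move=> Hx; apply: (idl_min (I := U)) Hx; last first.
  by move=> y Sy; exists [:: y]; [move=> z; rewrite inE => /eqP-> |
    apply: idl_sub; rewrite /= inE].
split; first by exists [::] => //; apply: ideal0; apply: idl_ideal.
- move=> a b [t tS ta] [u uS ub]; exists (t ++ u).
    by move=> y; rewrite mem_cat => /orP[/tS|/uS].
  apply: (idealD (idl_ideal _)).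
    by apply: idlS ta => y /= yt; rewrite mem_cat yt.
  by apply: idlS ub => y /= yt; rewrite mem_cat yt orbT.
- by move=> r a [t tS ta]; exists t => //; apply: (idealM _ (idl_ideal _)).
Qed.

Lemma prime_ideal_ideal P : prime_ideal P -> ideal P. Proof. by case. Qed.

Lemma prime_neg1 P : prime_ideal P -> ~ P 1. Proof. by case. Qed.

Lemma prime_mul P x y : prime_ideal P -> ~ P x -> ~ P y -> ~ P (x * y).
Proof. by move=> [_ _ h] nx ny /h []. Qed.

Lemma prime_exp P x n : prime_ideal P -> ~ P x -> ~ P (x ^+ n).
Proof.
move=> pP nx; elim: n => [|n IH]; first exact: prime_neg1.
by rewrite exprS; apply: prime_mul.
Qed.

(* The preimage of the localization of [I] at [p]. *)
Definition loc p I : set C := [set x | exists2 e, ~ p e & I (e * x)].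

Lemma loc_ideal p I : prime_ideal p -> ideal I -> ideal (loc p I).
Proof.
move=> pp iI; split.
- by exists 1; [exact: prime_neg1 | rewrite mulr0; apply: ideal0].
- move=> x y [e ne ex] [f nf fy]; exists (e * f); first exact: prime_mul.
  have -> : e * f * (x + y) = f * (e * x) + e * (f * y) by ring.
  by apply: idealD => //; apply: idealM.
- move=> r x [e ne ex]; exists e => //.
  have -> : e * (r * x) = r * (e * x) by ring.
  exact: idealM.
Qed.

Lemma loc_sub p I : prime_ideal p -> I `<=` loc p I.
Proof. by move=> pp x Ix; exists 1; [exact: prime_neg1 | rewrite mul1r]. Qed.

Lemma loc_loc p I : prime_ideal p -> loc p (loc p I) `<=` loc p I.
Proof.
move=> pp x [e ne [f nf fx]]; exists (f * e); first exact: prime_mul.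
by rewrite -mulrA.
Qed.

Lemma locS p I J : I `<=` J -> loc p I `<=` loc p J.
Proof. by move=> IJ x [e ne /IJ]; exists e. Qed.

Lemma loc_trans p I J x : prime_ideal p -> I `<=` loc p J -> loc p I x ->
  loc p J x.
Proof. by move=> pp /(locS (p := p)) IJ /IJ; apply: loc_loc. Qed.

Definition mulI I J : set C :=
  idl [set z | exists x y, [/\ I x, J y & z = x * y]].

Lemma mulI_mem I J x y : I x -> J y -> mulI I J (x * y).
Proof. by move=> Ix Jy; apply: idl_sub; exists x, y. Qed.

Lemma mulI_min I J K : ideal K -> (forall x y, I x -> J y -> K (x * y)) ->
  mulI I J `<=` K.
Proof. by move=> iK h; apply: idl_min => // z [x [y [Ix Jy ->]]]; apply: h. Qed.

Lemma mulI_ideal I J : ideal (mulI I J). Proof. exact: idl_ideal. Qed.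

Fixpoint pw p k : set C := if k is k'.+1 then mulI p (pw p k') else setT.

Lemma pw_ideal p k : ideal (pw p k).
Proof. by case: k => [|k] /=; [exact: idealT | exact: mulI_ideal]. Qed.

Lemma pwS p k : pw p k.+1 `<=` pw p k.
Proof.
apply: mulI_min; first exact: pw_ideal.
by move=> x y _ py; apply: idealM => //; apply: pw_ideal.
Qed.

Lemma pwD p m n : pw p (m + n) `<=` mulI (pw p m) (pw p n).
Proof.
elim: m => [|m IH] /=.
  by move=> x px; rewrite -(mul1r x); apply: mulI_mem.
apply: mulI_min; first exact: mulI_ideal.
move=> x y Px /IH; rewrite mulrC; move: y.
apply: (@idl_min _ [set y | mulI (mulI p (pw p m)) (pw p n) (y * x)]).
  by apply: ideal_colon; apply: mulI_ideal.
move=> _ [a [b [pa pb ->]]] /=.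
have -> : a * b * x = (x * a) * b by ring.
by apply: mulI_mem => //; apply: mulI_mem.
Qed.

Lemma pwMn p m n x y : ideal p -> pw p m x -> pw p n y -> pw p (m + n) (x * y).
Proof.
move=> ip; elim: m x y => [|m IH] x y /=.
  by move=> _ py; apply: idealM => //; apply: pw_ideal.
move=> px py; move: x px.
apply: (@idl_min _ [set x | pw p (m + n).+1 (x * y)]).
  by apply: ideal_colon; apply: pw_ideal.
move=> _ [a [b [pa pb ->]]] /=; rewrite -mulrA.
by apply: mulI_mem => //; apply: IH.
Qed.

Section Noetherian.
Hypothesis hC : noetherian C.

Lemma noeth_acc (Z : nat -> set C) : (forall n, ideal (Z n)) ->
  (forall n, Z n `<=` Z n.+1) ->
  exists N, forall n, (N <= n)%N -> Z n `<=` Z N.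
Proof.
move=> iZ sZ.
have mZ m n : (m <= n)%N -> Z m `<=` Z n.
  move=> /subnKC <-; elim: (n - m)%N => [|k IH]; first by rewrite addn0.
  by rewrite addnS; apply: subset_trans IH (sZ _).
pose U := [set x | exists n, Z n x].
have iU : ideal U.
  split; first by exists 0; apply: ideal0.
  - move=> x y [m xm] [n yn]; exists (maxn m n); apply: idealD => //.
      by apply: mZ xm; apply: leq_maxl.
    by apply: mZ yn; apply: leq_maxr.
  - by move=> r x [m xm]; exists m; apply: idealM.
have [g Ug] := hC iU.
have [N hN] : exists N, forall x, x \in g -> Z N x.
  have : forall x, x \in g -> U x by move=> x xg; rewrite Ug; apply: idl_sub.
  elim: g {Ug} => [|a g IH] hg; first by exists 0%N.
  have [N hN] := IH (fun x xg => hg x (@mem_behead _ (a :: g) x xg)).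
  have [n an] := hg a (mem_head _ _).
  exists (maxn n N) => x; rewrite inE => /orP[/eqP->|/hN].
    by apply: mZ an; apply: leq_maxl.
  by apply: mZ; apply: leq_maxr.
exists N => n _ x xn.
have : U x by exists n.
by rewrite Ug; apply: idl_min.
Qed.

Lemma noeth_ind (Phi : set C -> Prop) :
  (forall I, ideal I ->
     (forall J, ideal J -> I `<=` J -> ~ J `<=` I -> Phi J) -> Phi I) ->
  forall I, ideal I -> Phi I.
Proof.
move=> H I iI; apply: contrapT => nI.
pose T := {J : set C | ideal J /\ ~ Phi J}.
have nxt (t : T) : {u : T | sval t `<=` sval u /\ ~ sval u `<=` sval t}.
  case: t => J [iJ nJ] /=; apply: cid; apply: contrapT => hn.
  apply: nJ; apply: H => // K iK JK nKJ; apply: contrapT => nK.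
  by apply: hn; exists (exist _ K (conj iK nK)).
pose t0 : T := exist _ I (conj iI nI).
pose Z n := iter n (fun t => sval (nxt t)) t0.
have := @noeth_acc (fun n => sval (Z n)).
case.
- by move=> n; case: (svalP (Z n)).
- by move=> n; case: (svalP (nxt (Z n))).
move=> N /(_ N.+1 (leqnSn _)).
by case: (svalP (nxt (Z N))).
Qed.

(** Noetherian induction in place of Zorn's lemma: an ideal maximal among those over [I] that are
    disjoint from the multiplicative set [S] is prime. *)
Lemma noeth_prime I (S : set C) : ideal I -> S 1 ->
  (forall x y, S x -> S y -> S (x * y)) -> (forall x, I x -> ~ S x) ->
  exists Q, [/\ prime_ideal Q, I `<=` Q & forall x, Q x -> ~ S x].
Proof.
move=> iI S1 SM; move: I iI; apply: noeth_ind => I iI IH nIS.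
case: (pselect (exists J, [/\ ideal J, I `<=` J, ~ J `<=` I &
  forall x, J x -> ~ S x])) => [[J [iJ IJ nJI nJS]]|nJ].
  have [Q [pQ JQ nQS]] := IH J iJ IJ nJI nJS.
  by exists Q; split => //; apply: subset_trans IJ JQ.
exists I; split=> //; split=> // [I1|x y Ixy]; first exact: (nIS 1).
apply: contrapT => /not_orP [nx ny].
have meet z : ~ I z -> exists2 s, S s & addp I z s.
  move=> nz; apply: contrapT => hs; apply: nJ; exists (addp I z); split.
  - exact: addp_ideal.
  - exact: addp_sub.
  - by move/(_ z (addp_mem _ iI)).
  - by move=> s sI Ss; apply: hs; exists s.
have [s Ss [c hc]] := meet _ nx; have [t St [d hd]] := meet _ ny.
apply: (nIS (s * t)) (SM _ _ Ss St).
have -> : s * t = (s - c * x) * t + c * x * (t - d * y) + c * d * (x * y) by ring.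
by apply: (idealD iI); [apply: (idealD iI); [exact: idealMr|exact: idealM]|exact: idealM].
Qed.

Lemma noeth_maximal_prime I : ideal I -> ~ I 1 ->
  exists2 Q, prime_ideal Q & I `<=` Q.
Proof.
move=> iI I1.
have [|x Ix /= x1|Q [pQ IQ _]] := @noeth_prime I [set 1] iI erefl.
- by move=> x y /= -> ->; rewrite mulr1.
- by apply: I1; rewrite -x1.
by exists Q.
Qed.

(* [prodin Ps I]: the product of the ideals in [Ps] is contained in [I]. *)
Fixpoint prodin (Ps : seq (set C)) I : Prop :=
  if Ps is P :: Ps' then forall x, P x -> prodin Ps' [set y | I (x * y)]
  else I 1.

Lemma prodinS Ps I J : I `<=` J -> prodin Ps I -> prodin Ps J.
Proof.
elim: Ps I J => [|P Ps IH] I J IJ /=; first exact: IJ.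
by move=> h x Px; apply: (IH [set y | I (x * y)]) (h x Px) => y /=; apply: IJ.
Qed.

Lemma prodin_cat Ps Qs I J K : prodin Ps I -> prodin Qs J ->
  (forall x y, I x -> J y -> K (x * y)) -> prodin (Ps ++ Qs) K.
Proof.
elim: Ps I K => [|P Ps IH] I K /= hI hJ hK.
  by apply: prodinS hJ => y Jy; rewrite -(mul1r y); apply: hK.
move=> x Px; apply: (IH [set y | I (x * y)]) => // [|y z hy Jz /=].
  exact: hI.
by rewrite mulrA; apply: hK.
Qed.

Lemma prodin_prime Ps I Q : prime_ideal Q -> I `<=` Q -> prodin Ps I ->
  exists2 P, P \in Ps & P `<=` Q.
Proof.
move=> pQ; elim: Ps I => [|P Ps IH] I IQ /=.
  by move=> /IQ /(prime_neg1 pQ).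
move=> h; case: (pselect (P `<=` Q)) => [PQ|].
  by exists P => //; rewrite mem_head.
move=> /existsNP [x /not_implyP [Px nQx]].
have [||R RPs RQ] := IH [set y | I (x * y)].
- by move=> y /= /IQ; case: pQ => _ _ pr /pr [].
- exact: h.
by exists R => //; rewrite inE RPs orbT.
Qed.

(** If [x * y] lies in [I] but neither factor does, the lists for [I + (x)] and [I + (y)] are
    concatenated. This replaces primary decomposition: it yields finiteness and existence of minimal
    primes, and nilpotency of [p] modulo [I] at a minimal prime [p]. *)
Lemma prime_list I : ideal I -> exists Ps : seq (set C),
  (forall P, P \in Ps -> prime_ideal P /\ I `<=` P) /\ prodin Ps I.
Proof.
move: I; apply: noeth_ind => I iI IH.
case: (pselect (I 1)) => [I1|nI1]; first by exists [::].
case: (pselect (prime_ideal I)) => [pI|].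
  by exists [:: I]; split=> [P|x Ix /=]; [rewrite inE => /eqP->; split | rewrite mulr1].
move=> npI.
have [x [y [Ixy nx ny]]] : exists x y, [/\ I (x * y), ~ I x & ~ I y].
  apply: contrapT => hn; apply: npI; split=> // x y Ixy.
  by apply: contrapT => /not_orP [nx ny]; apply: hn; exists x, y.
have step z : ~ I z -> exists Ps : seq (set C),
  (forall P, P \in Ps -> prime_ideal P /\ I `<=` P) /\ prodin Ps (addp I z).
  move=> nz; have [||Ps [h1 h2]] := IH (addp I z) (addp_ideal z iI).
  - exact: addp_sub.
  - by move/(_ z (addp_mem _ iI)).
  exists Ps; split=> // P /h1 [pP sP]; split=> //.
  by apply: subset_trans sP; apply: addp_sub.
have [Ps [hP1 hP2]] := step x nx; have [Qs [hQ1 hQ2]] := step y ny.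
exists (Ps ++ Qs); split=> [P|]; first by rewrite mem_cat => /orP[/hP1|/hQ1].
apply: prodin_cat hP2 hQ2 _ => a b [c hc] [d hd].
have -> : a * b = (a - c * x) * b + c * x * (b - d * y) + c * d * (x * y) by ring.
by apply: (idealD iI); [apply: (idealD iI); [exact: idealMr|exact: idealM]|exact: idealM].
Qed.

Definition minprime I p : Prop := [/\ prime_ideal p, I `<=` p &
  forall q, prime_ideal q -> I `<=` q -> q `<=` p -> p `<=` q].

Lemma minprime_list I : ideal I -> exists Ps : seq (set C),
  (forall P, P \in Ps -> prime_ideal P) /\ forall P, minprime I P -> P \in Ps.
Proof.
move=> iI; have [Ps [h1 h2]] := prime_list iI.
exists Ps; split=> [P /h1 []//|P [pP IP mP]].
have [Q QPs QP] := prodin_prime pP IP h2.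
have [pQ IQ] := h1 _ QPs.
suff -> : P = Q by [].
by apply/seteqP; split=> //; apply: mP.
Qed.

Lemma exists_minprime I p : ideal I -> prime_ideal p -> I `<=` p ->
  exists2 q, minprime I q & q `<=` p.
Proof.
move=> iI pp Ip; have [Ps [h1 h2]] := prime_list iI.
have [Q QPs Qp] := prodin_prime pp Ip h2.
have minl : forall (Qs : seq (set C)) Q, Q \in Qs -> exists R, [/\ R \in Qs,
    R `<=` Q & forall S, S \in Qs -> S `<=` R -> R `<=` S].
  elim=> // P Qs IH Q'.
  have step S : S \in Qs -> S `<=` Q' -> exists R, [/\ R \in P :: Qs, R `<=` Q' &
      forall S, S \in P :: Qs -> S `<=` R -> R `<=` S].
    move=> /IH [R [RQs RS mR]] SQ'.
    case: (pselect (P `<=` R)) => PR.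
      exists P; split; first by rewrite mem_head.
        by apply: subset_trans PR (subset_trans RS SQ').
      move=> U; rewrite inE => /orP[/eqP->//|UQs] UP.
      by apply: subset_trans PR (mR _ UQs (subset_trans UP PR)).
    exists R; split; [by rewrite inE RQs orbT | exact: subset_trans RS SQ' |].
    by move=> U; rewrite inE => /orP[/eqP->//|]; apply: mR.
  rewrite inE => /orP[/eqP eQ|/step]; last by apply.
  case: (pselect (exists2 S, S \in Qs & S `<=` Q')) => [[S]|nS]; first exact: step.
  exists P; split; [by rewrite mem_head | by rewrite eQ |].
  move=> S; rewrite inE => /orP[/eqP->//|SQs] SP.
  by case: nS; exists S => //; rewrite eQ.
have [R [RPs RQ mR]] := minl _ _ QPs.
have [pR IR] := h1 _ RPs.
exists R; last exact: subset_trans RQ Qp.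
split=> // S pS IS SR; have [T TPs TS] := prodin_prime pS IS h2.
by apply: subset_trans (TS); apply: mR => //; apply: subset_trans TS SR.
Qed.

(** Localized at [p], the primes of the list not contained in [p] become the unit ideal and the
    others equal [p]; so the power of [p] whose exponent is the length of the list falls into
    [I]. *)
Lemma minprime_pw I p : ideal I -> minprime I p -> exists k, pw p k `<=` loc p I.
Proof.
move=> iI [pp Ip mp]; have [Ps [h1 h2]] := prime_list iI.
exists (size Ps).
have hP P : P \in Ps -> P `<=` p -> p `<=` P by move=> /h1[]; apply: mp.
clear h1; elim: Ps I {Ip mp} iI h2 hP => [|P Ps IH] I iI /=.
  by move=> I1 _ x _; apply: loc_sub => //; apply: ideal1.
move=> h hP; have hP' := fun Q QPs => hP Q (mem_behead (s := P :: Ps) QPs).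
have iIx x : ideal [set y | I (x * y)].
  have -> : [set y | I (x * y)] = [set y | I (y * x)].
    by apply/seteqP; split=> y /=; rewrite mulrC.
  exact: ideal_colon.
case: (pselect (P `<=` p)) => [Pp|].
  have pP := hP P (mem_head _ _) Pp.
  apply: mulI_min; first exact: loc_ideal.
  move=> x y /pP /h /(IH _ (iIx x)) /(_ hP') /[apply] -[e ne /=].
  by exists e => //; rewrite mulrCA.
move=> /existsNP [x /not_implyP [Px nx]].
apply: subset_trans (@pwS _ _) _.
move=> y /(IH _ (iIx x) (h _ Px) hP') [e ne /= Ie].
by exists (x * e); [exact: prime_mul | rewrite -mulrA].
Qed.

Lemma prime_avoidance I (Ps : seq (set C)) : ideal I ->
  (forall P, P \in Ps -> prime_ideal P /\ ~ I `<=` P) ->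
  exists2 x, I x & forall P, P \in Ps -> ~ P x.
Proof.
move=> iI; have [n] := ubnP (size Ps); elim: n Ps => // n IH [|P Ps] /=.
  by exists 0; first exact: ideal0.
rewrite ltnS => sz hP; have [pP nIP] := hP P (mem_head _ _).
have hP' Q : Q \in Ps -> prime_ideal Q /\ ~ I `<=` Q.
  by move=> QPs; apply: hP; rewrite inE QPs orbT.
(* If some [Q] lies inside [P], avoiding [P] avoids [Q], and [Q] can be removed from the list. *)
case: (pselect (exists2 Q, Q \in Ps & Q `<=` P)) => [[Q QPs QP]|nQ].
  have [||x Ix nx] := IH (P :: rem Q Ps).
  - rewrite /= size_rem // prednK //; first by case: (Ps) QPs.
  - by move=> R; rewrite inE => /orP[/eqP->//|/mem_rem]; apply: hP'.
  exists x => // R; rewrite inE => /orP[/eqP->|RPs]; first by apply: nx; rewrite mem_head.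
  case: (R =P Q) => [->|nRQ].
    by move=> /QP; apply: nx; rewrite mem_head.
  apply: nx; rewrite inE; apply/orP; right.
  move: RPs nRQ; move: (perm_to_rem QPs) => /perm_mem ->.
  by rewrite inE => /orP[/eqP|].
have [x Ix nx] := IH Ps sz hP'.
case: (pselect (P x)) => [Px|nPx]; last first.
  by exists x => // R; rewrite inE => /orP[/eqP->|/nx].
(* [x] misses every prime of [Ps] but lies in [P]; [y] behaves the other way round, so [x + y] lies
   in none of them. *)
have [y [Iy yPs nPy]] : exists y, [/\ I y, forall Q, Q \in Ps -> Q y & ~ P y].
  have : forall Q, Q \in Ps -> prime_ideal Q /\ ~ Q `<=` P.
    by move=> Q QPs; split; [case: (hP' Q QPs) | move=> QP; apply: nQ; exists Q].
  elim: (Ps) => [|Q Qs IHQ] hQ.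
    by move/existsNP: nIP => [y /not_implyP [Iy nPy]]; exists y.
  have [y [Iy yQs nPy]] := IHQ (fun R RQs => hQ R (mem_behead (s := Q :: Qs) RQs)).
  have [pQ /existsNP [z /not_implyP [Qz nPz]]] := hQ Q (mem_head _ _).
  exists (y * z); split; [exact: idealMr | | exact: prime_mul].
  move=> R; rewrite inE => /orP[/eqP->|RQs].
    by apply: idealM => //; apply: prime_ideal_ideal.
  apply: idealMr; last exact: yQs.
  by case: (hQ R (mem_behead (s := Q :: Qs) RQs)) => /prime_ideal_ideal.
exists (x + y); first exact: idealD.
move=> R; rewrite inE => /orP[/eqP->|RPs] Rxy.
  by apply: nPy; rewrite -(addKr x y) addrC; apply: idealB => //; apply: prime_ideal_ideal.
apply: (nx R RPs); rewrite -(addrK y x); apply: idealB => //; last exact: yPs.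
by case: (hP' R RPs) => /prime_ideal_ideal.
Qed.

End Noetherian.
End IdealTheory.

(** * Local lengths *)

Section Length.
Variables (C : comPzRingType) (p : set C).
Hypothesis pp : prime_ideal p.
Implicit Types (I J X Y W : set C) (x y z e : C).

(* The length of [Y / X] after localization at [p] is at most [m]. *)
Definition lenle X Y (m : nat) : Prop := forall Z : nat -> set C,
  (forall i, ideal (Z i)) -> (forall i, Z i `<=` Z i.+1) ->
  X `<=` loc p (Z 0%N) -> (forall i, Z i `<=` loc p Y) ->
  forall L, (\sum_(i < L) ~~ `[< Z i.+1 `<=` loc p (Z i) >] <= m)%N.

Lemma lenle_weaken X Y X' Y' m m' : lenle X Y m -> X `<=` loc p X' ->
  Y' `<=` loc p Y -> (m <= m')%N -> lenle X' Y' m'.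
Proof.
move=> h XX' YY' mm' Z iZ sZ XZ ZY L; apply: leq_trans mm'; apply: h => //.
  by move=> x /XX' /(loc_trans pp XZ).
by move=> i x /ZY /(loc_trans pp YY').
Qed.

(* By the modular law, a step of a chain is strict after intersection with [Y]
   or after addition of [Y]. *)
Lemma lenle_trans X Y W m m' : ideal Y -> ideal W ->
  X `<=` loc p Y -> Y `<=` loc p W ->
  lenle X Y m -> lenle Y W m' -> lenle X W (m + m').
Proof.
move=> iY iW XY YW h h' Z iZ sZ XZ ZW L.
pose Z1 i := Z i `&` loc p Y; pose Z2 i := addI (Z i) Y.
have b1 : (\sum_(i < L) ~~ `[< Z1 i.+1 `<=` loc p (Z1 i) >] <= m)%N.
  apply: h => [i|i x [/sZ ? ?]|x Xx|i x []//]; last 1 first.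
  - have [e ne ex] := XZ _ Xx; exists e => //; split=> //.
    by apply: (idealM _ (loc_ideal pp iY)); apply: XY.
  - by apply: ideal_setI => //; apply: loc_ideal.
  - by split.
have b2 : (\sum_(i < L) ~~ `[< Z2 i.+1 `<=` loc p (Z2 i) >] <= m')%N.
  apply: h' => [i|i x [y Yy hz]|x Yx|i x [y Yy hz]].
  - exact: addI_ideal.
  - by exists y => //; apply: sZ.
  - by apply: loc_sub => //; apply: addI_subr.
  - rewrite -(subrK y x); apply: (idealD (loc_ideal pp iW)); last exact: YW.
    exact: ZW hz.
apply: leq_trans (leq_add b1 b2); rewrite -big_split /=; apply: leq_sum => i _.
case: (pselect (Z i.+1 `<=` loc p (Z i))) => [/asboolP->//|nZ].
have -> : ~~ `[< Z i.+1 `<=` loc p (Z i) >] by apply/asboolPn.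
suff : ~~ `[< Z1 i.+1 `<=` loc p (Z1 i) >] || ~~ `[< Z2 i.+1 `<=` loc p (Z2 i) >].
  by case/orP => ->; rewrite ?addn1 ?addnS.
rewrite -negb_and; apply/negP => /andP [/asboolP s1 /asboolP s2]; apply: nZ.
move=> z Zz; have [|e ne [y Yy hy]] := s2 z; first exact: addI_subl.
have Zy : Z i.+1 y.
  have -> : y = e * z - (e * z - y) by ring.
  by apply: idealB => //; [apply: idealM | apply: sZ].
have [|f nf [fy _]] := s1 y; first by split=> //; apply: loc_sub.
exists (f * e); first exact: prime_mul.
have -> : f * e * z = f * (e * z - y) + f * y by ring.
by apply: idealD => //; apply: idealM.
Qed.

(** The residue ring at [p] is a field: a chain stays at [p] locally until a member contains an
    element outside [p], and from then on it is the whole ring. *)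
Lemma lenle_prime : lenle p setT 1.
Proof.
move=> Z iZ sZ pZ _ L.
have pin i : Z i `<=` p -> p `<=` loc p (Z i).
  move=> Zp x /pZ [e ne ex]; exists e => //; elim: (i) => // k; exact: sZ.
have big i : ~ Z i `<=` p -> forall j, (i <= j)%N -> Z j.+1 `<=` loc p (Z j).
  move=> /existsNP [e /not_implyP [Ze ne]] j ij x _; exists e => //.
  apply: idealMr => //; rewrite -(subnK ij); elim: (j - i)%N => // k; exact: sZ.
elim: L => [|L IH]; first by rewrite big_ord0.
rewrite big_ord_recr /=; case: (pselect (Z L `<=` p)) => [Zp|nZp]; last first.
  by move/big: nZp => /(_ _ (leqnn L)) /asboolP ->; rewrite addn0.
rewrite big1 ?leq_b1 // => i _; apply/eqP; rewrite eqb0 negbK; apply/asboolP.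
have mono j k : (j <= k)%N -> Z j `<=` Z k.
  move=> /subnK <-; elim: (k - j)%N => // n IHn; apply: subset_trans IHn (sZ _).
apply: subset_trans (pin i _); last exact: subset_trans (mono _ _ (ltnW (ltn_ord i))) Zp.
exact: subset_trans (mono _ _ (ltn_ord i)) Zp.
Qed.

(** Multiplication by [y] maps [C / I] locally onto [addp X y / X]; chains of the target are pulled
    back along it. *)
Lemma lenle_addp I X y m : ideal X -> lenle I setT m ->
  (forall x, I x -> loc p X (x * y)) -> lenle X (addp X y) m.
Proof.
move=> iX h IX Z iZ sZ XZ ZX L.
pose Z1 i : set C := [set c | loc p (Z i) (c * y)].
have iL i := loc_ideal pp (iZ i).
have b1 : (\sum_(i < L) ~~ `[< Z1 i.+1 `<=` loc p (Z1 i) >] <= m)%N.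
  apply: h => [i|i x|x Ix|i x _].
  - exact: (ideal_colon y (iL i)).
  - by apply: locS; apply: sZ.
  - by apply: loc_sub => //; apply: loc_trans (IX _ Ix).
  - exact: loc_sub.
apply: leq_trans b1; apply: leq_sum => i _.
case: (pselect (Z1 i.+1 `<=` loc p (Z1 i))) => [s1|/asboolPn->]; last exact: leq_b1.
suff /asboolP-> : Z i.+1 `<=` loc p (Z i) by [].
have XZi j : X `<=` loc p (Z j).
  move=> x /XZ [e ne ex]; exists e => //; elim: (j) => // k; exact: sZ.
move=> z Zz; have [e ne [c hc]] := ZX _ _ Zz.
have [|f nf hf] := s1 c.
  rewrite /Z1 /=; have -> : c * y = e * z - (e * z - c * y) by ring.
  apply: (idealB (iL _)); last exact: XZi.
  by apply: (idealM _ (iL _)); apply: loc_sub.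
apply: loc_loc => //; exists (f * e); first exact: prime_mul.
have -> : f * e * z = f * (e * z - c * y) + f * c * y by ring.
by apply: (idealD (iL _)) => //; apply: (idealM _ (iL _)); apply: XZi.
Qed.

Lemma lenle_addI I X m (ys : seq C) : ideal X -> lenle I setT m ->
  (forall y, y \in ys -> forall x, I x -> loc p X (x * y)) ->
  lenle X (addI X (idl [set y | y \in ys])) (m * size ys).
Proof.
move=> + h; elim: ys X => [|y ys IH] X iX hX.
  rewrite muln0 => Z iZ sZ XZ ZX L; rewrite big1 // => i _.
  apply/eqP; rewrite eqb0 negbK; apply/asboolP => z /ZX.
  apply: loc_trans => // {}z [j hj Xzj]; rewrite -(subrK j z).
  have iL := loc_ideal pp (iZ i).
  apply: (idealD iL); last first.
    suff -> : j = 0 by apply: ideal0.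
    by apply: (idl_min (ideal_set0 C) _ hj) => w.
  have [e ne ex] := XZ _ Xzj; exists e => //; elim: (nat_of_ord i) => // k; exact: sZ.
rewrite mulnS; set Y := addp X y.
have iY : ideal Y by apply: addp_ideal.
have XY : X `<=` Y by apply: addp_sub.
have iW := addI_ideal iY (idl_ideal [set y | y \in ys]).
have tr : lenle X (addI Y (idl [set y | y \in ys])) (m + m * size ys).
  apply: (@lenle_trans _ Y) => //.
  - by move=> x /XY; apply: loc_sub.
  - move=> x Yx; apply: loc_sub => //; apply: addI_subl => //; exact: idl_ideal.
  - apply: lenle_addp h _ => //; apply: hX; exact: mem_head.
  - apply: IH => // z zys x Ix; apply: (locS XY); apply: hX => //.
    by rewrite inE zys orbT.
apply: (lenle_weaken tr) => //; first by move=> x; apply: loc_sub.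
move=> x hx; apply: loc_sub => //; move: x hx => x [j hj Xj].
rewrite -(subrK j x); apply: (idealD iW).
  by apply: addI_subl; [exact: idl_ideal | apply: XY].
apply: (idl_min iW _ hj) => w; rewrite /= inE => /orP [/eqP->|wys].
  apply: addI_subl; [exact: idl_ideal | exact: addp_mem].
by apply: addI_subr => //; apply: idl_sub.
Qed.

(** Locally, each layer between consecutive powers of [p] is a vector space over the residue field
    spanned by finitely many generators of the larger power. *)
Lemma lenle_pw k : noetherian C -> exists m, lenle (pw p k) setT m.
Proof.
move=> hC; elim: k => [|k [m IH]].
  exists 0%N => Z iZ sZ XZ _ L; rewrite big1 // => i _.
  apply/eqP; rewrite eqb0 negbK; apply/asboolP => z _.
  have [e ne ex] := XZ z I; exists e => //; elim: (nat_of_ord i) => // k; exact: sZ.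
have [g gE] := hC _ (pw_ideal p k).
exists (1 * size g + m)%N; apply: lenle_trans IH => //.
- exact: pw_ideal.
- by move=> x /pwS; apply: loc_sub.
- by move=> x _; apply: loc_sub.
apply: lenle_weaken (lenle_addI (ys := g) (pw_ideal p k.+1) lenle_prime _) _ _ _ => //.
- move=> y yg x px; apply: loc_sub => //=; apply: mulI_mem => //.
  by rewrite gE; apply: idl_sub.
- by move=> x; apply: loc_sub.
- rewrite gE => x hx; apply: loc_sub => //; apply: addI_subr => //.
  exact: pw_ideal.
Qed.

Lemma lenle_lower X m L (x : nat -> C) : ideal X -> lenle X setT m ->
  (forall i, (i < L)%N -> ~ loc p (addI X (idl [set x j | j in [set j | (j < i)%N]])) (x i)) ->
  (L <= m)%N.
Proof.
move=> iX h hx.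
pose Z i := addI X (idl [set x j | j in [set j | (j < i)%N]]).
have : (\sum_(i < L) ~~ `[< Z i.+1 `<=` loc p (Z i) >] <= m)%N.
  apply: h => // [i|i z [j hj Xj]|z Xz|i z _].
  - apply: addI_ideal => //; exact: idl_ideal.
  - exists j => //; apply: idlS hj => w [k /= ki <-]; exists k => //=; exact: ltnW.
  - apply: loc_sub => //; apply: addI_subl => //; exact: idl_ideal.
  - by apply: loc_sub.
rewrite (eq_bigr (fun=> 1%N)) ?sum1_card ?card_ord // => i _.
apply/eqP; rewrite eqb1; apply/asboolPn => s; apply: (hx i) => //; apply: s.
by apply: addI_subr => //; apply: idl_sub; exists (nat_of_ord i) => /=.
Qed.
End Length.

(** * Systems of inequalities and monotone families of ideals *)

(** The midpoint of the largest lower and the smallest upper bound works: the two can coincide only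
    if no strict bound attains that value. *)
Lemma interval_pick (Lo Hi : seq (rat * bool)) :
  (forall l h, l \in Lo -> h \in Hi ->
     l.1 <= h.1 /\ (l.2 || h.2 -> l.1 < h.1)) ->
  exists t, (forall l, l \in Lo -> l.1 <= t /\ (l.2 -> l.1 < t)) /\
            (forall h, h \in Hi -> t <= h.1 /\ (h.2 -> t < h.1)).
Proof.
have maxl (L : seq (rat * bool)) : L != [::] ->
    exists2 m, m \in L & forall l, l \in L -> l.1 <= m.1.
  elim: L => // a [|b L] IH _.
    by exists a; rewrite ?mem_head // => l; rewrite inE => /eqP->.
  have [m mL hm] := IH isT; case: (lerP m.1 a.1) => ma.
    exists a; first by rewrite mem_head.
    by move=> l; rewrite inE => /orP[/eqP->//|/hm /le_trans]; apply.
  exists m; first by rewrite inE mL orbT.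
  by move=> l; rewrite inE => /orP[/eqP->|/hm//]; apply: ltW.
have minl (L : seq (rat * bool)) : L != [::] ->
    exists2 m, m \in L & forall l, l \in L -> m.1 <= l.1.
  move=> Ln; have [|m] := maxl [seq (- l.1, l.2) | l <- L]; first by case: (L) Ln.
  move=> /mapP [l lL ->] /= hl; exists l => // k kL.
  by rewrite -lerN2; apply: (hl (- k.1, k.2)); apply/mapP; exists k.
move=> hLH; case: (altP (Lo =P [::])) => [->|/maxl [l lLo hl]].
  case: (altP (Hi =P [::])) => [->|/minl [h hHi hh]]; first by exists 0.
  exists (h.1 - 1); split=> // k /hh hk.
  by split=> [|_]; lra.
case: (altP (Hi =P [::])) => [->|/minl [h hHi hh]].
  exists (l.1 + 1); split=> // k /hl hk.
  by split=> [|_]; lra.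
have [lh _] := hLH _ _ lLo hHi.
exists ((l.1 + h.1) / 2); split=> k kin.
  have kl := hl _ kin; split=> [|k2]; first by lra.
  have [_ /(_ _)] := hLH _ _ kin hHi; rewrite k2 => /(_ isT) kh; lra.
have kh := hh _ kin; split=> [|k2]; first by lra.
have [_ /(_ _)] := hLH _ _ lLo kin; rewrite k2 orbT => /(_ isT) lk; lra.
Qed.

(* Motzkin's transposition theorem by Fourier-Motzkin elimination; the Boolean
   tells which of the inequalities are strict. *)
Lemma fourier_motzkin (s : nat) (K : 'rV[rat]_s -> bool -> Prop) :
  (forall d b d' b', K d b -> K d' b' -> K (d + d') (b || b')) ->
  (forall c d b, 0 < c -> K d b -> K (c *: d) b) ->
  ~ K 0 true ->
  forall L : seq ('rV[rat]_s * bool), (forall l, l \in L -> K l.1 l.2) ->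
  exists w : 'cV[rat]_s, forall l, l \in L ->
    0 <= (l.1 *m w) 0 0 /\ (l.2 -> 0 < (l.1 *m w) 0 0).
Proof.
move=> Kadd Kscale K0 L KL.
suff gen k : (k <= s)%N -> forall L : seq ('rV[rat]_s * bool),
    (forall l, l \in L -> K l.1 l.2) ->
    (forall l, l \in L -> forall i : 'I_s, (k <= i)%N -> l.1 0 i = 0) ->
    exists w : 'cV[rat]_s, forall l, l \in L ->
      0 <= (l.1 *m w) 0 0 /\ (l.2 -> 0 < (l.1 *m w) 0 0).
  by apply: (gen s) => // l _ i; rewrite leqNgt ltn_ord.
elim: k {L KL} => [|k IH] ks L KL hL.
  exists 0 => l lL; have l0 : l.1 = 0.
    by apply/rowP => i; rewrite mxE; apply: hL.
  rewrite l0 mul0mx mxE; split=> // l2; case: K0.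
  by have := KL _ lL; rewrite l0 l2.
pose i0 := Ordinal ks.
pose P := [seq ((l.1 0 i0)^-1 *: l.1, l.2) | l : 'rV[rat]_s * bool <- L & 0 < l.1 0 i0].
pose N := [seq ((- l.1 0 i0)^-1 *: l.1, l.2) | l : 'rV[rat]_s * bool <- L & l.1 0 i0 < 0].
pose Z := [seq l : 'rV[rat]_s * bool <- L | l.1 0 i0 == 0].
(* The coordinate [i0], scaled to 1 or -1, is cancelled between every positive and every negative
   inequality. [K] is closed under both operations, so a contradiction [0 < 0] reached in the end
   would be an instance of [K 0 true]. *)
pose L' := Z ++ [seq (x.1 + y.1, x.2 || y.2) | x <- P, y <- N].
have KP l : l \in P -> [/\ K l.1 l.2, l.1 0 i0 = 1 &
    forall i : 'I_s, (k.+1 <= i)%N -> l.1 0 i = 0].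
  move=> /mapP [x]; rewrite mem_filter => /andP [xp xL] -> /=; split.
  - by apply: Kscale; [rewrite invr_gt0 | apply: KL].
  - by rewrite mxE mulVf // gt_eqF.
  - by move=> i ki; rewrite mxE (hL _ xL _ ki) mulr0.
have KN l : l \in N -> [/\ K l.1 l.2, l.1 0 i0 = -1 &
    forall i : 'I_s, (k.+1 <= i)%N -> l.1 0 i = 0].
  move=> /mapP [x]; rewrite mem_filter => /andP [xp xL] -> /=; split.
  - by apply: Kscale; [rewrite invr_gt0 oppr_gt0 | apply: KL].
  - by rewrite mxE invrN mulNr mulVf // lt_eqF.
  - by move=> i ki; rewrite mxE (hL _ xL _ ki) mulr0.
have [||w hw] := IH (ltnW ks) L'.
- move=> l; rewrite mem_cat mem_filter => /orP [/andP [_ /KL]//|].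
  by move=> /allpairsP [[x y] /= [/KP [Kx _ _] /KN [Ky _ _] ->]]; apply: Kadd.
- move=> l hl i; rewrite leq_eqVlt => /orP [/eqP ki|ki].
    have -> : i = i0 by apply: val_inj.
    move: hl; rewrite mem_cat mem_filter => /orP [/andP [/eqP]//|].
    by move=> /allpairsP [[x y] /= [/KP [_ x1 _] /KN [_ y1 _] ->]];
      rewrite mxE x1 y1 subrr.
  move: hl; rewrite mem_cat mem_filter => /orP [/andP [_ /hL]|]; first exact.
  by move=> /allpairsP [[x y] /= [/KP [_ _ x1] /KN [_ _ y1] ->]];
    rewrite mxE x1 // y1 // addr0.
pose dot (d : 'rV[rat]_s) := (d *m w) 0 0.
have [|t [tlo thi]] := @interval_pick [seq (- dot x.1, x.2) | x <- P]
   [seq (dot y.1, y.2) | y <- N].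
  move=> _ _ /mapP [x xP ->] /mapP [y yN ->] /=.
  have [|h1 h2] := hw (x.1 + y.1, x.2 || y.2).
    by rewrite mem_cat; apply/orP; right; apply/allpairsP; exists (x, y).
  move: h1 h2 => /=; rewrite mulmxDl mxE -/(dot x.1) -/(dot y.1) => h1 h2.
  by split=> [|/h2]; lra.
exists (w + t *: delta_mx i0 0) => l lL.
have dE : (l.1 *m (w + t *: delta_mx i0 0)) 0 0 = dot l.1 + t * l.1 0 i0.
  rewrite mulmxDr mxE -scalemxAr [X in _ + X]mxE /dot; congr (_ + _ * _).
  rewrite mxE (bigD1 i0) //= big1 ?addr0 ?mxE ?eqxx ?mulr1 // => i ii0.
  by rewrite !mxE (negPf ii0) mulr0.
rewrite dE; case: (ltrgtP (l.1 0 i0) 0) => [neg|pos|zero].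
- have [|h1 h2] := thi ((dot ((- l.1 0 i0)^-1 *: l.1)), l.2).
    by apply/mapP; exists ((- l.1 0 i0)^-1 *: l.1, l.2) => //;
      apply/mapP; exists l => //; rewrite mem_filter neg.
  move: h1 h2 => /=; rewrite /dot -scalemxAl mxE -/(dot l.1).
  have n0 : 0 < - l.1 0 i0 by rewrite oppr_gt0.
  rewrite mulrC ler_pdivlMr // ltr_pdivlMr // => h1 h2.
  by split=> [|/h2 {}h1]; lra.
- have [|h1 h2] := tlo (- (dot ((l.1 0 i0)^-1 *: l.1)), l.2).
    by apply/mapP; exists ((l.1 0 i0)^-1 *: l.1, l.2) => //;
      apply/mapP; exists l => //; rewrite mem_filter pos.
  move: h1 h2 => /=; rewrite /dot -scalemxAl mxE -/(dot l.1).
  rewrite mulrC -mulNr ler_pdivrMr // ltr_pdivrMr // => h1 h2.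
  by split=> [|/h2 {}h1]; lra.
- rewrite zero mulr0 addr0; apply: hw.
  by rewrite mem_cat mem_filter zero eqxx lL.
Qed.

(** [low N] finds an index where [c] attains its minimum over all indices from [N] on; it is
    iterated from the successor of each index found. *)
Lemma nondecreasing_subseq (c : nat -> nat) : exists phi : nat -> nat,
  (forall m n, (m < n)%N -> (phi m < phi n)%N) /\
  (forall m n, (m <= n)%N -> (c (phi m) <= c (phi n))%N).
Proof.
have low N : {n | (N <= n)%N /\ forall m, (n <= m)%N -> (c n <= c m)%N}.
  apply: cid; pose Q k := `[< exists2 n, (N <= n)%N & c n = k >].
  have exQ : exists k, Q k by exists (c N); apply/asboolP; exists N.
  case: (ex_minnP exQ) => k /asboolP [n Nn cn] mk; exists n; split=> // m nm.
  by rewrite cn; apply: mk; apply/asboolP; exists m => //; apply: leq_trans nm.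
pose g N := sval (low N).
pose phi := fix phi n := if n is n'.+1 then g (phi n').+1 else g 0%N.
have pS n : (phi n < phi n.+1)%N by case: (svalP (low (phi n).+1)).
have plt m n : (m < n)%N -> (phi m < phi n)%N.
  move=> /subnK <-; elim: (n - m.+1)%N => [|k IH]; first exact: pS.
  by rewrite addSn; apply: ltn_trans IH (pS _).
exists phi; split=> // m n; rewrite leq_eqVlt => /orP [/eqP->//|/plt/ltnW].
by case: m => [|m]; [case: (svalP (low 0%N)) | case: (svalP (low (phi m).+1))] => _;
  apply.
Qed.

Lemma dickson_subseq (k : nat) (f : nat -> nat -> nat) :
  exists phi : nat -> nat, (forall m n, (m < n)%N -> (phi m < phi n)%N) /\
    forall i, (i < k)%N -> forall m n, (m <= n)%N ->
      (f i (phi m) <= f i (phi n))%N.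
Proof.
elim: k => [|k [phi [p1 p2]]]; first by exists id.
have [psi [q1 q2]] := nondecreasing_subseq (fun n => f k (phi n)).
exists (fun n => phi (psi n)); split=> [m n /q1/p1//|i].
rewrite ltnS leq_eqVlt => /orP [/eqP->//|ik] m n mn; apply: p2 => //.
by move: mn; rewrite leq_eqVlt => /orP [/eqP->//|/q1/ltnW].
Qed.

Notation expo n := {ffun 'I_n -> nat}.

Definition expo_le n (u v : expo n) := [forall i, (u i <= v i)%N].

(** Otherwise there is a sequence of indices none of which is controlled by an earlier one. By
    Dickson's lemma a subsequence increases in every coordinate ([t] counts as coordinate 0); along
    it the ideals ascend, so they stabilize, a contradiction. *)
Lemma finite_basis (R : comPzRingType) (n : nat) (E : nat -> expo n -> set R) :
  noetherian R -> (forall t v, ideal (E t v)) ->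
  (forall t t' v v', (t <= t')%N -> expo_le v v' -> E t v `<=` E t' v') ->
  exists B : seq (nat * expo n), forall t v, exists2 b, b \in B &
    [/\ (b.1 <= t)%N, expo_le b.2 v & E t v `<=` E b.1 b.2].
Proof.
move=> hR iE mE; apply: contrapT => hn.
have bad (B : seq (nat * expo n)) : {j : nat * expo n | forall b, b \in B ->
    ~ [/\ (b.1 <= j.1)%N, expo_le b.2 j.2 & E j.1 j.2 `<=` E b.1 b.2]}.
  apply: cid; apply: contrapT => hB; apply: hn; exists B => t v.
  apply: contrapT => hb; apply: hB; exists (t, v) => b bB h.
  by apply: hb; exists b.
pose S := fix S k := if k is k'.+1 then sval (bad (S k')) :: S k' else [::].
pose j k := sval (bad (S k)).
have jS m k : (m < k)%N -> j m \in S k.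
  move=> /subnK <-; elim: (k - m.+1)%N => [|l IH] /=; first by rewrite mem_head.
  by rewrite inE IH orbT.
pose f i k := if i is i'.+1 then (if insub i' is Some i'' then (j k).2 i'' else 0%N)
              else (j k).1.
have [phi [p1 p2]] := dickson_subseq n.+1 f.
have jmono k l : (k <= l)%N -> (((j (phi k)).1 <= (j (phi l)).1)%N *
    expo_le (j (phi k)).2 (j (phi l)).2)%type.
  move=> kl; split; first exact: (p2 0%N).
  apply/forallP => i; have := p2 i.+1 (ltn_ord i) _ _ kl.
  by rewrite /f /= insubT //= => lti; rewrite (_ : Sub _ _ = i) //; apply: val_inj.
have [||N hN] := @noeth_acc _ hR (fun k => E (j (phi k)).1 (j (phi k)).2).
- by move=> k; apply: iE.
- by move=> k; apply: mE; have [] := jmono _ _ (leqnSn k).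
have := svalP (bad (S (phi N.+1))) _ (jS _ _ (p1 _ _ (ltnSn N))).
by apply; have [h1 h2] := jmono _ _ (leqnSn N); split=> //; apply: hN.
Qed.

(** * Monomials and monomial orders *)

Section Exponents.
Variable n : nat.
Implicit Types u v : expo n.

Definition addX u v : expo n := [ffun i => (u i + v i)%N].
Definition zeroX : expo n := [ffun=> 0%N].
Definition unitX (i : 'I_n) : expo n := [ffun j => nat_of_bool (j == i)].
Definition scaleX m u : expo n := [ffun i => (m * u i)%N].
Definition subX u v : expo n := [ffun i => (u i - v i)%N].
Definition wt (w : 'I_n -> nat) u : nat := (\sum_i w i * u i)%N.

Lemma addXC u v : addX u v = addX v u.
Proof. by apply/ffunP => i; rewrite !ffunE addnC. Qed.

Lemma add0X u : addX zeroX u = u.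
Proof. by apply/ffunP => i; rewrite !ffunE. Qed.

Lemma subXK u v : expo_le v u -> addX v (subX u v) = u.
Proof. by move=> /forallP h; apply/ffunP => i; rewrite !ffunE subnKC. Qed.

Lemma unitX_neq0 i : unitX i != zeroX.
Proof. by apply/eqP => /ffunP /(_ i); rewrite !ffunE eqxx. Qed.

Lemma scaleXS m u : scaleX m.+1 u = addX u (scaleX m u).
Proof. by apply/ffunP => i; rewrite !ffunE mulSn. Qed.

Lemma wtD w u v : wt w (addX u v) = (wt w u + wt w v)%N.
Proof. by rewrite /wt -big_split; apply: eq_bigr => i _; rewrite ffunE mulnDr. Qed.

Lemma wt0 w : wt w zeroX = 0%N.
Proof. by rewrite /wt big1 // => i _; rewrite ffunE muln0. Qed.

Lemma wt_ge w u i : (w i * u i <= wt w u)%N.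
Proof. by rewrite /wt (bigD1 i) //= leq_addr. Qed.

Lemma wt_gt0 w u : (forall i, 0 < w i)%N -> u != zeroX -> (0 < wt w u)%N.
Proof.
move=> w0 u0; have [i ui] : exists i, u i != 0%N.
  apply: contrapT => h; case/eqP: u0; apply/ffunP => i; rewrite ffunE.
  by case E: (u i) => //; case: h; exists i; rewrite E.
by apply: leq_trans (wt_ge w u i); rewrite muln_gt0 w0 lt0n.
Qed.

Record mono_pre (lt : rel (expo n)) : Prop := MonoPre {
  mp_asym : forall u v, lt u v -> ~~ lt v u;
  mp_split : forall u v z, lt u v -> lt u z || lt z v;
  mp_add : forall u v z, lt (addX u z) (addX v z) = lt u v;
  mp_pos : forall u, u != zeroX -> lt zeroX u }.

Record mono_ord (lt : rel (expo n)) : Prop := MonoOrd {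
  mo_pre : mono_pre lt;
  mo_total : forall u v, u != v -> lt u v || lt v u }.

Section Preorder.
Variable lt : rel (expo n).
Hypothesis hlt : mono_pre lt.

Lemma mp_irr u : lt u u = false.
Proof. by apply/negP => h; move: (mp_asym hlt h); rewrite h. Qed.

Lemma mp_trans u v z : lt u v -> lt v z -> lt u z.
Proof.
by move=> /(mp_split hlt z) /orP [//|zv] /(mp_asym hlt); rewrite zv.
Qed.

Lemma mp_le_trans u v z : ~~ lt v u -> ~~ lt z v -> ~~ lt z u.
Proof. by move=> vu zv; apply/negP => /(mp_split hlt v); rewrite (negPf vu) (negPf zv). Qed.

Lemma mp_lt_le u v z : lt u v -> ~~ lt z v -> lt u z.
Proof. by move=> /(mp_split hlt z) /orP [//|->]. Qed.

Lemma mp_le_lt u v z : ~~ lt v u -> lt v z -> lt u z.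
Proof. by move=> vu /(mp_split hlt u); rewrite (negPf vu). Qed.

Lemma mp_addl u v z : lt (addX z u) (addX z v) = lt u v.
Proof. by rewrite !(addXC z) mp_add. Qed.

Lemma mp_leD u v u' v' : ~~ lt v u -> ~~ lt v' u' -> ~~ lt (addX v v') (addX u u').
Proof.
move=> h h'; apply: (@mp_le_trans _ (addX v u')); first by rewrite mp_add.
by rewrite mp_addl.
Qed.

Lemma mp_ltD u v u' v' : ~~ lt v u -> ~~ lt v' u' -> lt u v || lt u' v' ->
  lt (addX u u') (addX v v').
Proof.
move=> h h' /orP [k|k].
  by apply: (@mp_lt_le _ (addX v u')); [rewrite mp_add | rewrite mp_addl].
by apply: (@mp_le_lt _ (addX v u')); [rewrite mp_add | rewrite mp_addl].
Qed.

Lemma mp_le_scale m u v : ~~ lt v u -> ~~ lt (scaleX m v) (scaleX m u).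
Proof.
move=> h; elim: m => [|m IH]; last by rewrite !scaleXS; apply: mp_leD.
have -> : scaleX 0 v = scaleX 0 u by apply/ffunP => i; rewrite !ffunE.
by rewrite mp_irr.
Qed.

Lemma mp_lt_scale m u v : (0 < m)%N -> lt u v -> lt (scaleX m u) (scaleX m v).
Proof.
case: m => // m _ h; rewrite !scaleXS; apply: mp_ltD; rewrite ?h //.
  exact: mp_asym.
by apply: mp_le_scale; apply: mp_asym.
Qed.

Lemma mp_addr u v : ~~ lt (addX u v) u.
Proof.
rewrite -[X in lt _ X](add0X u) addXC mp_add //.
case: (eqVneq v zeroX) => [->|/(mp_pos hlt)]; first by rewrite mp_irr.
exact: mp_asym.
Qed.

Lemma pos_ratP (c : rat) : 0 < c -> exists p q, [/\ (0 < p)%N, (0 < q)%N &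
  q%:R * c = p%:R].
Proof.
move=> c0; exists (absz (numq c)), (absz (denq c)); split.
- by rewrite absz_gt0 numq_eq0 gt_eqF.
- by rewrite absz_gt0 denq_eq0.
- rewrite !pmulrn !gtz0_abs ?denq_gt0 ?numq_gt0 //.
  by rewrite numqE mulrC.
Qed.

Definition vec u : 'rV[rat]_n := \row_i (u i)%:R.

Lemma vecD u v : vec (addX u v) = vec u + vec v.
Proof. by apply/rowP => i; rewrite !mxE ffunE natrD. Qed.

Lemma vecM m u : vec (scaleX m u) = m%:R *: vec u.
Proof. by apply/rowP => i; rewrite !mxE ffunE natrM. Qed.

Lemma vec_inj u v : vec u = vec v -> u = v.
Proof.
move=> /rowP h; apply/ffunP => i; move: (h i); rewrite !mxE.
exact: (can_inj (@natrK _)).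
Qed.

Lemma clear_denominators (w : 'cV[rat]_n) : (forall i, 0 < w i 0) ->
  exists m (W : 'I_n -> nat), (0 < m)%N /\ forall i, m%:R * w i 0 = (W i)%:R.
Proof.
move=> w0; pose d i := absz (denq (w i 0)).
exists (\prod_i d i)%N, (fun i => absz (numq (w i 0%R)) * \prod_(j | j != i) d j)%N.
split; first by rewrite prodn_gt0 // => i; rewrite absz_gt0 denq_eq0.
move=> i; rewrite (bigD1 i) //= !natrM mulrAC; congr (_ * _).
by rewrite !pmulrn !gtz0_abs ?denq_gt0 ?numq_gt0 // numqE mulrC.
Qed.

(** Motzkin's theorem is applied to the cone [K] of differences of comparable exponents, up to a
    positive integer factor; a strict [0 < 0] in it would mean [lt u u]. The comparisons of 1 with
    the variables are added to make the weights positive. *)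
Lemma weight_exists (D : seq (expo n * expo n)) :
  (forall d, d \in D -> ~~ lt d.2 d.1) ->
  exists w : 'I_n -> nat, (forall i, (0 < w i)%N) /\
    forall d, d \in D -> (wt w d.1 <= wt w d.2)%N /\
      (lt d.1 d.2 -> (wt w d.1 < wt w d.2)%N).
Proof.
move=> hD.
pose K (d : 'rV[rat]_n) b := exists m u v, [/\ (0 < m)%N,
  m%:R *: d = vec v - vec u, ~~ lt v u & b -> lt u v].
pose L := [seq (vec d.2 - vec d.1, lt d.1 d.2) |
  d : expo n * expo n <- [seq (zeroX, unitX i) | i <- enum 'I_n] ++ D].
have [|||l lL|w hw] := @fourier_motzkin n K _ _ _ L.
- move=> d b d' b' [m [u [v [m0 md uv buv]]]] [m' [u' [v' [m0' md' uv' buv']]]].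
  exists (m * m')%N, (addX (scaleX m' u) (scaleX m u')),
    (addX (scaleX m' v) (scaleX m v')); split.
  + by rewrite muln_gt0 m0.
  + rewrite scalerDr natrM -[in X in _ + X]scalerA md' [m%:R * m'%:R]mulrC -scalerA md.
    rewrite !vecD !vecM.
    by rewrite !scalerBr addrACA opprD.
  + by apply: mp_leD; apply: mp_le_scale.
  + move=> bb; apply: mp_ltD; [exact: mp_le_scale.. |].
    by case/orP: bb => [/buv|/buv'] h; apply/orP; [left|right]; apply: mp_lt_scale.
- move=> c d b /pos_ratP [p [q [p0 q0 qc]]] [m [u [v [m0 md uv buv]]]].
  exists (m * q)%N, (scaleX p u), (scaleX p v); split.
  + by rewrite muln_gt0 m0.
  + rewrite natrM -scalerA [q%:R *: (c *: d)]scalerA qc scalerA mulrC -scalerA md.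
    by rewrite scalerBr !vecM.
  + exact: mp_le_scale.
  + by move=> /buv; apply: mp_lt_scale.
- move=> [m [u [v [_ /esym/eqP]]]]; rewrite scaler0 subr_eq0 => /eqP /vec_inj ->.
  by move=> _ /(_ isT); rewrite mp_irr.
- move: lL => /mapP [d]; rewrite mem_cat => dD ->; exists 1%N, d.1, d.2; split=> //.
    by rewrite scale1r.
  case/orP: dD => [/mapP [i _ -> /=]|/hD//].
  by apply: mp_asym => //; apply: mp_pos => //; apply: unitX_neq0.
have wE u v b : (vec v - vec u, b) \in L ->
    (vec u *m w) 0 0 <= (vec v *m w) 0 0 /\ (b -> (vec u *m w) 0 0 < (vec v *m w) 0 0).
  move=> /hw [] /=; rewrite mulmxBl !mxE subr_ge0 => h1 h2; split=> // /h2.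
  by rewrite subr_gt0.
have w0 i : 0 < w i 0.
  have [|_ /(_ isT)] := wE zeroX (unitX i) true.
    apply/mapP; exists (zeroX, unitX i); last by rewrite /= mp_pos ?unitX_neq0.
    by rewrite mem_cat; apply/orP; left; apply/mapP; exists i; rewrite ?mem_enum.
  rewrite !mxE big1 => [|j _]; last by rewrite mxE ffunE mul0r.
  rewrite (bigD1 i) //= big1 ?addr0 => [|j ji]; first by rewrite mxE ffunE eqxx mul1r.
  by rewrite mxE ffunE (negPf ji) mul0r.
have [m [W [m0 hW]]] := clear_denominators w0.
have WE u : (wt W u)%:R = m%:R * (vec u *m w) 0 0 :> rat.
  rewrite /wt natr_sum mxE mulr_sumr; apply: eq_bigr => i _.
  by rewrite natrM -hW mxE -mulrA; congr (_ * _); rewrite mulrC.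
have mR : 0 < m%:R :> rat by rewrite ltr0n.
exists W; split=> [i|d dD].
  by rewrite -(ltr0n rat) -hW mulr_gt0.
rewrite -(ler_nat rat) -(ltr_nat rat) !WE ler_pM2l // ltr_pM2l //.
by apply: wE; apply/mapP; exists d => //; rewrite mem_cat dD orbT.
Qed.

End Preorder.

Definition ltw (w : 'I_n -> nat) (lt : rel (expo n)) : rel (expo n) :=
  fun u v => (wt w u < wt w v)%N || (wt w u == wt w v) && lt u v.

Lemma ltw_ord w lt : (forall i, (0 < w i)%N) -> mono_ord lt -> mono_ord (ltw w lt).
Proof.
move=> w0 [hlt tot]; split; first split.
- move=> u v; rewrite /ltw; case: ltngtP => //= _ /(mp_asym hlt) //.
- move=> u v z; rewrite /ltw => /orP [h|/andP [/eqP -> h]].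
    case: (ltnP (wt w u) (wt w z)) => //= zu.
    by rewrite (leq_ltn_trans zu h) orbT.
  by case: ltngtP => //= _; apply: mp_split.
- by move=> u v z; rewrite /ltw !wtD ltn_add2r eqn_add2r mp_add.
- by move=> u u0; rewrite /ltw wt0 wt_gt0.
- move=> u v /tot; rewrite /ltw; case: ltngtP => //=.
Qed.

End Exponents.

Section Monomials.
Variables (C : comPzRingType) (n : nat) (a : 'I_n -> C).
Implicit Types (u v z : expo n) (P Q : set (expo n)).

Definition mon u : C := \prod_(i < n) a i ^+ u i.

Lemma monD u v : mon (addX u v) = mon u * mon v.
Proof. by rewrite -big_split /=; apply: eq_bigr => i _; rewrite ffunE exprD. Qed.

Lemma mon0 : mon (zeroX n) = 1.
Proof. by rewrite /mon big1 // => i _; rewrite ffunE expr0. Qed.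

Lemma mon_unit i : mon (unitX i) = a i.
Proof.
rewrite /mon (bigD1 i) //= big1 ?mulr1 ?ffunE ?eqxx // => j ji.
by rewrite ffunE (negPf ji).
Qed.

Definition spanm P : set C := idl [set mon u | u in P].

Lemma spanm_ideal P : ideal (spanm P). Proof. exact: idl_ideal. Qed.

Lemma spanm_mem P u : P u -> spanm P (mon u).
Proof. by move=> Pu; apply: idl_sub; exists u. Qed.

Lemma spanmS P Q : P `<=` Q -> spanm P `<=` spanm Q.
Proof. by move=> PQ; apply: idlS => _ [u Pu <-]; exists u => //; apply: PQ. Qed.

Lemma spanm_min P I : ideal I -> (forall u, P u -> I (mon u)) -> spanm P `<=` I.
Proof. by move=> iI h; apply: idl_min => // _ [u Pu <-]; apply: h. Qed.

Lemma spanm_mul P Q v x : (forall u, P u -> Q (addX u v)) -> spanm P x ->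
  spanm Q (x * mon v).
Proof.
move=> PQ; rewrite mulrC; apply: idlMl => _ [u Pu <-].
by exists (addX u v); [exact: PQ | rewrite monD mulrC].
Qed.

Lemma spanm_fin P x : spanm P x -> exists2 t : seq (expo n),
  (forall u, u \in t -> P u) & spanm [set u | u \in t] x.
Proof.
move=> /idl_fin [t tP tx].
have [t' t'P tt'] : exists2 t' : seq (expo n), (forall u, u \in t' -> P u) &
    forall y, y \in t -> exists2 u, u \in t' & mon u = y.
  elim: t tP {tx} => [|y t IH] tP; first by exists [::].
  have [|t' t'P tt'] := IH; first by move=> z zt; apply: tP; rewrite inE zt orbT.
  have [u Pu uy] := tP y (mem_head _ _).
  exists (u :: t') => [v|z]; rewrite inE => /orP [/eqP->//|]; first exact: t'P.
    by exists u; rewrite ?mem_head.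
  by move=> /tt' [v vt' vz]; exists v; rewrite // inE vt' orbT.
exists t' => //; apply: idlS tx => y /= /tt' [u ut' uy]; by exists u.
Qed.

(* The union over all monomials [v] of the ideals of leading coefficients at [v]
   of the polynomials vanishing at [a]. *)
Definition initI (lt : rel (expo n)) : set C :=
  [set e | exists v, spanm [set u | lt v u] (e * mon v)].

Lemma initI_ideal lt : mono_pre lt -> ideal (initI lt).
Proof.
move=> hlt; split.
- by exists (zeroX n); rewrite mul0r; apply: ideal0; apply: spanm_ideal.
- move=> x y [v hv] [z hz]; exists (addX v z).
  rewrite mulrDl; apply: (idealD (spanm_ideal _)).
    rewrite monD mulrA; apply: spanm_mul hv => u /=.
    by rewrite mp_add.
  rewrite addXC monD mulrA; apply: spanm_mul hz => u /=.
  by rewrite mp_add.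
- by move=> r x [v hv]; exists v; rewrite -mulrA; apply: (idealM _ (spanm_ideal _)).
Qed.

Lemma initI_var lt i : mono_pre lt -> initI lt (a i).
Proof.
move=> hlt; exists (zeroX n); rewrite mon0 mulr1 -mon_unit; apply: spanm_mem => /=.
by apply: mp_pos => //; apply: unitX_neq0.
Qed.

End Monomials.

(** * Approximation of a monomial order by positive weights *)

Lemma count_rank_lt (T : eqType) (lt : rel T) (s : seq T) u z :
  irreflexive lt -> transitive lt -> uniq s -> u \in s -> lt u z ->
  (count (lt^~ u) s < count (lt^~ z) s)%N.
Proof.
move=> irr tr us uins uz.
have <- : count (predU (lt^~ u) (pred1 u)) s = (count (lt^~ u) s).+1.
  have cu : count (pred1 u) s = 1%N by rewrite count_uniq_mem // uins.
  rewrite -addn1 -cu -count_predUI [X in (_ + X)%N](_ : _ = 0%N) ?addn0 //.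
  apply/eqP; rewrite -leqn0 leqNgt -has_count; apply/hasPn => y _ /=.
  by case: eqP => [->|]; rewrite ?irr ?andbF.
by apply: sub_count => y /= /orP [yu|/eqP->//]; apply: tr uz.
Qed.

Section Box.
Variable n : nat.

Definition emb N (f : {ffun 'I_n -> 'I_N}) : expo n := [ffun i => nat_of_ord (f i)].

Lemma emb_inj N : injective (@emb N).
Proof.
move=> f g /ffunP h; apply/ffunP => i; apply: val_inj.
by have := h i; rewrite !ffunE.
Qed.

Lemma emb_ex N (u : expo n) : (forall i, (u i < N)%N) -> exists f, @emb N f = u.
Proof.
by move=> h; exists [ffun i => Ordinal (h i)]; apply/ffunP => i; rewrite !ffunE.
Qed.

Definition degX (u : expo n) : nat := wt (fun=> 1%N) u.

Lemma degX_ge (u : expo n) i : (u i <= degX u)%N.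
Proof. by have := wt_ge (fun=> 1%N) u i; rewrite mul1n. Qed.

Definition mons d : seq (expo n) :=
  [seq u <- [seq @emb d.+1 f | f <- enum {ffun 'I_n -> 'I_d.+1}] | (degX u <= d)%N].

Lemma mem_mons d (u : expo n) : (u \in mons d) = (degX u <= d)%N.
Proof.
rewrite mem_filter; case: leqP => //= ud.
have [i|f <-] := @emb_ex d.+1 u; first by rewrite ltnS (leq_trans (degX_ge u i)).
by apply: map_f; rewrite mem_enum.
Qed.

Lemma mons_uniq d : uniq (mons d).
Proof. by rewrite filter_uniq // map_inj_uniq ?enum_uniq //; apply: emb_inj. Qed.
Lemma degX_le_wt w (u : expo n) : (forall i, (0 < w i)%N) -> (degX u <= wt w u)%N.
Proof. by move=> w0; apply: leq_sum => i _; rewrite leq_mul2r w0 orbT. Qed.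

End Box.

Section Approximation.
Variables (C : comPzRingType) (n : nat) (a : 'I_n -> C).
Implicit Types (u v z : expo n) (P Q : set (expo n)) (f g : expo n -> C).

Definition eval d f : C := \sum_(u <- mons n d) f u * mon a u.

Lemma spanm_eval P d x : spanm a [set u | P u /\ (degX u <= d)%N] x ->
  exists2 f, (forall u, f u <> 0 -> P u) & x = eval d f.
Proof.
pose U : set C := [set x | exists2 f, (forall u, f u <> 0 -> P u) & x = eval d f].
move: x; apply: (@spanm_min _ _ _ _ U).
  split.
  - by exists (fun=> 0) => //; rewrite /eval big1 // => u _; rewrite mul0r.
  - move=> x y [f fP ->] [g gP ->]; exists (fun u => f u + g u).
      move=> u h; case: (f u =P 0) => [f0|/fP//].
      by apply: gP => g0; apply: h; rewrite f0 g0 addr0.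
    by rewrite -big_split; apply: eq_bigr => u _; rewrite mulrDl.
  - move=> r x [f fP ->]; exists (fun u => r * f u).
      by move=> u h; apply: fP => f0; apply: h; rewrite f0 mulr0.
    by rewrite mulr_sumr; apply: eq_bigr => u _; rewrite mulrA.
move=> u [Pu du]; exists (fun v => (v == u)%:R).
  by move=> v; case: eqP => [->|].
rewrite /eval (bigD1_seq u) ?mons_uniq ?mem_mons //= eqxx mul1r big1 ?addr0 //.
by move=> v /negPf ->; rewrite mul0r.
Qed.

(* [initT lt t v] is the coefficient of the monomial [v] in degree
   [degX v + t] of the initial ideal of the homogenized ideal of relations. *)
Definition initT (lt : rel (expo n)) t v : set C :=
  [set e | spanm a [set u | lt v u /\ (degX u <= degX v + t)%N] (e * mon a v)].

Lemma initT_ideal lt t v : ideal (initT lt t v).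
Proof. exact: ideal_colon (spanm_ideal _ _). Qed.

Lemma initT_mono lt t t' v v' : mono_pre lt -> (t <= t')%N -> expo_le v v' ->
  initT lt t v `<=` initT lt t' v'.
Proof.
move=> hlt tt' /subXK <- x; rewrite /initT /= monD mulrA.
apply: spanm_mul => u [vu du]; rewrite /= mp_add // vu /degX !wtD addnAC leq_add2r.
by split=> //; apply: leq_trans du _; rewrite leq_add2l.
Qed.

(* Reducing a relation by the relations [hred], whose leading terms agree for
   both orders, leaves a remainder whose coefficients are all outside the
   initial ideal of [lt]; hence the remainder is zero. *)
Lemma initT_reduce (lt lw : rel (expo n)) d v e : mono_ord lt -> mono_ord lw ->
  (forall u c, (degX u <= d)%N -> initT lt (d - degX u) u c ->
     spanm a [set z | lw u z /\ (degX z <= d)%N] (c * mon a u)) ->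
  (degX v <= d)%N -> spanm a [set u | lw v u /\ (degX u <= d)%N] (e * mon a v) ->
  initT lt (d - degX v) v e.
Proof.
move=> [hlt tlt] [hlw tlw] hred dv hv; apply: contrapT => ne.
have e0 : e <> 0.
  by move=> e0; apply: ne; rewrite e0; apply: ideal0; apply: initT_ideal.
pose bad f u := f u <> 0 -> ~ initT lt (d - degX u) u (f u).
pose rank u := count (lw^~ u) (mons n d).
have rank_lt u z : (degX u <= d)%N -> lw u z -> (rank u < rank z)%N.
  move=> du uz; by apply: count_rank_lt (mp_irr hlw) (fun _ _ _ => @mp_trans _ _ hlw _ _ _) _ _ uz;
    rewrite ?mons_uniq ?mem_mons.
(* Stage [k] of the reduction: the coefficients at ranks below [k] are zero or outside [initT], and
   [v] keeps its coefficient [e]. *)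
have red k : exists f, [/\ eval d f = 0, f v = e, forall u, lw u v -> f u = 0 &
    forall u, (degX u <= d)%N -> (rank u < k)%N -> bad f u].
  elim: k => [|k [f [f1 f2 f3 f4]]].
    have [g gP ge] := spanm_eval hv.
    exists (fun u => e * (u == v)%:R - g u); split=> //.
    - rewrite /eval (eq_bigr (fun u => e * ((u == v)%:R * mon a u) - g u * mon a u)).
        rewrite sumrB -mulr_sumr -/(eval d g) -ge.
        rewrite (bigD1_seq v) ?mons_uniq ?mem_mons //= eqxx mul1r.
        rewrite big1 ?addr0 ?subrr // => u /negPf ->; by rewrite mul0r.
      by move=> u _; rewrite mulrBl mulrA.
    - rewrite eqxx mulr1; case: (g v =P 0) => [->|/gP]; first by rewrite subr0.
      by rewrite mp_irr.
    - move=> u uv; case: eqP uv => [->|_ uv]; first by rewrite mp_irr.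
      rewrite mulr0n mulr0 sub0r; case: (g u =P 0) => [->|/gP vu]; first by rewrite oppr0.
      by have := mp_asym hlw vu; rewrite uv.
  case: (pselect (exists u, [/\ (degX u <= d)%N, rank u = k & ~ bad f u])); last first.
    move=> nex; exists f; split=> // u du; rewrite ltnS leq_eqVlt => /orP [/eqP uk|].
      by apply: contrapT => nb; apply: nex; exists u.
    exact: f4.
  move=> [u [du uk /not_implyP [fu0 /contrapT fuE]]].
  have vu : lw v u.
    case: (eqVneq v u) => [vu|/tlw /orP [//|/f3 //]].
    by case: ne; rewrite -f2 vu.
  (* The term at [u] is traded for monomials that are larger for [lw], so no coefficient of smaller
     rank changes. *)
  have [g gP ge] := spanm_eval (hred _ _ du fuE).
  exists (fun z => f z - (f u * (z == u)%:R - g z)); split.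
  - rewrite /eval (eq_bigr (fun z => f z * mon a z - f u * ((z == u)%:R * mon a z)
        + g z * mon a z)).
      rewrite big_split sumrB /= -mulr_sumr -/(eval d g) -/(eval d f) -ge f1.
      rewrite (bigD1_seq u) ?mons_uniq ?mem_mons //= eqxx mul1r.
      rewrite big1 ?addr0 ?sub0r ?addNr // => z /negPf ->; by rewrite mul0r.
    by move=> z _; ring.
  - rewrite f2; case: eqP => [vu'|_]; first by move: vu; rewrite vu' mp_irr.
    case: (g v =P 0) => [->|/gP uv]; first by rewrite mulr0n mulr0 !subr0.
    by have := mp_asym hlw vu; rewrite uv.
  - move=> z zv; rewrite f3 //; case: eqP => [zu|_].
      by have := mp_asym hlw vu; rewrite -zu zv.
    case: (g z =P 0) => [->|/gP uz]; first by rewrite mulr0n mulr0 !subr0.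
    by have := mp_asym hlw (mp_trans hlw vu uz); rewrite zv.
  - move=> z dz; rewrite ltnS => zk.
    case: (eqVneq z u) => [->|zu].
      rewrite /bad eqxx mulr1 opprB addrC subrK.
      by case: (g u =P 0) => [->//|/gP]; rewrite mp_irr.
    case: (g z =P 0) => [gz|/gP /(rank_lt _ _ du)]; last first.
      by rewrite uk ltnNge zk.
    rewrite /bad gz (negPf zu) mulr0n mulr0 !subr0; apply: f4 => //.
    rewrite ltn_neqAle zk andbT; apply/eqP => rzk; case/orP: (tlw _ _ zu) => h.
      by have := rank_lt _ _ dz h; rewrite rzk uk ltnn.
    by have := rank_lt _ _ du h; rewrite rzk uk ltnn.
have [f [f1 f2 _ fb]] := red (size (mons n d)).+1.
have {}fb u : (degX u <= d)%N -> bad f u.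
  by move=> du; apply: fb => //; rewrite ltnS count_size.
(* The remainder is nonzero, having the coefficient [e] at [v]. At its [lt]-least monomial it is
   itself the relation that puts the coefficient into [initT], which is the contradiction. *)
have [u [du fu mu]] : exists u, [/\ (degX u <= d)%N, f u <> 0 &
    forall z, (degX z <= d)%N -> f z <> 0 -> z != u -> lt u z].
  pose rk u := count (lt^~ u) [seq u <- mons n d | f u != 0].
  have exk : exists k, `[< exists u, [/\ (degX u <= d)%N, f u <> 0 & rk u = k] >].
    by exists (rk v); apply/asboolP; exists v; rewrite f2.
  case: (ex_minnP exk) => k /asboolP [u [du fu uk]] mk.
  exists u; split=> // z dz fz; rewrite eq_sym => /tlt /orP [//|zlu].
  have zin : z \in [seq u <- mons n d | f u != 0].
    by rewrite mem_filter mem_mons dz andbT; apply/eqP.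
  have := count_rank_lt (mp_irr hlt) (fun _ _ _ => @mp_trans _ _ hlt _ _ _) (filter_uniq _ (mons_uniq n d)) zin zlu.
  by rewrite -/(rk u) uk ltnNge mk //; apply/asboolP; exists z.
apply: (fb u du fu); rewrite /initT /= subnKC //.
have fuE : f u * mon a u = - \sum_(z <- mons n d | z != u) f z * mon a z.
  apply/eqP; rewrite -addr_eq0; apply/eqP; apply: etrans f1.
  by rewrite /eval [RHS](bigD1_seq u) ?mons_uniq ?mem_mons.
rewrite fuE; apply: (idealN (spanm_ideal _ _)); rewrite big_seq_cond.
apply: (ideal_sum _ (spanm_ideal _ _)) => z /andP []; rewrite mem_mons => dz zu.
case: (f z =P 0) => [->|fz].
  by rewrite mul0r; apply: ideal0; apply: spanm_ideal.
by apply: (idealM _ (spanm_ideal _ _)); apply: spanm_mem; split=> //; apply: mu.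
Qed.

Lemma spanm_bound P v x : spanm a P x ->
  exists t, spanm a [set u | P u /\ (degX u <= degX v + t)%N] x.
Proof.
move=> /spanm_fin [s sP sx]; exists (\sum_(u <- s) degX u)%N.
apply: spanmS sx => u us; split; first exact: sP.
by apply: leq_trans (leq_addl _ _); rewrite (big_rem u) //= leq_addr.
Qed.

(** Bounding the degree by [degX v + t] amounts to homogenizing. [finite_basis] leaves finitely many
    ideals [initT], each with finitely many generators, each witnessed by finitely many monomials;
    [w] only has to respect the resulting comparisons [D]. Multiplying by monomials extends [good]
    to all [t] and [v], and [initT_reduce] then shows that no new leading coefficients arise. *)
Lemma approx_weight lt : noetherian C -> mono_ord lt ->
  exists w : 'I_n -> nat, [/\ forall i, (0 < w i)%N,
    forall e, initI a lt e ->
      exists v, spanm a [set u | (wt w v < wt w u)%N] (e * mon a v) &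
    initI a (ltw w lt) `<=` initI a lt].
Proof.
move=> hC olt; have hlt := mo_pre olt.
have [B hB] := @finite_basis C n (initT lt) hC (initT_ideal lt)
  (fun t t' v v' => @initT_mono lt t t' v v' hlt).
pose good (w : 'I_n -> nat) t v e :=
  spanm a [set u | [/\ lt v u, (wt w v < wt w u)%N & (degX u <= degX v + t)%N]]
    (e * mon a v).
have [D Dlt Dgood] : exists2 D : seq (expo n * expo n),
    (forall d, d \in D -> lt d.1 d.2) &
    forall w, (forall d, d \in D -> (wt w d.1 < wt w d.2)%N) ->
    forall b, b \in B -> forall e, initT lt b.1 b.2 e -> good w b.1 b.2 e.
  elim: {hB} B => [|[t v] B [D Dlt Dgood]]; first by exists [::].
  have [g gE] := hC _ (initT_ideal lt t v).
  have [D' D'lt D'good] : exists2 D' : seq (expo n * expo n),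
      (forall d, d \in D' -> lt d.1 d.2) &
      forall w, (forall d, d \in D' -> (wt w d.1 < wt w d.2)%N) ->
      forall e, e \in g -> good w t v e.
    have : forall e, e \in g -> initT lt t v e.
      by move=> e eg; rewrite gE; apply: idl_sub.
    elim: {gE} g => [|e g IH] hg; first by exists [::].
    have [|D' D'lt D'good] := IH; first by move=> x xg; apply: hg; rewrite inE xg orbT.
    have [us usP us_e] := spanm_fin (hg e (mem_head _ _)).
    exists ([seq (v, u) | u <- us] ++ D').
      move=> d; rewrite mem_cat => /orP [/mapP [u /usP [vu _] ->]//|/D'lt//].
    move=> w hw x; rewrite inE => /orP [/eqP->|]; last first.
      by apply: D'good => d dD; apply: hw; rewrite mem_cat dD orbT.
    apply: spanmS us_e => u us_u; have [vu du] := usP _ us_u; split=> //.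
    by apply: (hw (v, u)); rewrite mem_cat map_f.
  exists (D' ++ D) => [d|w hw b]; first by rewrite mem_cat => /orP [/D'lt|/Dlt].
  rewrite inE => /orP [/eqP->|bB] e /=; last first.
    by apply: Dgood => // d dD; apply: hw; rewrite mem_cat dD orbT.
  rewrite gE; apply: (@idl_min _ _ (good w t v)).
    exact: ideal_colon (spanm_ideal _ _).
  by move=> x /=; apply: D'good => d dD; apply: hw; rewrite mem_cat dD.
have [|w [w0 hw]] := weight_exists hlt (D := D).
  by move=> d /Dlt; apply: mp_asym.
have {}Dgood t v e : initT lt t v e -> good w t v e.
  have [[t' v'] bB /= [tt vv sub]] := hB t v => /sub he.
  have := Dgood w _ _ bB _ he => /(_ _)-/(_ _) H.
  have {H} : good w t' v' e by apply: H => d dD; apply: (hw d dD).2; apply: Dlt.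
  rewrite /good -(subXK vv) monD mulrA; apply: spanm_mul => u [vu wu du] /=.
  rewrite mp_add // !wtD ltn_add2r; split=> //.
  by rewrite /degX !wtD addnAC leq_add2r; apply: leq_trans du _; rewrite leq_add2l.
have olw := ltw_ord w0 olt.
exists w; split=> // e [v hv].
  have [t ht] := spanm_bound v hv; exists v.
  by apply: spanmS (Dgood t v e ht) => u [].
have [t ht] := spanm_bound v hv.
exists v.
have : initT lt (degX v + t - degX v) v e.
  apply: (initT_reduce olt olw) ht; last exact: leq_addr.
  move=> u c du /Dgood; rewrite /good subnKC //.
  by apply: spanmS => z [uz wz dz]; split=> //; rewrite /ltw wz.
by apply: spanmS => z [].
Qed.
End Approximation.

(** * Growth of local lengths *)

Section Growth.
Variables (C : comPzRingType) (p : set C).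
Hypotheses (hC : noetherian C) (pp : prime_ideal p).

(* The length of the localization of [C / p ^ N] at [p] is [O(N ^ m)]. *)
Definition poly_growth (m : nat) : Prop :=
  exists K, forall N, lenle p (pw p N) setT (K * N ^ m).

Section Weights.
Variables (n : nat) (a : 'I_n -> C) (w : 'I_n -> nat).

Definition wspan N : set C := spanm a [set u | (N <= wt w u)%N].

Lemma wspan_ideal N : ideal (wspan N). Proof. exact: spanm_ideal. Qed.

Lemma wspanS M N : (M <= N)%N -> wspan N `<=` wspan M.
Proof. by move=> MN; apply: spanmS => u /=; apply: leq_trans. Qed.

Lemma wspan_mon u : wspan (wt w u) (mon a u).
Proof. exact: spanm_mem (leqnn _). Qed.

Lemma wspanM M N x y : wspan M x -> wspan N y -> wspan (M + N) (x * y).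
Proof.
move=> Mx; rewrite mulrC; move: y.
apply: (@spanm_min _ _ _ _ [set y | wspan (M + N) (y * x)]).
  exact: ideal_colon (wspan_ideal _).
move=> u /= Nu; rewrite mulrC; apply: spanm_mul Mx => v /= Mv.
by rewrite wtD leq_add.
Qed.

(* The elements whose order is at least [N] in the filtration [wspan]
   localized at [p] and at the monomials. *)
Definition worder N : set C := [set x | exists2 e, ~ p e &
  exists v, wspan (wt w v + N) (e * x * mon a v)].

Lemma worder_ideal N : ideal (worder N).
Proof.
split.
- exists 1; first exact: prime_neg1.
  by exists (zeroX n); rewrite mulr0 mul0r; apply: ideal0; apply: wspan_ideal.
- move=> x y [e ne [v hv]] [f nf [z hz]]; exists (e * f); first exact: prime_mul.
  exists (addX v z); rewrite monD wtD.
  have -> : e * f * (x + y) * (mon a v * mon a z) =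
     e * x * mon a v * mon a z * f + f * y * mon a z * mon a v * e by ring.
  apply: (idealD (wspan_ideal _)); apply: (idealMr _ (wspan_ideal _)).
    by rewrite addnAC; apply: wspanM hv (@wspan_mon z).
  by rewrite -addnA addnC; apply: wspanM hz (@wspan_mon v).
- move=> r x [e ne [v hv]]; exists e => //; exists v.
  have -> : e * (r * x) * mon a v = r * (e * x * mon a v) by ring.
  exact: idealM (wspan_ideal _) _.
Qed.

Lemma worderM M N x y : worder M x -> worder N y -> worder (M + N) (x * y).
Proof.
move=> [e ne [v hv]] [f nf [z hz]]; exists (e * f); first exact: prime_mul.
exists (addX v z); rewrite monD wtD addnACA.
have -> : e * f * (x * y) * (mon a v * mon a z) =
  (e * x * mon a v) * (f * y * mon a z) by ring.
exact: wspanM.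
Qed.

(** Orders add up under multiplication. This is where the exponent of [p] becomes linear in [N]. *)
Lemma pw_worder k N : pw p k `<=` worder 1 -> pw p (k * N) `<=` worder N.
Proof.
move=> h; elim: N => [|N IH].
  move=> x _; exists 1; first exact: prime_neg1.
  exists (zeroX n); rewrite mon0 mulr1; apply: (ideal1 (wspan_ideal _)).
  by rewrite -(mon0 a) addn0; apply: wspan_mon.
rewrite mulnS => x /pwD; move: x; apply: mulI_min; first exact: worder_ideal.
by move=> x y /h hx /IH hy; rewrite -add1n; apply: worderM.
Qed.

(** The monomials are adjoined in decreasing order. If [mon a u] were locally a combination of
    larger ones modulo [worder N], multiplication by a suitable monomial would put an element
    outside [p] into [initI]; monomials of weight at least [N] count as larger too. *)
Lemma worder_lower (lt : rel (expo n)) N m (us : seq (expo n)) :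
  mono_ord (ltw w lt) -> initI a (ltw w lt) `<=` p -> uniq us ->
  (forall u, u \in us -> (wt w u < N)%N) ->
  lenle p (worder N) setT m -> (size us <= m)%N.
Proof.
set lw := ltw w lt => olw hp us_u us_N hm.
have hlw := mo_pre olw.
pose r := fun u v : expo n => (u == v) || lw v u.
have rtot : total r.
  move=> u v; rewrite /r eq_sym; case: (eqVneq v u) => //= vu.
  exact: (mo_total olw vu).
have rtr : transitive r.
  move=> v u z; rewrite /r => /orP [/eqP->//|vu] /orP [/eqP<-|zv].
    by rewrite vu orbT.
  by rewrite (mp_trans hlw zv vu) orbT.
pose s := sort r us.
have su : uniq s by rewrite sort_uniq.
rewrite -(size_sort r) -/s.
pose x j := mon a (nth (zeroX n) s j).
apply: (@lenle_lower _ _ pp _ _ _ x (worder_ideal N) hm) => i iL.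
move=> [e ne [y hy [f nf [v hv]]]].
set u := nth (zeroX n) s i in hv *.
have uN : (wt w u < N)%N.
  by apply: us_N; rewrite -(mem_sort r) -/s mem_nth.
suff : p (f * e) by apply: prime_mul.
apply: hp; exists (addX u v).
have -> : f * e * mon a (addX u v) = f * (e * x i - y) * mon a v + y * mon a v * f.
  by rewrite monD /x -/u; ring.
apply: (idealD (spanm_ideal _ _)).
  apply: spanmS hv => z /= hz; rewrite /lw /ltw wtD.
  by rewrite (leq_trans _ hz) // addnC ltn_add2l.
apply: (idealMr _ (spanm_ideal _ _)).
suff : spanm a [set z | lw u z] y by apply: spanm_mul => z /=; rewrite mp_add.
apply: (idl_min (spanm_ideal _ _) _ hy) => _ [j /= ji <-].
apply: spanm_mem => /=.
have sL : sorted r s by apply: sort_sorted.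
have := sorted_ltn_nth rtr (zeroX n) sL; move=> /(_ j i).
rewrite !inE iL (ltn_trans ji iL) => /(_ isT isT ji).
by rewrite -/u /r nth_uniq ?(ltn_trans ji iL) // (ltn_eqF ji).
Qed.

End Weights.

(* Modulo a power of [p] that grows linearly with [M], the [M ^ s] monomials with
   exponents below [M] are the steps of a strict chain of ideals. *)
Lemma growth_lower (s m k : nat) (a : 'I_s -> C) (lt : rel (expo s)) :
  mono_ord lt -> initI a lt `<=` p -> pw p k `<=` loc p (initI a lt) ->
  poly_growth m -> (s <= m)%N.
Proof.
move=> olt hp hk [K hK].
have [w [w0 hw1 hw2]] := approx_weight a hC olt.
have kw : pw p k `<=` worder a w 1.
  move=> x /hk [e ne /hw1 [v hv]]; exists e => //; exists v.
  by apply: spanmS hv => u /=; rewrite addn1.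
pose W := (\sum_i w i)%N.
(* Exponents below [M] give weights at most [W * M], hence the threshold [(W * M).+1]. *)
have key M : (M ^ s <= K * (k * (W * M).+1) ^ m)%N.
  have h : lenle p (worder a w (W * M).+1) setT (K * (k * (W * M).+1) ^ m).
    apply: (lenle_weaken pp (hK _)) => // x hx; apply: loc_sub => //.
    exact: (pw_worder kw).
  have := @worder_lower _ a w lt _ _
    [seq emb f | f <- enum {ffun 'I_s -> 'I_M}] (ltw_ord w0 olt) _ _ _ h.
  rewrite size_map -cardE card_ffun !card_ord; apply.
  - exact: subset_trans hw2 hp.
  - by rewrite map_inj_uniq ?enum_uniq //; apply: emb_inj.
  - move=> _ /mapP [f _ ->]; rewrite ltnS /W big_distrl /=.
    by apply: leq_sum => i _; rewrite ffunE leq_mul2l ltnW ?orbT.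
rewrite leqNgt; apply/negP => ms.
(* As [W * M + 1 <= W.+1 * M], the bound in [key] is at most [K * (k * W.+1) ^ m * M ^ m]; this [M]
   exceeds the coefficient. *)
pose M := (K * (k * W.+1) ^ m).+1.
have M0 : (0 < M)%N by [].
have : (M ^ m.+1 <= K * (k * W.+1) ^ m * M ^ m)%N.
  apply: leq_trans (leq_trans (key M) _); first by rewrite leq_pexp2l.
  rewrite -mulnA -expnMn leq_mul2l; apply/orP; right.
  have le : (k * (W * M).+1 <= k * W.+1 * M)%N.
    by rewrite -mulnA leq_mul2l mulSn -add1n leq_add2r M0 orbT.
  by case: (m) => // j; rewrite leq_exp2r.
rewrite expnS leq_pmul2r; last by rewrite expn_gt0 M0.
by rewrite ltnn.
Qed.

Lemma lenle_refl X Y : Y `<=` loc p X -> lenle p X Y 0.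
Proof.
move=> YX Z iZ sZ XZ ZY L; rewrite big1 // => i _.
apply/eqP; rewrite eqb0 negbK; apply/asboolP => z /ZY.
apply: loc_trans => // {}z /YX; apply: loc_trans => // {}z /XZ [e ne ez].
by exists e => //; elim: (nat_of_ord i) => // j; apply: sZ.
Qed.

Section Upper.
Variables (n : nat) (b : 'I_n -> C) (w : 'I_n -> nat) (T : pred (expo n)) (k : nat).
Hypotheses (w0 : forall i, (0 < w i)%N)
  (hk : pw p k `<=` loc p (idl [set b i | i in setT])).

Notation J := (wspan b w).
Let S M := spanm b [set u | T u /\ wt w u = M].

(* [J M] is generated by the monomials in [T] up to [p * J M] and [J M.+1]. *)
Hypothesis hT : forall u, let M := wt w u in
  loc p (addI (S M) (addI (mulI p (J M)) (J M.+1))) (mon b u).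

Let mS j M : ideal (addI (S M) (addI (mulI (pw p j) (J M)) (J M.+1))).
Proof.
apply: addI_ideal; first exact: spanm_ideal.
by apply: addI_ideal; [exact: mulI_ideal | exact: wspan_ideal].
Qed.

Let pwJ x M y : pw p k x -> J M y -> loc p (J M.+1) (x * y).
Proof.
move=> /hk [e ne he] My; exists e => //; rewrite mulrA -add1n; apply: wspanM => //.
apply: (idl_min (wspan_ideal _ _ _) _ he) => _ [i _ <-].
by rewrite -mon_unit; apply: spanm_mem => /=; rewrite wt_gt0 // unitX_neq0.
Qed.

Let ip : ideal p := prime_ideal_ideal pp.

(** As in Nakayama's lemma, substituting [hT] into itself replaces [p] by its powers. At [j = k] the
    term with [p ^ k] is absorbed into [J M.+1] by [pwJ]. *)
Let step j M : J M `<=` loc p (addI (S M) (addI (mulI (pw p j) (J M)) (J M.+1))).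
Proof.
elim: j => [|j IH].
  move=> x Mx; apply: loc_sub => //; apply: addI_subr; first exact: spanm_ideal.
  apply: addI_subl; first exact: wspan_ideal.
  by rewrite -(mul1r x); apply: mulI_mem.
have iY := mS j.+1 M; have iL := loc_ideal pp iY.
have sT : S M `<=` addI (S M) (addI (mulI (pw p j.+1) (J M)) (J M.+1)).
  by apply: addI_subl; apply: addI_ideal; [exact: mulI_ideal | exact: wspan_ideal].
have sJ : J M.+1 `<=` addI (S M) (addI (mulI (pw p j.+1) (J M)) (J M.+1)).
  move=> x hx; apply: addI_subr; first exact: spanm_ideal.
  by apply: addI_subr => //; apply: mulI_ideal.
have sP : mulI (pw p j.+1) (J M) `<=` addI (S M) (addI (mulI (pw p j.+1) (J M)) (J M.+1)).
  move=> x hx; apply: addI_subr; first exact: spanm_ideal.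
  by apply: addI_subl => //; apply: wspan_ideal.
apply: subset_trans IH _ => x; apply: loc_trans => // {}x [y [z Jz hyz] hxy].
rewrite -(subrK y x); apply: (idealD iL); first by apply: loc_sub => //; apply: sT.
rewrite -(subrK z y); apply: (idealD iL); last by apply: loc_sub => //; apply: sJ.
move: (y - z) hyz; apply: mulI_min => // c d pc; move: d.
apply: (@spanm_min _ _ _ _ [set d | loc p _ (c * d)]).
  by under eq_set => d do rewrite mulrC; apply: ideal_colon.
move=> u /= Mu; move: (Mu); rewrite leq_eqVlt => /orP [/eqP eM|lM]; last first.
  apply: (idealM _ iL); apply: loc_sub => //; apply: sJ.
  by apply: spanm_mem.
have [e ne [s [r Jr hr] hs]] := hT u; move: r Jr hr hs; rewrite -eM => r Jr hr hs.
exists e => //; have -> : e * (c * mon b u) =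
  c * (e * mon b u - s) + (c * (s - r) + c * r) by ring.
apply: (idealD iY); first by apply: (idealM _ iY); apply: sT.
apply: (idealD iY); last by apply: (idealM _ iY); apply: sJ.
apply: sP; move: (s - r) hr; apply: (@mulI_min _ _ _ [set z | mulI _ _ (c * z)]).
  by under eq_set => d do rewrite mulrC; apply: ideal_colon; apply: mulI_ideal.
move=> x' y' px Jy /=; rewrite mulrA; apply: mulI_mem => //.
by rewrite mulrC; apply: mulI_mem.
Qed.

(** Each monomial of [T] of weight [M] is killed by [p ^ k] modulo [J M.+1], so it contributes at
    most the length of [C / p ^ k]. As weights are positive, its exponents are at most [M] and fit
    into ['I_N]. *)
Lemma wspan_step M N m0 : (M < N)%N -> lenle p (pw p k) setT m0 ->
  lenle p (J M.+1) (J M) (m0 * #|[pred f : {ffun 'I_n -> 'I_N} |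
     T (emb f) && (wt w (emb f) == M)]|).
Proof.
move=> MN hm; set A := [pred f | _].
have h := @lenle_addI _ _ pp (pw p k) (J M.+1) m0 [seq mon b (emb f) | f <- enum A]
  (wspan_ideal _ _ _) hm.
apply: (lenle_weaken pp (h _)) => {h}.
- move=> _ /mapP [f fA ->] x px; apply: pwJ => //.
  by move: fA; rewrite mem_enum inE => /andP [_ /eqP <-]; apply: wspan_mon.
- by move=> x; apply: loc_sub.
- have iY : ideal (addI (J M.+1) (idl [set y | y \in [seq mon b (emb f) | f <- enum A]])).
    by apply: addI_ideal; [exact: wspan_ideal | exact: idl_ideal].
  have iL := loc_ideal pp iY.
  apply: subset_trans (@step k M) _ => x; apply: loc_trans => // {}x [y [z Jz hyz] hxy].
  rewrite -(subrK y x); apply: (idealD iL).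
    apply: loc_sub => //; apply: addI_subr; first exact: wspan_ideal.
    move: (x - y) hxy; apply: spanm_min; first exact: idl_ideal.
    move=> u [Tu uM]; apply: idl_sub => /=.
    have [i|f fu] := @emb_ex n N u.
      apply: leq_ltn_trans MN; rewrite -uM; apply: leq_trans (wt_ge w u i).
      by rewrite leq_pmull.
    by rewrite -fu; apply/mapP; exists f; rewrite ?mem_enum ?inE ?fu ?Tu ?uM ?eqxx.
  have sJ : J M.+1 `<=` addI (J M.+1) (idl [set y | y \in [seq mon b (emb f) | f <- enum A]]).
    by apply: addI_subl; apply: idl_ideal.
  rewrite -(subrK z y); apply: (idealD iL); last by apply: loc_sub => //; apply: sJ.
  move: (y - z) hyz; apply: mulI_min => // c d pc Jd.
  exact: locS sJ _ (pwJ pc Jd).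
- by rewrite size_map -cardE.
Qed.

Lemma growth_upper (c m : nat) :
  (forall i, p (b i)) ->
  (forall N, (#|[pred f : {ffun 'I_n -> 'I_N} | T (emb f)]| <= c * N ^ m)%N) ->
  poly_growth m.
Proof.
move=> pb hc; have [m0 hm0] := lenle_pw pp k hC.
pose W := (\sum_i w i)%N.
(* A monomial of weight at least [W.+1 * N0] has degree at least [N0], so [J N] lies in [p ^ N0]. *)
exists (m0 * (c * W.+1 ^ m))%N => N0; pose N := (W.+1 * N0)%N.
have hJ M : (M <= N)%N -> lenle p (J M) setT (m0 * \sum_(i < M)
    #|[pred f : {ffun 'I_n -> 'I_N} | T (emb f) && (wt w (emb f) == i)]|).
  elim: M => [|M IH] MN.
    apply: lenle_weaken (lenle_refl (X := J 0) (Y := setT) _) _ _ _ => //.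
    - move=> x _; apply: loc_sub => //; apply: (ideal1 (wspan_ideal _ _ _)).
      by rewrite -(mon0 b); apply: spanm_mem.
    - by move=> x; apply: loc_sub.
    - by move=> x _; exists 1; first exact: prime_neg1.
  rewrite big_ord_recr mulnDr /= addnC; apply: lenle_trans (IH (ltnW MN)) => //.
  - exact: wspan_ideal.
  - by move=> x hx; apply: loc_sub => //; apply: wspanS hx.
  - by move=> x _; apply: loc_sub.
  - exact: wspan_step.
apply: (lenle_weaken pp (hJ N (leqnn N))).
- move=> x hx; apply: loc_sub => //; move: x hx; apply: spanm_min; first exact: pw_ideal.
  move=> u /= Nu.
  have dN : (N0 <= degX u)%N.
    have : (wt w u <= W.+1 * degX u)%N.
      rewrite /degX /wt big_distrr /=; apply: leq_sum => i _.
      by rewrite mul1n leq_mul2r leqW ?orbT // /W (bigD1 i) //= leq_addr.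
    by move=> /(leq_trans Nu); rewrite leq_pmul2l.
  suff : pw p (degX u) (mon b u).
    by move: dN => /subnK <-; rewrite addnC => /pwD; apply: mulI_min;
      [exact: pw_ideal | move=> y z py _; apply: idealMr => //; exact: pw_ideal].
  have pwX x i : p x -> pw p i (x ^+ i).
    by move=> px; elim: i => [//|i IH]; rewrite exprS; apply: mulI_mem.
  have : forall r : seq 'I_n, pw p (\sum_(i <- r) 1 * u i) (\prod_(i <- r) b i ^+ u i).
    elim=> [|i r IH]; first by rewrite !big_nil.
    by rewrite !big_cons mul1n; apply: pwMn => //; apply: pwX.
  exact.
- by move=> x _; exists 1; [exact: prime_neg1 | ].
- rewrite -mulnA leq_mul2l; apply/orP; right.
  rewrite -mulnA -expnMn -/N; apply: leq_trans (hc N).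
  rewrite -sum1_card (eq_bigr (fun i : 'I_N => \sum_(f : {ffun 'I_n -> 'I_N} |
      T (emb f) && (wt w (emb f) == i)) 1)%N); last by move=> i _; rewrite sum1_card.
  rewrite (exchange_big_dep (fun f : {ffun 'I_n -> 'I_N} => T (emb f))) /=; last first.
    by move=> i f _ /andP [].
  apply: leq_sum => f Tf.
  rewrite sum1_card; apply/card_le1_eqP => i j; rewrite !unfold_in.
  by move=> /andP [_ /eqP ei] /andP [_ /eqP ej]; apply: val_inj; rewrite /= -ei -ej.
Qed.

End Upper.
End Growth.

(** * The lexicographic order and total refinements of a preorder *)

Section Orders.
Variable n : nat.
Implicit Types u v z : expo n.

Lemma mono_ord_intro (lt : rel (expo n)) :
  irreflexive lt -> transitive lt -> (forall u v, u != v -> lt u v || lt v u) ->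
  (forall u v z, lt u v -> lt (addX u z) (addX v z)) ->
  (forall u, u != zeroX n -> lt (zeroX n) u) -> mono_ord lt.
Proof.
move=> irr tr tot add pos; split=> //; split=> //.
- by move=> u v uv; apply/negP => /(tr _ _ _ uv); rewrite irr.
- move=> u v z uv; case: (eqVneq u z) => [<-|/tot /orP [->//|zu]].
    by rewrite uv orbT.
  by rewrite (tr _ _ _ zu uv) orbT.
- move=> u v z; apply/idP/idP; last exact: add.
  case: (eqVneq u v) => [->|/tot /orP [//|/(add _ _ z) h1 h2]]; first by rewrite irr.
  by have := tr _ _ _ h1 h2; rewrite irr.
Qed.

Definition lexlt : rel (expo n) := fun u v =>
  [exists i : 'I_n, (u i < v i)%N && [forall j : 'I_n, (j < i)%N ==> (u j == v j)]].

Lemma lexltP u v : reflect (exists2 i : 'I_n, (u i < v i)%N &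
  forall j : 'I_n, (j < i)%N -> u j = v j) (lexlt u v).
Proof.
apply: (iffP existsP) => [[i /andP [h /forallP k]]|[i h k]]; exists i => //.
  by move=> j ji; apply/eqP; have := k j; rewrite ji.
by rewrite h; apply/forallP => j; apply/implyP => /k ->.
Qed.

Lemma lexlt_ord : mono_ord lexlt.
Proof.
apply: mono_ord_intro.
- by move=> u; apply/lexltP => [[i]]; rewrite ltnn.
- move=> v u z /lexltP [i uv hi] /lexltP [j vz hj]; apply/lexltP.
  case: (ltngtP i j) => ij.
  + by exists i => [|k ki]; [rewrite -(hj _ ij) | rewrite hi // hj // (ltn_trans ki)].
  + by exists j => [|k kj]; [rewrite (hi _ ij) | rewrite hi ?hj // (ltn_trans kj)].
  + have eij : i = j by apply: val_inj.
    exists i => [|k ki]; first by apply: ltn_trans uv _; rewrite eij.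
    by rewrite hi // hj // -eij.
- move=> u v uv; have [i0 ui0] : exists i, u i != v i.
    apply: contrapT => h; case/eqP: uv; apply/ffunP => i.
    by apply/eqP; apply: contrapT => /negP k; apply: h; exists i.
  have [j uj mj] : exists2 j : 'I_n, u j != v j &
      forall k : 'I_n, (k < j)%N -> u k = v k.
    case: (@arg_minnP _ i0 (fun i => u i != v i) (fun i : 'I_n => i : nat) ui0) => j uj mj.
    exists j => // k kj; apply/eqP; apply: contraTT kj => /mj.
    by rewrite -leqNgt.
  apply/orP; case: (ltngtP (u j) (v j)) uj => // h _; [left|right]; apply/lexltP;
    by exists j => // k /mj.
- move=> u v z /lexltP [i h k]; apply/lexltP; exists i.
    by rewrite !ffunE ltn_add2r.
  by move=> j /k; rewrite !ffunE => ->.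
- move=> u u0; have [i0 ui0] : exists i, u i != 0%N.
    apply: contrapT => h; case/eqP: u0; apply/ffunP => i; rewrite ffunE.
    by apply/eqP; apply: contrapT => /negP k; apply: h; exists i.
  apply/lexltP.
  case: (@arg_minnP _ i0 (fun i => u i != 0%N) (fun i : 'I_n => i : nat) ui0) => j uj mj.
  exists j => [|k kj]; first by rewrite ffunE lt0n.
  rewrite ffunE; apply/esym/eqP; apply: contraTT kj => /mj.
  by rewrite -leqNgt.
Qed.

Definition refine (lt : rel (expo n)) : rel (expo n) := fun u v =>
  lt u v || ~~ lt v u && lexlt u v.

Lemma refine_ord lt : mono_pre lt -> mono_ord (refine lt).
Proof.
move=> hlt; have hx := mo_pre lexlt_ord; apply: mono_ord_intro.
- by move=> u; rewrite /refine !mp_irr // andbF.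
- move=> v u z; rewrite /refine => /orP [uv|/andP [vu luv]] /orP [vz|/andP [zv lvz]].
  + by rewrite (mp_trans hlt uv vz).
  + by rewrite (mp_lt_le hlt uv zv).
  + by rewrite (mp_le_lt hlt vu vz).
  + by rewrite (mp_le_trans hlt vu zv) (mp_trans hx luv lvz) orbT.
- move=> u v /(mo_total lexlt_ord); rewrite /refine.
  by case: (lt u v); case: (lt v u) => //=; rewrite orbF.
- by move=> u v z; rewrite /refine !mp_add.
- by move=> u u0; rewrite /refine mp_pos.
Qed.

End Orders.

(** * Growth bounds at primes minimal over given elements *)

Section Krull.
Variable C : comPzRingType.
Hypothesis hC : noetherian C.
Implicit Types (p q I J : set C) (l : seq C).

Lemma idl_range n (b : 'I_n -> C) i : idl [set b i | i in setT] (b i).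
Proof. by apply: idl_sub; exists i. Qed.

Lemma minprime_growth p n (b : 'I_n -> C) :
  minprime (idl [set b i | i in setT]) p -> poly_growth p n.
Proof.
move=> mp; have [pp bp _] := mp; have [k hk] := minprime_pw hC (idl_ideal _) mp.
apply: (@growth_upper _ _ hC pp n b (fun=> 1%N) predT k _ hk _ 1) => //.
- move=> u; apply: loc_sub => //; apply: addI_subl.
    by apply: addI_ideal; [exact: mulI_ideal | exact: wspan_ideal].
  by apply: spanm_mem.
- by move=> i; apply: bp; apply: idl_range.
- by move=> N; rewrite mul1n card_ffun !card_ord.
Qed.

Lemma card_box_lt n N (i : 'I_n) c :
  (#|[pred f : {ffun 'I_n -> 'I_N} | (f i < c)%N]| <= c * N ^ n.-1)%N.
Proof.
have -> : #|[pred f : {ffun 'I_n -> 'I_N} | (f i < c)%N]| =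
    #|family (fun j (x : 'I_N) => (j == i) ==> (x < c)%N)|.
  apply: eq_card => f; rewrite inE; apply/idP/forallP => [fi j|/(_ i)].
    by rewrite unfold_in; apply/implyP => /eqP ->.
  by rewrite unfold_in eqxx.
rewrite card_family foldrE big_map big_enum /= (bigD1 i) //= leq_mul //.
  have -> : #|(fun x : 'I_N => (i == i) ==> (x < c)%N)| = #|[pred x : 'I_N | (x < c)%N]|.
    by apply: eq_card => x; rewrite inE unfold_in /= eqxx.
  rewrite cardE -(size_map val) -[X in (_ <= X)%N](size_iota 0).
  apply: uniq_leq_size; first by rewrite map_inj_uniq ?enum_uniq //; apply: val_inj.
  by move=> y /mapP [x xin ->]; rewrite mem_iota; move: xin; rewrite mem_enum inE.
rewrite -[X in (_ <= _ ^ X)%N](_ : #|[pred j : 'I_n | j != i]| = n.-1); last first.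
  by apply: etrans (cardC1 i) _; rewrite card_ord.
rewrite -prod_nat_const; apply: leq_prod => j ji.
by rewrite -[X in (_ <= X)%N](card_ord N) max_card.
Qed.

(* The relation makes the monomials divisible by [v] redundant, which lowers the
   number of generators in weight [N] by one order of magnitude. *)
Lemma dependent_growth p n (a : 'I_n -> C) (w : 'I_n -> nat) (lt : rel (expo n)) v c :
  minprime (idl [set a i | i in setT]) p -> (forall i, (0 < w i)%N) -> mono_ord lt ->
  ~ p c ->
  addI (spanm a [set u | lt v u /\ wt w u = wt w v])
    (addI (mulI p (wspan a w (wt w v))) (wspan a w (wt w v).+1)) (c * mon a v) ->
  poly_growth p n.-1.
Proof.
move=> mp w0 [hlt _] pc hv; have [pp bp _] := mp.
have [k hk] := minprime_pw hC (idl_ideal _) mp.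
apply: (@growth_upper _ _ hC pp n a w (fun u => ~~ expo_le v u) k w0 hk _
  (\sum_i v i)%N).
(* Induction on the number of larger monomials of degree at most [wt w u]: the relation rewrites a
   multiple of [v] by larger monomials of the same weight, whose degrees the weight bounds, together
   with terms already in [H]. *)
- move=> u; have [m] := ubnP (count (fun z => lt u z) (mons n (wt w u))).
  elim: m u => // m IH u; rewrite ltnS => um M.
  set H := addI _ _.
  have iJ : ideal (addI (mulI p (wspan a w M)) (wspan a w M.+1)).
    by apply: addI_ideal; [exact: mulI_ideal | exact: wspan_ideal].
  have iH : ideal H by apply: addI_ideal => //; exact: spanm_ideal.
  have iL := loc_ideal pp iH.
  case: (boolP (expo_le v u)) => [vu|nvu]; last first.
    by apply: loc_sub => //; apply: addI_subl => //; apply: spanm_mem.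
  pose z := subX u v; have uE : u = addX v z by rewrite subXK.
  suff : loc p H (c * mon a u).
    move=> [e ne he]; exists (e * c); first exact: prime_mul.
    by rewrite -mulrA.
  rewrite uE monD mulrA; case: hv => x [y hy hxy] hx.
  have -> : c * mon a v * mon a z =
    (c * mon a v - x) * mon a z + ((x - y) * mon a z + y * mon a z) by ring.
  apply: (idealD iL); last apply: (idealD iL).
  + suff : spanm a [set u' | lt u u' /\ wt w u' = M] ((c * mon a v - x) * mon a z).
      apply: (spanm_min iL) => u' [uu' wu'].
      move: IH => /(_ u'); rewrite /= wu' -/M -/H; apply.
      apply: leq_trans um.
      apply: (@count_rank_lt _ (fun x y => lt y x)) => //.
      - by move=> t; apply: mp_irr.
      - by move=> t1 t2 t3 h1 h2; apply: mp_trans h2 h1.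
      - exact: mons_uniq.
      - by rewrite mem_mons -wu' degX_le_wt.
    apply: spanm_mul hx => u' [vu' wu']; rewrite /= /M uE !wtD wu' mp_add //.
  + apply: loc_sub => //; apply: addI_subr; first exact: spanm_ideal.
    apply: addI_subl; first exact: wspan_ideal.
    move: (x - y) hxy; apply: (@mulI_min _ _ _ [set x | mulI _ _ (x * _)]).
      by apply: ideal_colon; apply: mulI_ideal.
    move=> d f pd Jf /=; rewrite -mulrA; apply: mulI_mem => //.
    by rewrite /M uE wtD; apply: wspanM => //; apply: wspan_mon.
  + apply: loc_sub => //; apply: addI_subr; first exact: spanm_ideal.
    apply: addI_subr; first exact: mulI_ideal.
    by rewrite /M uE wtD -addSn; apply: wspanM => //; apply: wspan_mon.
- by move=> i; apply: bp; apply: idl_range.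
(* A monomial not divisible by [v] has an exponent below some [v i], whence the constant
   [\sum_i v i]. *)
- move=> N; rewrite big_distrl /=.
  apply: (@leq_trans (\sum_(i < n) #|[pred f : {ffun 'I_n -> 'I_N} | (f i < v i)%N]|));
    last by apply: leq_sum => i _; apply: card_box_lt.
  rewrite -sum1_card; under [X in (_ <= X)%N]eq_bigr do rewrite -sum1_card.
  rewrite (exchange_big_dep predT) //= [X in (X <= _)%N]big_mkcond /=.
  apply: leq_sum => f _; case: ifP => // nvf; move: nvf; rewrite inE => /forallPn [i].
  rewrite ffunE -ltnNge => fi.
  by rewrite (bigD1 i) //=.
Qed.
End Krull.

(** * Chains of primes and generic sequences *)

Section Chains.
Variable C : comPzRingType.
Hypothesis hC : noetherian C.
Implicit Types (p q I J P Q : set C) (l : seq C).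

Definition lidl l : set C := idl [set x | x \in l].

Lemma lidl_ideal l : ideal (lidl l). Proof. exact: idl_ideal. Qed.

Lemma lidl_mem l x : x \in l -> lidl l x. Proof. by move=> xl; apply: idl_sub. Qed.

Lemma lidl_min l I : ideal I -> (forall x, x \in l -> I x) -> lidl l `<=` I.
Proof. by move=> iI h; apply: idl_min. Qed.

Lemma lidl_rcons l x I : ideal I -> lidl l `<=` I -> I x -> lidl (rcons l x) `<=` I.
Proof.
move=> iI lI Ix; apply: lidl_min => // y; rewrite mem_rcons inE => /orP [/eqP->//|yl].
by apply: lI; apply: lidl_mem.
Qed.

Lemma lidl_rcons_sub l x : lidl l `<=` lidl (rcons l x).
Proof.
apply: lidl_min; first exact: lidl_ideal.
by move=> y yl; apply: lidl_mem; rewrite mem_rcons inE yl orbT.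
Qed.

(* The elements of [l] cut down the dimension one at a time, like a partial
   system of parameters. *)
Definition generic l : Prop := forall j, (j < size l)%N -> forall q,
  minprime (lidl (take j l)) q -> ~ q (nth 0 l j).

Lemma generic_nil : generic [::]. Proof. by []. Qed.

Lemma generic_rcons l x : generic (rcons l x) <->
  generic l /\ forall q, minprime (lidl l) q -> ~ q x.
Proof.
split=> [h|[h hx] j].
  split=> [j jl q|q].
    have := h j _ q; rewrite size_rcons ltnS nth_rcons jl -cats1 takel_cat ?(ltnW jl) //.
    exact.
  have := h (size l) _ q; rewrite size_rcons ltnS nth_rcons ltnn eqxx -cats1 take_size_cat //.
  exact.
rewrite size_rcons ltnS leq_eqVlt => /orP [/eqP ->|jl] q.
  by rewrite nth_rcons ltnn eqxx -cats1 take_size_cat //; apply: hx.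
by rewrite nth_rcons jl -cats1 takel_cat ?(ltnW jl) //; apply: h.
Qed.

(** Two ideals are treated at once because [chain_avoiding] extends [g :: k] and [k] by the same
    element. *)
Lemma avoid_minprimes I I' J : ideal I -> ideal I' -> ideal J ->
  (forall q, minprime I q \/ minprime I' q -> ~ J `<=` q) ->
  exists2 x, J x & forall q, minprime I q \/ minprime I' q -> ~ q x.
Proof.
move=> iI iI' iJ h.
have [Ps [Ps1 Ps2]] := minprime_list hC iI.
have [Qs [Qs1 Qs2]] := minprime_list hC iI'.
pose L := [seq q <- Ps ++ Qs | `[< minprime I q \/ minprime I' q >]].
have [|x Jx hx] := @prime_avoidance _ J L iJ.
  move=> q; rewrite mem_filter => /andP [/asboolP hq]; split; last exact: h.
  by case: hq => [] [].
exists x => // q hq; apply: hx; rewrite mem_filter mem_cat; apply/andP; split.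
  exact/asboolP.
by case: hq => [/Ps2->//|/Qs2->]; rewrite orbT.
Qed.

Lemma prime_chain_trunc n s (P : nat -> set C) : (s <= n)%N ->
  prime_chain n P -> prime_chain s P.
Proof.
move=> sn [h1 h2]; split=> i hi; [apply: h1 | apply: h2].
  exact: leq_trans hi sn.
exact: leq_trans hi sn.
Qed.

Lemma prime_chain_mono n (P : nat -> set C) i j : prime_chain n P ->
  (i <= j)%N -> (j <= n)%N -> P i `<=` P j.
Proof.
move=> [_ h] /subnK <-; elim: (j - i)%N => [|k IH] kn; first by rewrite add0n.
by apply: subset_trans (IH (ltnW kn)) _; have [] := h _ kn.
Qed.

(** A minimal prime over [rcons l x] contains a minimal prime over [l], which omits [x]; so every
    element of [l] adds a strict step. *)
Lemma generic_chain l p : generic l -> minprime (lidl l) p ->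
  exists q : nat -> set C, [/\ prime_chain (size l) q, q (size l) = p,
    minprime (lidl [::]) (q 0%N) &
    forall i, (i < size l)%N -> q i.+1 (nth 0 l i) /\ ~ q i (nth 0 l i)].
Proof.
elim/last_ind: l p => [|l x IH] p.
  by move=> _ mp; have [pp _ _] := mp; exists (fun=> p); split.
move=> /generic_rcons [gl gx] [pp lp mp].
have [p' mp' p'p] := exists_minprime hC (lidl_ideal l) pp
  (subset_trans (lidl_rcons_sub (x := x)) lp).
have [q [[q1 q2] q3 q0 q4]] := IH p' gl mp'.
have px : p x by apply: lp; apply: lidl_mem; rewrite mem_rcons mem_head.
exists (fun i => if (i <= size l)%N then q i else p); rewrite size_rcons ltnn; split=> //.
  split=> i; first by case: (leqP i (size l)) => [/q1//|].
  rewrite ltnS /=; case: (ltngtP i (size l)) => //= [il _|-> _]; first exact: q2.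
  by rewrite q3; split=> // /(_ x px); apply: gx.
move=> i; rewrite ltnS nth_rcons; case: (ltngtP i (size l)) => //= [il _|-> _].
  exact: q4.
by rewrite q3; split=> //; apply: gx.
Qed.

(** As long as [p] is not minimal over [l], prime avoidance gives an element of [p] outside all
    minimal primes over [l]; adding it enlarges the ideal, so the process ends. *)
Lemma generic_extend l p : generic l -> prime_ideal p -> lidl l `<=` p ->
  exists l', generic (l ++ l') /\ minprime (lidl (l ++ l')) p.
Proof.
move=> gl pp lp.
suff H I : ideal I -> forall l, lidl l = I -> generic l -> lidl l `<=` p ->
    exists l', generic (l ++ l') /\ minprime (lidl (l ++ l')) p.
  exact: H (lidl_ideal l) l erefl gl lp.
move: I {l gl lp}; apply: (noeth_ind hC) => I iI IH l lI gl lp.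
case: (pselect (minprime (lidl l) p)) => [mp|nmp].
  by exists [::]; rewrite cats0.
have [|x px hx] := avoid_minprimes (lidl_ideal l) (lidl_ideal l)
    (prime_ideal_ideal pp).
  move=> q; move=> hq pq; have [prq lq mq] : minprime (lidl l) q by case: hq.
  apply: nmp; by have <- : q = p by apply/seteqP; split=> //; apply: mq.
have px' : lidl (rcons l x) `<=` p.
  by apply: lidl_rcons => //; apply: prime_ideal_ideal.
suff [l' [gl' ml']] : exists l', generic (rcons l x ++ l') /\
    minprime (lidl (rcons l x ++ l')) p by exists (x :: l'); rewrite -cat_rcons.
apply: (IH (lidl (rcons l x)) (lidl_ideal _) _ _ (rcons l x) erefl) => //.
- by rewrite -lI; apply: lidl_rcons_sub.
- move=> sub; have [q mq _] := exists_minprime hC (lidl_ideal l) pp lp.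
  apply: (hx q); first by left.
  have [_ lq _] := mq; apply: lq; rewrite lI; apply: sub.
  by apply: lidl_mem; rewrite mem_rcons mem_head.
- apply/generic_rcons; split=> // q mq; apply: hx; by left.
Qed.

(** A minimal prime over [l] that contains [P s.+1] also contains [P s], which contains [l]; by
    minimality it would equal [P s]. Hence the next element can be taken from [P s.+1]. *)
Lemma generic_of_chain s (P : nat -> set C) : prime_chain s P ->
  exists l, [/\ size l = s, generic l & lidl l `<=` P s].
Proof.
elim: s => [|s IH] hP.
  exists [::]; split=> //; apply: lidl_min => //.
  by apply: prime_ideal_ideal; apply: hP.1.
have [l [sl gl lP]] := IH (prime_chain_trunc (leqnSn s) hP).
have [sP nP] := hP.2 s (ltnSn s).
have pS := hP.1 s (leqnSn s); have pS1 := hP.1 s.+1 (leqnn _).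
have [|x Px hx] := avoid_minprimes (lidl_ideal l) (lidl_ideal l)
    (prime_ideal_ideal pS1).
  move=> q hq sub; have [prq lq mq] : minprime (lidl l) q by case: hq.
  apply: nP; apply: subset_trans (sub) _; apply: mq => //.
  by apply: subset_trans sP sub.
exists (rcons l x); rewrite size_rcons sl; split=> //.
  by apply/generic_rcons; split=> // q mq; apply: hx; left.
apply: lidl_rcons => //; first exact: prime_ideal_ideal.
exact: subset_trans lP sP.
Qed.

(** The variables are cancelled in turn. Modulo [q j] the power [a j ^+ v j] divides out, [a j]
    being outside that prime; a term with a higher power of [a j] keeps a factor [a j], which
    vanishes modulo [q j.+1]. In the end only [e] is left, modulo [q n]. *)
Lemma lex_initI_sub n (a : 'I_n -> C) (q : nat -> set C) :
  (forall i, (i <= n)%N -> prime_ideal (q i)) ->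
  (forall i : 'I_n, [/\ q i `<=` q i.+1, q i.+1 (a i) & ~ q i (a i)]) ->
  initI a (@lexlt n) `<=` q n.
Proof.
move=> q1 q2 e [v hv].
pose m j (u : expo n) := \prod_(i < n | (j <= i)%N) a i ^+ u i.
pose lexfrom j (u : expo n) := exists2 i : 'I_n, (j <= i)%N /\ (v i < u i)%N &
  forall k : 'I_n, (j <= k)%N -> (k < i)%N -> v k = u k.
pose Y j := addI (q j) (idl [set m j u | u in lexfrom j]).
have iY j : (j <= n)%N -> ideal (Y j).
  by move=> /q1 /prime_ideal_ideal ij; apply: addI_ideal => //; apply: idl_ideal.
have mS (j : 'I_n) u : m j u = a j ^+ u j * m j.+1 u.
  rewrite /m (bigD1 j) //=; congr (_ * _); apply: eq_bigl => i.
  by rewrite ltn_neqAle eq_sym andbC.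
suff H j : (j <= n)%N -> Y j (e * m j v).
  have [y hy] := H n (leqnn n).
  rewrite /m big1 ?mulr1 => [|i]; last by rewrite leqNgt ltn_ord.
  have -> : y = 0; last by rewrite subr0.
  by apply: (idl_min (ideal_set0 C) _ hy) => t [u [i [ni _] _] _]; move: ni; rewrite leqNgt ltn_ord.
elim: j => [|j IH] jn.
  apply: addI_subr; first by apply: prime_ideal_ideal; apply: q1.
  have m0 u : m 0%N u = mon a u by [].
  rewrite m0; apply: spanmS hv => u /lexltP [i h k] /=.
  by exists i => // k' _; apply: k.
have [qS qa nqa] := q2 (Ordinal jn); set o := Ordinal jn in qa nqa.
have iY1 := iY j.+1 jn.
have ij1 := prime_ideal_ideal (q1 _ jn).
have sub : idl [set m j u | u in lexfrom j] `<=`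
    [set x | exists2 y, Y j.+1 y & x = a o ^+ v o * y].
  apply: idl_min.
    split.
    - by exists 0; rewrite ?mulr0 //; apply: ideal0.
    - move=> _ _ [x hx ->] [y hy ->]; exists (x + y); first exact: idealD.
      by rewrite mulrDr.
    - move=> r _ [x hx ->]; exists (r * x); first exact: idealM.
      by rewrite mulrCA.
  move=> _ [u [i [ji ui] hi] <-]; move: (mS o u) => /= ->.
  case: (ltngtP i j) ji => // ij _.
    exists (m j.+1 u); last by rewrite (hi o) //=.
    apply: addI_subr => //; apply: idl_sub; exists u => //; exists i => // k jk.
    by apply: hi; apply: ltnW.
  have ei : i = o by apply: val_inj.
  move: ui; rewrite ei => ui; exists (a o * (a o ^+ (u o - v o).-1 * m j.+1 u)).
    apply: addI_subl; first exact: idl_ideal.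
    exact: idealMr.
  rewrite !mulrA -exprSr -exprD; congr (_ ^+ _ * _).
  by move: ui; lia.
have [y /sub [z hz ->]] := IH (ltnW jn).
move: (mS o v) => /= ->.
have -> : e * (a o ^+ v o * m j.+1 v) - a o ^+ v o * z =
   a o ^+ v o * (e * m j.+1 v - z) by ring.
have pj := q1 _ (ltnW jn); case: (pj) => _ _ /[apply] -[/(prime_exp pj nqa)//|h].
apply: (ideal_subr iY1) hz; apply: addI_subl; first exact: idl_ideal.
exact: qS.
Qed.

(** * The height theorem and the independence of generic sequences *)

Lemma lidl_range l : idl [set nth 0 l i | i in @setT 'I_(size l)] = lidl l.
Proof.
apply/seteqP; split; apply: idl_min; try exact: idl_ideal.
  by move=> _ [i _ <-]; apply: lidl_mem; apply: mem_nth.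
move=> x /= xl; apply: idl_sub; have xs : (index x l < size l)%N by rewrite index_mem.
by exists (Ordinal xs) => //=; rewrite nth_index.
Qed.

Lemma generic_height l p m : generic l -> minprime (lidl l) p -> poly_growth p m ->
  (size l <= m)%N.
Proof.
move=> gl mp hm; have [pp lp _] := mp.
have [q [[q1 q2] q3 _ q4]] := generic_chain gl mp.
pose a (i : 'I_(size l)) := nth 0 l i.
have lexp : initI a (@lexlt _) `<=` p.
  rewrite -q3; apply: lex_initI_sub => // i; have [h1 h2] := q4 i (ltn_ord i).
  by split=> //; have [] := q2 i (ltn_ord i).
have [k hk] := minprime_pw hC (lidl_ideal l) mp.
apply: (growth_lower hC pp (lexlt_ord _) lexp (k := k) _ hm).
apply: subset_trans hk _; apply: locS; rewrite -lidl_range.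
apply: idl_min; first exact: initI_ideal (mo_pre (lexlt_ord _)).
by move=> _ [i _ <-]; apply: (initI_var a i (mo_pre (lexlt_ord _))).
Qed.

(** Krull's height theorem in comparative form: at [p] the growth is at least [N ^ size l] and at
    most [N ^ size l']. *)
Lemma krull_height l l' p : generic l -> minprime (lidl l) p ->
  minprime (lidl l') p -> (size l <= size l')%N.
Proof.
move=> gl mp; rewrite -(lidl_range l') => mp'.
exact: generic_height gl mp (minprime_growth hC mp').
Qed.

Lemma initI_height s (a : 'I_s -> C) (lt : rel (expo s)) l p : mono_ord lt ->
  minprime (initI a lt) p -> minprime (lidl l) p -> (s <= size l)%N.
Proof.
move=> olt mp; rewrite -(lidl_range l) => mp'; have [pp ap _] := mp.
have [k hk] := minprime_pw hC (initI_ideal a (mo_pre olt)) mp.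
exact: (growth_lower hC pp olt ap hk (minprime_growth hC mp')).
Qed.

(** Such a relation would lower the growth at [p] to the exponent [(size l).-1], against
    [generic_height]. *)
Lemma generic_independent l p (w : 'I_(size l) -> nat) (lt : rel (expo (size l)))
    (a := fun i : 'I_(size l) => nth 0 l i) v c :
  generic l -> minprime (lidl l) p -> (0 < size l)%N -> (forall i, (0 < w i)%N) ->
  mono_ord lt -> ~ p c ->
  ~ addI (spanm a [set u | lt v u /\ wt w u = wt w v])
    (addI (mulI p (wspan a w (wt w v))) (wspan a w (wt w v).+1)) (c * mon a v).
Proof.
move=> gl mp l0 w0 olt nc hv; have mp' := mp; move: mp'; rewrite -(lidl_range l) => mp'.
have := generic_height gl mp (dependent_growth hC mp' w0 olt nc hv).
by rewrite leqNgt prednK // leqnn.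
Qed.

(* In a sequence [g :: l2] of maximal length, a prime minimal over [l2] does not
   contain [g], and there is a long chain below it. *)
Lemma chain_avoiding s (P : nat -> set C) g :
  (forall q, minprime (lidl [::]) q -> ~ q g) -> prime_chain s.+1 P ->
  exists (Q : nat -> set C) (r : set C), [/\ prime_chain s Q, minprime (lidl [::]) (Q 0%N), ~ Q s g &
    [/\ prime_ideal r, Q s `<=` r & ~ r `<=` Q s]].
Proof.
move=> hg hP; set p := P s.+1; have pp : prime_ideal p := hP.1 _ (leqnn _).
have [l [sl gl lp]] := generic_of_chain hP.
have [l' [gl' mp']] := generic_extend gl pp lp.
have sl' : (s < size (l ++ l'))%N by rewrite size_cat sl leq_addr.
case: (pselect (p g)) => [pg|npg]; last first.
  have [q [qc qn q0 _]] := generic_chain gl' mp'.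
  exists q, (q s.+1); split=> //.
  - by apply: (prime_chain_trunc _ qc); apply: ltnW.
  - by rewrite -/p -qn in npg => /(prime_chain_mono qc (ltnW sl') (leqnn _)).
  - by have [h1 h2] := qc.2 s sl'; split=> //; apply: qc.1.
have [l2 [gl2 g2 mp2]] : exists l2, [/\ generic (g :: l2), generic l2 &
    minprime (lidl (g :: l2)) p].
  suff H I : ideal I -> forall l, lidl (g :: l) = I -> generic (g :: l) ->
      generic l -> lidl (g :: l) `<=` p ->
      exists l2, [/\ generic (g :: l2), generic l2 & minprime (lidl (g :: l2)) p].
    apply: (H _ (lidl_ideal [:: g]) [::]) => //; last first.
      by apply: lidl_min => [|x]; [exact: prime_ideal_ideal | rewrite inE => /eqP->].
    by rewrite -[[:: g]]/(rcons [::] g); apply/generic_rcons.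
  move: I; apply: (noeth_ind hC) => I iI IH k kI gk1 gk2 kp.
  case: (pselect (minprime (lidl (g :: k)) p)) => [mp|nmp]; first by exists k.
  have ksub : lidl k `<=` lidl (g :: k).
    apply: lidl_min => [|x xk]; first exact: lidl_ideal.
    by apply: lidl_mem; rewrite inE xk orbT.
  have [|x px hx] := avoid_minprimes (lidl_ideal (g :: k)) (lidl_ideal k)
      (prime_ideal_ideal pp).
    move=> q [] [prq kq mq] pq; apply: nmp.
      by have <- : q = p by apply/seteqP; split=> //; apply: mq.
    (* A prime minimal over [k] that contains [p] equals [p]; but then [p] is minimal over [g :: k]
       as well, against [nmp]. *)
    have qp : q = p.
      by apply/seteqP; split=> //; apply: mq => //; apply: subset_trans ksub kp.
    split=> // t pt gkt tp; rewrite -qp; apply: mq => //; last by rewrite qp.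
    exact: subset_trans ksub gkt.
  have h1 : lidl (rcons (g :: k) x) `<=` p.
    by apply: lidl_rcons => //; apply: prime_ideal_ideal.
  apply: (IH (lidl (rcons (g :: k) x)) (lidl_ideal _) _ _ (rcons k x) erefl) => //.
  - by rewrite -kI; apply: lidl_rcons_sub.
  - move=> sub; have [q mq _] := exists_minprime hC (lidl_ideal (g :: k)) pp kp.
    apply: (hx q); first by left.
    have [_ lq _] := mq; apply: lq; rewrite kI; apply: sub.
    by apply: lidl_mem; rewrite mem_rcons mem_head.
  - apply/(@generic_rcons (g :: k)); split=> // q mq; apply: hx; by left.
  - apply/generic_rcons; split=> // q mq; apply: hx; by right.
(* From [s < size (l ++ l') <= (size l2).+1], the element [g] accounting for the successor. *)
have s2 : (s <= size l2)%N by have := leq_trans sl' (krull_height gl' mp' mp2).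
have l2p : lidl l2 `<=` p.
  have [_ h _] := mp2; apply: subset_trans h; apply: lidl_min => [|x xl].
    exact: lidl_ideal.
  by apply: lidl_mem; rewrite inE xl orbT.
have [q mq qp] := exists_minprime hC (lidl_ideal l2) pp l2p.
(* Otherwise [p] would be minimal over [l2], although the longer sequence [g :: l2] is generic at
   [p]. *)
have npq : ~ p `<=` q.
  move=> pq; have qE : q = p by apply/seteqP; split.
  by have := krull_height gl2 mp2 (l' := l2); rewrite -{1}qE ltnn => /(_ mq).
have [Q [Qc Qn Q0 _]] := generic_chain g2 mq.
have Qq : Q s `<=` q by rewrite -Qn; apply: (prime_chain_mono Qc).
exists Q, p; split=> //.
- exact: (prime_chain_trunc _ Qc).
- move=> /Qq qg; apply: npq; have [_ _ h] := mp2; apply: h => //.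
    by case: mq.
  apply: lidl_min => [|x]; first by case: mq => /prime_ideal_ideal.
  rewrite inE => /orP [/eqP->//|xl]; case: mq => _ + _; apply.
  exact: lidl_mem.
- split=> //; first exact: subset_trans Qq qp.
  by move=> pQ; apply: npq; apply: subset_trans pQ Qq.
Qed.
End Chains.

(** * Simple extensions *)

Section PolyMod.
Variables (R : comNzRingType) (P : set R).
Hypothesis pP : prime_ideal P.
Implicit Types F G : {poly R}.

Let iP : ideal P := prime_ideal_ideal pP.

Definition polyI : set {poly R} := [set F | forall i, P F`_i].

Lemma polyI_ideal : ideal polyI.
Proof.
split=> [i|F G hF hG i|r F hF i] /=; rewrite ?coef0 ?coefD ?coefM.
- exact: ideal0.
- by apply: idealD; [|exact: hF|exact: hG].
- by apply: ideal_sum => // j _; apply: idealM.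
Qed.

Lemma polyIC c : polyI c%:P <-> P c.
Proof.
split=> [/(_ 0%N)|Pc i]; first by rewrite coefC.
by rewrite coefC; case: ifP => // _; apply: ideal0.
Qed.

(** Leading terms with coefficient in [P] are dropped. The size of [F'] is the size of [F] over
    [R / P], so degree arguments over that domain need no quotient. *)
Lemma poly_trim F : ~ polyI F -> exists F', [/\ (size F' <= size F)%N,
  ~ P (lead_coef F') & polyI (F - F')].
Proof.
have [n] := ubnP (size F); elim: n F => // n IH F; rewrite ltnS => sF nF.
case: (pselect (P (lead_coef F))) => [lF|nl]; last first.
  exists F; split=> //; rewrite subrr; apply: ideal0; exact: polyI_ideal.
have F0 : F != 0 by apply: contra_notN nF => /eqP ->; apply: ideal0; exact: polyI_ideal.
pose m := lead_coef F *: 'X^((size F).-1).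
have Pm : polyI m.
  move=> i; rewrite coefZ coefXn; case: eqP => _; rewrite ?mulr1 ?mulr0 //.
  exact: ideal0.
have sm : (size (F - m)%R < size F)%N.
  apply: leq_ltn_trans (_ : (size F).-1 < _)%N; last by rewrite prednK // size_poly_gt0.
  apply/leq_sizeP => j; rewrite leq_eqVlt => /orP [/eqP <-|lj].
    by rewrite coefB coefZ coefXn eqxx mulr1 subrr.
  rewrite coefB coefZ coefXn gtn_eqF // mulr0 subr0 nth_default //.
  by rewrite -(prednK (n := size F)) // size_poly_gt0.
have [||F' [s' l' h']] := IH (F - m).
- exact: leq_trans sm sF.
- move=> h; apply: nF; apply: (ideal_subr polyI_ideal) (idealD polyI_ideal h Pm).
  by rewrite subrK subrr; apply: ideal0; exact: polyI_ideal.
exists F'; split=> //; first exact: leq_trans s' (ltnW sm).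
have -> : F - F' = (F - m - F') + m by ring.
exact: (idealD polyI_ideal).
Qed.

Lemma lead_coef_mul_mod F G : ~ P (lead_coef F) -> ~ P (lead_coef G) ->
  ~ P (F * G)`_(size F + size G).-2.
Proof. by move=> hF hG; rewrite -mul_lead_coef; apply: prime_mul. Qed.

Lemma polyI_prime : prime_ideal polyI.
Proof.
have iI := polyI_ideal; split=> // [/polyIC /(prime_neg1 pP) //|F G hFG].
apply: contrapT => /not_orP [/poly_trim [F' [_ lF hF]] /poly_trim [G' [_ lG hG]]].
apply: (lead_coef_mul_mod lF lG); suff : polyI (F' * G') by apply.
have -> : F' * G' = F * G - ((F - F') * G + F' * (G - G')) by ring.
by apply: (idealB iI hFG); apply: (idealD iI); [exact: (idealMr _ iI hF)|exact: (idealM _ iI hG)].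
Qed.

End PolyMod.

Section SimpleExtension.
Variables (R B : comNzRingType) (psi : {rmorphism R -> B}) (b : B).
Implicit Types (F G : {poly R}) (y : B).

Definition ev F : B := (map_poly psi F).[b].

Lemma evD F G : ev (F + G) = ev F + ev G.
Proof. by rewrite /ev rmorphD hornerD. Qed.
Lemma evB F G : ev (F - G) = ev F - ev G.
Proof. by rewrite /ev rmorphB hornerD hornerN. Qed.
Lemma evM F G : ev (F * G) = ev F * ev G.
Proof. by rewrite /ev rmorphM hornerM. Qed.
Lemma evC c : ev c%:P = psi c.
Proof. by rewrite /ev map_polyC hornerC. Qed.
Lemma evX : ev 'X = b.
Proof. by rewrite /ev map_polyX hornerX. Qed.
Lemma evXn n : ev 'X^n = b ^+ n.
Proof. by rewrite /ev map_polyXn hornerXn. Qed.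
Lemma evZ c F : ev (c *: F) = psi c * ev F.
Proof. by rewrite -mul_polyC evM evC. Qed.
Lemma ev0 : ev 0 = 0. Proof. by rewrite /ev rmorph0 horner0. Qed.
Lemma ev1 : ev 1 = 1. Proof. by rewrite /ev rmorph1 hornerE. Qed.

Definition simple_ext : Prop := forall y, exists F, y = ev F.
Hypothesis sB : simple_ext.

Lemma ideal_preim (I : set B) : ideal I -> ideal [set x | I (psi x)].
Proof.
move=> iI; split=> [|x y Ix Iy|r x Ix] /=; rewrite ?rmorph0 ?rmorphD ?rmorphM.
- exact: ideal0.
- exact: idealD.
- exact: idealM.
Qed.

Lemma prime_preim (Q : set B) : prime_ideal Q -> prime_ideal [set x | Q (psi x)].
Proof.
move=> [iQ n1 pr]; split; first exact: ideal_preim.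
  by rewrite /= rmorph1.
by move=> x y /=; rewrite rmorphM => /pr.
Qed.

Lemma ev_polyI (I : set B) F : ideal I -> polyI [set x | I (psi x)] F -> I (ev F).
Proof.
move=> iI hF; rewrite /ev horner_coef; apply: ideal_sum => // i _.
by rewrite coef_map; apply: idealMr => //; apply: hF.
Qed.

(* Hilbert's basis theorem: [L J d] is the ideal of leading coefficients of the
   polynomials of degree [d] that evaluate into [J]. *)
Lemma noetherian_simple_ext : noetherian R -> noetherian B.
Proof.
move=> hR I iI.
pose L (J : set B) d : set R := [set r | exists F, [/\ (size F <= d.+1)%N,
  F`_d = r & J (ev F)]].
have iL J d : ideal J -> ideal (L J d).
  move=> iJ; split.
  - by exists 0; rewrite size_poly0 coef0 ev0; split=> //; apply: ideal0.
  - move=> _ _ [F [sF <- JF]] [G [sG <- JG]]; exists (F + G); split.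
    + by rewrite (leq_trans (size_polyD _ _)) // geq_max sF.
    + by rewrite coefD.
    + by rewrite evD; apply: idealD.
  - move=> r _ [F [sF <- JF]]; exists (r *: F); split.
    + exact: leq_trans (size_scale_leq _ _) sF.
    + by rewrite coefZ.
    + by rewrite evZ; apply: idealM.
have LS J d : ideal J -> L J d `<=` L J d.+1.
  move=> iJ _ [F [sF <- JF]]; exists (F * 'X); split.
  - by rewrite (leq_trans (size_polyMleq _ _)) // size_polyX addn2.
  - by rewrite coefMX.
  - by rewrite evM; apply: idealMr.
have Lmono J d e : ideal J -> (d <= e)%N -> L J d `<=` L J e.
  move=> iJ /subnK <-; elim: (e - d)%N => [//|k IH]; exact: subset_trans IH (LS _ _ iJ).
have [N hN] := noeth_acc hR (fun d => iL I d iI) (fun d => LS I d iI).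
have gens d : exists2 t : seq B, (forall y, y \in t -> I y) &
    L I d `<=` L (lidl t) d.
  have [g gE] := hR _ (iL I d iI).
  have [t tI gt] : exists2 t : seq B, (forall y, y \in t -> I y) &
      forall r, r \in g -> L (lidl t) d r.
    have : forall r, r \in g -> L I d r by move=> r rg; rewrite gE; apply: idl_sub.
    elim: (g) => [|r h IH] hh; first by exists [::].
    have [|t tI ht] := IH; first by move=> x xh; apply: hh; rewrite inE xh orbT.
    have [F [sF Fr IF]] := hh r (mem_head _ _).
    exists (ev F :: t) => [y|x]; rewrite inE => /orP [/eqP->//|]; first exact: tI.
      by exists F; split=> //; apply: lidl_mem; rewrite mem_head.
    move=> /ht [G [sG Gx IG]]; exists G; split=> //.
    by apply: idlS IG => y /= yt; rewrite inE yt orbT.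
  exists t => //; rewrite gE; apply: idl_min => //.
  by apply: iL; apply: lidl_ideal.
have [t tI ht] : exists2 t : seq B, (forall y, y \in t -> I y) &
    forall d, (d <= N)%N -> L I d `<=` L (lidl t) d.
  elim: (N) => [|M [t tI ht]].
    have [t tI ht] := gens 0%N; exists t => // d; rewrite leqn0 => /eqP ->; exact: ht.
  have [u uI hu] := gens M.+1; exists (t ++ u).
    by move=> y; rewrite mem_cat => /orP [/tI|/uI].
  have sub d (t' : seq B) : {subset t' <= t ++ u} -> L (lidl t') d `<=` L (lidl (t ++ u)) d.
    move=> tt _ [F [sF <- JF]]; exists F; split=> //.
    by apply: idlS JF => y /= /tt.
  move=> d; rewrite leq_eqVlt ltnS => /orP [/eqP ->|/ht h].
    apply: subset_trans hu _; apply: sub => y yu; by rewrite mem_cat yu orbT.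
  apply: subset_trans h _; apply: sub => y yt; by rewrite mem_cat yt.
have it := lidl_ideal t.
have {}ht d : L I d `<=` L (lidl t) d.
  case: (leqP d N) => [/ht//|Nd].
  apply: subset_trans (hN d (ltnW Nd)) _; apply: subset_trans (ht N (leqnn N)) _.
  by apply: Lmono; rewrite // ltnW.
have tIs : lidl t `<=` I by apply: lidl_min.
exists t; apply/seteqP; split=> // y; have [F ->] := sB y => {y}.
have [d] : exists d, (size F <= d)%N by exists (size F).
elim: d F => [|d IH] F sF IF.
  by move: sF; rewrite leqn0 size_poly_eq0 => /eqP ->; rewrite ev0; apply: ideal0.
have [|G [sG Gd JG]] := ht d F`_d; first by exists F.
rewrite -(subrK G F) evD; apply: (idealD it) => //; apply: IH.
  apply/leq_sizeP => j; rewrite leq_eqVlt => /orP [/eqP <-|dj].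
    by rewrite coefB Gd subrr.
  by rewrite coefB !nth_default ?subrr // (leq_trans _ dj).
by rewrite evB; apply: idealB => //; apply: tIs.
Qed.

End SimpleExtension.

(** Going up above a fixed prime, for chains that avoid some [g]. The element [g1] to be avoided
    upstairs is part of the definition to make the property compose along a tower. *)
Definition lifting (R B : comNzRingType) (psi : R -> B) : Prop :=
  forall (Q0 : set B) (g1 : B), prime_ideal Q0 -> ~ Q0 g1 ->
  exists2 g, ~ Q0 (psi g) & forall n (P : nat -> set R), prime_chain n P ->
    P 0%N = [set x | Q0 (psi x)] -> ~ P n g ->
    exists Q : nat -> set B, [/\ prime_chain n Q, Q 0%N = Q0,
      forall i, (i <= n)%N -> P i = [set x | Q i (psi x)] & ~ Q n g1].

(* The form in which the Jacobson property is used; it passes to finitely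
   generated algebras without appeal to the Nullstellensatz. *)
Definition goldman (R : comPzRingType) : Prop := forall (q r : set R) g,
  prime_ideal q -> prime_ideal r -> q `<=` r -> ~ r `<=` q -> ~ q g ->
  exists P, [/\ prime_ideal P, q `<=` P, ~ P `<=` q & ~ P g].

Lemma strict_preim (R B : Type) (psi : R -> B) (P P' : set R) (Q Q' : set B) :
  P `<` P' -> P = [set x | Q (psi x)] -> P' = [set x | Q' (psi x)] ->
  ~ Q' `<=` Q.
Proof. by move=> [_ nP] PE PE' QQ; apply: nP => x; rewrite PE PE' => /QQ. Qed.

(** * Lifting chains of primes through a simple extension *)

Section Lifting.
Variables (R B : comNzRingType) (psi : {rmorphism R -> B}) (b : B).
Hypotheses (sB : simple_ext psi b) (hB : noetherian B).
Variable Q0 : set B.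
Hypothesis pQ0 : prime_ideal Q0.
Notation ev := (ev psi b).
Let P0 : set R := [set x | Q0 (psi x)].
Let pP0 : prime_ideal P0 := prime_preim psi pQ0.
Let iQ0 : ideal Q0 := prime_ideal_ideal pQ0.
Let iP0 : ideal P0 := prime_ideal_ideal pP0.

Section Transcendental.
Hypothesis tb : forall F, Q0 (ev F) -> polyI P0 F.

Let ext (P : set R) : set B := [set y | exists2 F, polyI P F & y = ev F].

Let extP (P : set R) F : prime_ideal P -> P0 `<=` P -> ext P (ev F) -> polyI P F.
Proof.
move=> pP PP [G hG /eqP]; rewrite -subr_eq0 -evB => /eqP h.
apply: (ideal_subr (polyI_ideal pP) _ hG) => i; apply: PP; apply: tb.
by rewrite h; apply: ideal0.
Qed.

Let ext_prime (P : set R) : prime_ideal P -> P0 `<=` P -> prime_ideal (ext P).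
Proof.
move=> pP PP; have iI := polyI_ideal pP; split.
- split.
  + by exists 0; [exact: ideal0 | rewrite ev0].
  + move=> _ _ [F hF ->] [G hG ->]; exists (F + G); last by rewrite evD.
    exact: (idealD iI).
  + move=> r _ [F hF ->]; have [H ->] := sB r; exists (H * F); last by rewrite evM.
    exact: (idealM _ iI).
- by rewrite -(ev1 psi b) => /(extP pP PP) /(prime_neg1 (polyI_prime pP)).
- move=> x y; have [F ->] := sB x; have [G ->] := sB y.
  rewrite -evM => /(extP pP PP); case: (polyI_prime pP) => _ _ pr /pr [] h; [left|right];
  by [exists F | exists G].
Qed.

Lemma lifting_transcendental g1 : ~ Q0 g1 -> exists2 g, ~ Q0 (psi g) &
  forall n (P : nat -> set R), prime_chain n P -> P 0%N = P0 -> ~ P n g ->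
    exists Q : nat -> set B, [/\ prime_chain n Q, Q 0%N = Q0,
      forall i, (i <= n)%N -> P i = [set x | Q i (psi x)] & ~ Q n g1].
Proof.
have [G ->] := sB g1 => nG; have [i nGi] : exists i, ~ P0 G`_i.
  apply: contrapT => h; apply: nG; apply: ev_polyI => // i.
  by apply: contrapT => hi; apply: h; exists i.
exists G`_i => // n P hP PE nPg.
have sub j : (j <= n)%N -> P0 `<=` P j.
  by move=> jn; rewrite -PE; apply: (prime_chain_mono hP).
have PiE j : (j <= n)%N -> P j = [set x | ext (P j) (psi x)].
  move=> jn; apply/seteqP; split=> x.
    by move=> Px; exists x%:P; [apply/polyIC => //; exact: hP.1 | rewrite evC].
  by rewrite /= -(evC psi b) => /(extP (hP.1 _ jn) (sub _ jn)) /(polyIC (hP.1 _ jn)).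
exists (fun j => ext (P j)); split=> //.
- split=> [j jn|j jn]; first by apply: ext_prime; [exact: hP.1 | exact: sub].
  split; last by apply: strict_preim (hP.2 j jn) (PiE _ (ltnW jn)) (PiE _ jn).
  by move=> _ [F hF ->]; exists F => // k; apply: (hP.2 j jn).1.
- rewrite PE; apply/seteqP; split=> y; first by move=> [F hF ->]; apply: ev_polyI.
  by have [F ->] := sB y => /tb hF; exists F.
- by move=> /(extP (hP.1 _ (leqnn n)) (sub _ (leqnn n))) /(_ i).
Qed.

(** Euclid's argument: over a domain and for nonzero [G], the polynomial [1 + 'X * G] is neither
    zero nor a unit, and a prime containing its value [t] cannot contain that of [G]. *)
Lemma goldman_transcendental g : ~ Q0 g ->
  exists P, [/\ prime_ideal P, Q0 `<=` P, ~ P `<=` Q0 & ~ P g].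
Proof.
have [G ->] := sB g => nG.
have nGp : ~ polyI P0 G by move=> h; apply: nG; apply: ev_polyI.
have [G' [_ lG' hG']] := poly_trim pP0 nGp.
pose t := 1 + b * ev G.
have iI := addp_ideal t iQ0.
have [|P pP sP] := @noeth_maximal_prime _ hB _ iI.
  move=> [c]; have [Y ->] := sB c => h.
  have {h} : polyI P0 (1 - Y * (1 + 'X * G)).
    by apply: tb; rewrite evB ev1 evM evD ev1 evM evX.
  move=> hY; have nY : ~ polyI P0 Y.
    move=> h; apply: (prime_neg1 (polyI_prime pP0)).
    apply: (ideal_subr (polyI_ideal pP0) hY).
    exact: (idealMr _ (polyI_ideal pP0)).
  have [Y' [_ lY' hY']] := poly_trim pP0 nY.
  apply: (prime_mul pP0 lY' lG').
  have hh : polyI P0 (1 - Y' * (1 + 'X * G')).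
    have -> : 1 - Y' * (1 + 'X * G') = 1 - Y * (1 + 'X * G) +
      ((Y - Y') * (1 + 'X * G') + Y * 'X * (G - G')) by ring.
    have ip := polyI_ideal pP0; apply: (idealD ip hY); apply: (idealD ip).
      exact: (idealMr _ ip).
    exact: (idealM _ ip).
  have Y0 : (0 < size Y')%N.
    rewrite size_poly_gt0; apply/eqP => Y0; apply: lY'; rewrite Y0 lead_coef0.
    exact: ideal0.
  have G0 : (0 < size G')%N.
    rewrite size_poly_gt0; apply/eqP => G0; apply: lG'; rewrite G0 lead_coef0.
    exact: ideal0.
  (* In this positive degree [Y' * 'X * G'] has its leading coefficient, whereas 1 and [Y'] have
     coefficient 0. *)
  have := hh (size Y' + size G').-1.
  rewrite mulrDr mulr1 coefB coefD coef1 mulrCA mulrC coefMX.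
  have idx : (0 < (size Y' + size G').-1)%N by case: (size Y') Y0 => // m _; case: (size G') G0 => // k _; rewrite addSn addnS.
  rewrite (gtn_eqF idx).
  rewrite -mul_lead_coef [Y'`_ _]nth_default; last first.
    by case: (size G') G0 => // k _; rewrite addnS leq_addr.
  by rewrite mulr0n !add0r => /(idealN iP0); rewrite opprK.
exists P; split=> //.
- by apply: subset_trans sP; apply: addp_sub.
- move=> PQ; have /tb h : Q0 (ev (1 + 'X * G)).
    by rewrite evD ev1 evM evX; apply: PQ; apply: sP; apply: addp_mem.
  apply: nGp => i; have := h i.+1.
  by rewrite coefD coef1 add0r mulrC coefMX.
- move=> Pg; apply: (prime_neg1 pP); have iP := prime_ideal_ideal pP.
  have : P t by apply: sP; apply: addp_mem.
  move=> Pt; have -> : 1 = t - b * ev G by rewrite addrK.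
  by apply: (idealB iP Pt); apply: (idealM _ iP).
Qed.
End Transcendental.

Section Algebraic.
Variable f : {poly R}.
Hypotheses (Qf : Q0 (ev f)) (lf : ~ P0 (lead_coef f)).

Let size_lead (F : {poly R}) : ~ P0 (lead_coef F) -> F != 0.
Proof.
by move=> lF; apply: contra_notN lF => /eqP ->; rewrite lead_coef0; apply: ideal0.
Qed.

(* Euclid's algorithm modulo [P0]: a polynomial of least degree representing
   a multiple of [y] must be constant. *)
Lemma algebraic_multiple y : ~ Q0 y -> exists h c, ~ P0 c /\ Q0 (y * h - psi c).
Proof.
move=> nQy.
pose ann d := `[< exists F, [/\ Q0 (ev F), ~ P0 (lead_coef F) & size F = d] >].
have exann : exists d, ann d by exists (size f); apply/asboolP; exists f.
case: (ex_minnP exann) => d /asboolP [F [QF lF sF]] mind.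
have small G : ~ P0 (lead_coef G) -> (size G < d)%N -> ~ Q0 (ev G).
  move=> lG; rewrite ltnNge => /negP h QG; apply: h; apply: mind.
  by apply/asboolP; exists G.
pose rep e := `[< exists G h, [/\ Q0 (y * h - ev G), ~ P0 (lead_coef G) & size G = e] >].
have rep_trim G h : Q0 (y * h - ev G) -> ~ polyI P0 G ->
    exists2 e, (e <= size G)%N & rep e.
  move=> QG /(poly_trim pP0) [G' [sG' lG' hG']]; exists (size G') => //.
  apply/asboolP; exists G', h; split=> //.
  have -> : y * h - ev G' = (y * h - ev G) + ev (G - G') by rewrite evB; ring.
  by apply: (idealD iQ0 QG); apply: ev_polyI.
have [Y yE] := sB y.
have [e0 le0 re0] : exists2 e, (e < d)%N & rep e.
  have YF := Pdiv.ComRing.rdivp_eq F Y; set N := Pdiv.Ring.rscalp _ _ in YF.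
  set r := Pdiv.Ring.rmodp _ _ in YF.
  have sr : (size r < d)%N by rewrite -sF Pdiv.Ring.ltn_rmodpN0 // size_lead.
  have Qr : Q0 (y * psi (lead_coef F ^+ N) - ev r).
    have -> : y * psi (lead_coef F ^+ N) - ev r = ev (Pdiv.Ring.rdivp Y F) * ev F.
      by rewrite -evM mulrC yE -evZ YF evD addrK.
    exact: (idealM _ iQ0).
  have [|e es re] := rep_trim _ _ Qr; last by exists e => //; apply: leq_ltn_trans es sr.
  move=> /(ev_polyI b iQ0) Qevr; have : Q0 (y * psi (lead_coef F ^+ N)).
    exact: (ideal_subr iQ0 Qr).
  have lN : ~ Q0 (psi (lead_coef F ^+ N)) := prime_exp (n := N) pP0 lF.
  exact: prime_mul.
have exrep : exists e, rep e by exists e0.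
case: (ex_minnP exrep) => e /asboolP [G [h [QG lG sG]]] mine.
have ed : (e < d)%N by apply: leq_ltn_trans le0; apply: mine.
have nQG : ~ Q0 (ev G) by apply: small; rewrite ?sG.
case: (leqP e 1) => [e1|e1].
  exists h, (lead_coef G); split=> //; move: QG; rewrite {1}(size1_polyC (p := G)) ?sG //.
  rewrite evC; have -> // : lead_coef G = G`_0.
  by rewrite lead_coefE sG; case: (e) e1 => [|[]].
(* If [G] is not constant, dividing [F] by [G] leaves a remainder that represents a multiple of [y]
   in smaller degree, so it is zero modulo [P0]. Then the quotient [q], of smaller degree than [F],
   vanishes at [b] modulo [Q0], against the minimality of [F]. *)
have FG := Pdiv.ComRing.rdivp_eq G F; set N := Pdiv.Ring.rscalp _ _ in FG.
set r := Pdiv.Ring.rmodp _ _ in FG; set q := Pdiv.Ring.rdivp _ _ in FG.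
have sr : (size r < e)%N by rewrite -sG Pdiv.Ring.ltn_rmodpN0 // size_lead.
have evr : ev r = psi (lead_coef G ^+ N) * ev F - ev q * ev G.
  by rewrite -evZ FG evD evM addrAC subrr add0r.
have Pr : polyI P0 r.
  apply: contrapT => nr; have [||e' e's /mine] := rep_trim r (- (ev q * h)).
  - rewrite evr; have -> : y * - (ev q * h) - (psi (lead_coef G ^+ N) * ev F - ev q * ev G) =
      - (ev q * (y * h - ev G) + psi (lead_coef G ^+ N) * ev F) by ring.
    apply: (idealN iQ0); apply: (idealD iQ0); exact: (idealM _ iQ0).
  - exact: nr.
  - by rewrite leqNgt (leq_ltn_trans e's sr).
have Qq : Q0 (ev q).
  have : Q0 (ev q * ev G).
    have -> : ev q * ev G = psi (lead_coef G ^+ N) * ev F - ev r by rewrite evr; ring.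
    by apply: (idealB iQ0); [exact: (idealM _ iQ0) | exact: ev_polyI].
  by case: pQ0 => _ _ /[apply] -[].
have lN := prime_exp (n := N) pP0 lG.
have nq : ~ polyI P0 q.
  move=> Pq; apply: (prime_mul pP0 lN lF).
  rewrite lead_coefE -coefZ FG coefD; apply: (idealD iP0); last exact: Pr.
  exact: (idealMr _ (polyI_ideal pP0) Pq).
have [q' [sq' lq' hq']] := poly_trim pP0 nq.
have Qq' : Q0 (ev q').
  have -> : ev q' = ev q - ev (q - q') by rewrite evB; ring.
  by apply: (idealB iQ0 Qq); apply: ev_polyI.
have dq' : (size q' < d)%N.
  rewrite ltnNge; apply/negP => dq; apply: (lead_coef_mul_mod pP0 lq' lG).
  have -> : q' * G = (lead_coef G ^+ N *: F - r) - (q - q') * G by rewrite FG; ring.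
  have ip := polyI_ideal pP0.
  rewrite coefB; apply: (idealB iP0); last exact: (idealMr _ ip hq').
  rewrite coefB; apply: (idealB iP0); last exact: Pr.
  rewrite coefZ nth_default ?mulr0; first exact: ideal0.
  by rewrite sF; move: dq e1; rewrite -sG; case: (size G) => [|[|k]] // dq _;
    rewrite !addnS /= (leq_trans dq) // leq_addr.
by case: (small q').
Qed.

(* Nakayama's argument on the generators [1, b, b ^+ 2, ...] of [B] modulo [Q],
   localized at [P']. *)
Lemma lying_over (Q : set B) (P' : set R) g1 : prime_ideal Q -> Q0 `<=` Q ->
  prime_ideal P' -> [set x | Q (psi x)] `<=` P' -> ~ P' (lead_coef f) ->
  (exists h c, ~ P' c /\ Q0 (g1 * h - psi c)) ->
  exists Q', [/\ prime_ideal Q', Q `<=` Q', P' = [set x | Q' (psi x)] & ~ Q' g1].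
Proof.
move=> pQ QQ pP' PP' lP' [h [c [nc Qgh]]].
have iQ := prime_ideal_ideal pQ; have iP' := prime_ideal_ideal pP'.
pose I := addI Q (idl [set psi x | x in P']).
have iI : ideal I by apply: addI_ideal => //; exact: idl_ideal.
pose M j y := exists F : {poly R}, (size F <= j)%N /\ Q (y - ev F).
have claim0 y : exists2 a, ~ P' a & M (size f).-1 (psi a * y).
  have [Y ->] := sB y; have YF := Pdiv.ComRing.rdivp_eq f Y.
  set N := Pdiv.Ring.rscalp _ _ in YF; set r := Pdiv.Ring.rmodp _ _ in YF.
  exists (lead_coef f ^+ N); first exact: prime_exp.
  have f0 : f != 0 by apply: size_lead.
  exists r; split; first by rewrite -ltnS prednK ?size_poly_gt0 // Pdiv.Ring.ltn_rmodpN0.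
  by rewrite -evZ YF evD addrK evM; apply: (idealM _ iQ); apply: QQ.
have disj a : ~ P' a -> ~ I (psi a).
  move=> na Ia.
  (* Here [j] is the number of powers of [b] that generate [B] modulo [Q], locally at [P']. An
     element of [I] coming from outside [P'] lets it drop down to 0, which puts an element from
     outside [P'] into [Q]. *)
  suff claim j : (forall y, exists2 a, ~ P' a & M j (psi a * y)) -> False.
    exact: claim claim0.
  elim: j => [|j IH] hj.
    have [d nd [F [sF QF]]] := hj 1; apply: nd; apply: PP' => /=.
    move: sF QF; rewrite leqn0 size_poly_eq0 => /eqP ->.
    by rewrite ev0 subr0 mulr1.
  pose U : set B := [set y | exists2 d, ~ P' d &
    exists F : {poly R}, [/\ (size F <= j.+1)%N, polyI P' F & Q (psi d * y - ev F)]].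
  have iPP := polyI_ideal pP'.
  have UD x y : U x -> U y -> U (x + y).
    move=> [d nd [F [sF PF QF]]] [e ne [G [sG PG QG]]]; exists (d * e).
      exact: prime_mul.
    exists (e *: F + d *: G); split.
    - rewrite (leq_trans (size_polyD _ _)) // geq_max.
      by rewrite !(leq_trans (size_scale_leq _ _)).
    - by apply: (idealD iPP); rewrite -mul_polyC; apply: (idealM _ iPP).
    - have -> : psi (d * e) * (x + y) - ev (e *: F + d *: G) =
        psi e * (psi d * x - ev F) + psi d * (psi e * y - ev G).
        by rewrite evD !evZ rmorphM; ring.
      by apply: (idealD iQ); apply: (idealM _ iQ).
  pose U' : set B := [set z | forall y, U (z * y)].
  have iU' : ideal U'.
    split.
    - move=> y; rewrite mul0r; exists 1; first exact: prime_neg1.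
      exists 0; rewrite size_poly0 ev0 mulr0 subr0; split=> //.
        exact: (ideal0 iPP).
      exact: ideal0.
    - by move=> x z hx hz y; rewrite mulrDl; apply: UD; [apply: hx | apply: hz].
    - by move=> r x hx y; rewrite mulrC mulrA -mulrC mulrCA mulrC -mulrA; apply: hx.
  have IU : I `<=` U'.
    move=> z [t ht hzt]; rewrite -(subrK t z); apply: (idealD iU').
      move=> y; exists 1; first exact: prime_neg1.
      exists 0; rewrite size_poly0 ev0 rmorph1 mul1r subr0; split=> //.
        exact: (ideal0 iPP).
      exact: idealMr.
    move: t ht {hzt}; apply: (idl_min iU') => _ [p Pp <-] y.
    have [d nd [F [sF QF]]] := hj y; exists d => //.
    exists (p *: F); split.
    - exact: leq_trans (size_scale_leq _ _) sF.
    - by move=> i; rewrite coefZ; apply: idealMr.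
    - rewrite evZ; have -> : psi d * (psi p * y) - psi p * ev F =
        psi p * (psi d * y - ev F) by ring.
      exact: idealM.
  have [d nd [F [sF PF QF]]] := IU _ Ia (b ^+ j).
  pose trunc (G : {poly R}) := \poly_(i < j) G`_i.
  have evtr (G : {poly R}) : (size G <= j.+1)%N -> ev G = psi G`_j * b ^+ j + ev (trunc G).
    move=> sG; rewrite -(evXn psi) -evZ -evD; congr ev; apply/polyP => i.
    rewrite coefD coefZ coefXn coef_poly; case: (ltngtP i j) => ij.
    - by rewrite mulr0 add0r.
    - by rewrite mulr0 addr0 nth_default // (leq_trans sG).
    - by rewrite ij mulr1 addr0.
  (* Multiplication by [psi a] sends [b ^+ j] into [P'] times the generators; as [k] is outside
     [P'], this expresses [b ^+ j] by lower powers. *)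
  pose k := d * a - F`_j.
  have nk : ~ P' k.
    move=> Pk; apply: (prime_mul pP' nd na); apply: (ideal_subr iP' Pk); exact: PF.
  have Qk : Q (psi k * b ^+ j - ev (trunc F)).
    move: QF; rewrite evtr // /k rmorphB rmorphM.
    by have -> : psi d * (psi a * b ^+ j) - (psi F`_j * b ^+ j + ev (trunc F)) =
      (psi d * psi a - psi F`_j) * b ^+ j - ev (trunc F) by ring.
  apply: IH => y; have [e ne [G [sG QG]]] := hj y.
  exists (k * e); first exact: prime_mul.
  exists (G`_j *: trunc F + k *: trunc G); split.
    rewrite (leq_trans (size_polyD _ _)) // geq_max.
    by rewrite !(leq_trans (size_scale_leq _ _)) ?size_poly.
  rewrite evD !evZ rmorphM; move: QG; rewrite evtr // => QG.
  have -> : psi k * psi e * y - (psi G`_j * ev (trunc F) + psi k * ev (trunc G)) =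
    psi k * (psi e * y - (psi G`_j * b ^+ j + ev (trunc G))) +
    psi G`_j * (psi k * b ^+ j - ev (trunc F)) by ring.
  by apply: (idealD iQ); apply: (idealM _ iQ).
(* Including the powers of [g1] makes [Q'] avoid it. As [g1 * h] is [psi c] modulo [Q0], an element
   of [S] in [I] would yield one excluded by [disj]. *)
pose S : set B := [set z | exists2 a, ~ P' a & exists k, z = psi a * g1 ^+ k].
have [|||Q' [pQ' IQ' SQ']] := @noeth_prime _ hB I S iI.
- exists 1; first exact: prime_neg1.
  by exists 0%N; rewrite rmorph1 mulr1.
- move=> _ _ [a na [k ->]] [d nd [m ->]]; exists (a * d); first exact: prime_mul.
  by exists (k + m)%N; rewrite rmorphM exprD mulrACA.
- move=> z Iz [a na [k zE]]; move: Iz; rewrite {}zE {z} => Iz.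
  apply: (disj (a * c ^+ k)); first by apply: prime_mul => //; apply: prime_exp.
  have sI : Q0 `<=` I.
    by move=> z /QQ Qz; apply: addI_subl => //; apply: idl_ideal.
  have Ik : I ((g1 * h) ^+ k - psi (c ^+ k)).
    rewrite rmorphXn subrXX; apply: idealMr => //; exact: sI.
  rewrite rmorphM.
  have -> : psi a * psi (c ^+ k) = psi a * g1 ^+ k * h ^+ k -
    psi a * ((g1 * h) ^+ k - psi (c ^+ k)) by rewrite exprMn; ring.
  by apply: (idealB iI); [apply: (idealMr _ iI) | apply: (idealM _ iI)].
exists Q'; split=> //.
- by apply: subset_trans IQ'; apply: addI_subl; apply: idl_ideal.
- apply/seteqP; split=> x.
    by move=> Px; apply: IQ'; apply: addI_subr => //; apply: idl_sub; exists x.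
  move=> /SQ' nS; apply: contrapT => nx; apply: nS; exists x => //.
  by exists 0%N; rewrite mulr1.
- move=> /SQ' nS; apply: nS; exists 1; first exact: prime_neg1.
  by exists 1%N; rewrite rmorph1 mul1r.
Qed.

(** Avoiding [lead_coef f] makes [b] integral modulo [Q0], locally, as [lying_over] requires;
    avoiding [c], which is a multiple of [g1] modulo [Q0], keeps [g1] outside the lifted primes. *)
Lemma lifting_algebraic g1 : ~ Q0 g1 -> exists2 g, ~ Q0 (psi g) &
  forall n (P : nat -> set R), prime_chain n P -> P 0%N = P0 -> ~ P n g ->
    exists Q : nat -> set B, [/\ prime_chain n Q, Q 0%N = Q0,
      forall i, (i <= n)%N -> P i = [set x | Q i (psi x)] & ~ Q n g1].
Proof.
move=> ng1; have [h [c [nc hc]]] := algebraic_multiple ng1.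
exists (lead_coef f * c); first exact: (prime_mul pP0 lf nc).
elim=> [|n IH] P hP PE nPg.
  exists (fun=> Q0); split=> // i; by rewrite leqn0 => /eqP ->.
have nPn : ~ P n (lead_coef f * c) by move/((hP.2 n (ltnSn n)).1).
have [Q [Qc QE QP nQ]] := IH P (prime_chain_trunc (leqnSn n) hP) PE nPn.
have pP := hP.1 n.+1 (leqnn _).
have nl : ~ P n.+1 (lead_coef f).
  by move=> hl; apply: nPg; apply: idealMr => //; apply: prime_ideal_ideal.
have nc' : ~ P n.+1 c.
  by move=> hl; apply: nPg; apply: idealM => //; apply: prime_ideal_ideal.
have [||||Q' [pQ' QQ' PQ' nQ']] := @lying_over (Q n) (P n.+1) g1 (Qc.1 n (leqnn n)) _ pP.
- by rewrite -QE; apply: (prime_chain_mono Qc).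
- by rewrite -QP //; case: (hP.2 n (ltnSn n)).
- exact: nl.
- by exists h, c.
exists (fun i => if (i <= n)%N then Q i else Q'); rewrite ltnn; split=> //.
- split=> i; first by case: (leqP i n) => [ni _|//]; apply: Qc.1.
  rewrite ltnS; case: (ltngtP i n) => //= [ni _|-> _]; first exact: Qc.2.
  split=> //; exact: (strict_preim (hP.2 n (ltnSn n)) (QP n (leqnn n)) PQ').
- by move=> i; case: (leqP i n) => [ni _|ni ni1]; [exact: QP | have -> : i = n.+1 by apply/eqP; rewrite eqn_leq ni1 ni].
Qed.

(** An element of [r] outside [Q0] has a multiple that comes, modulo [Q0], from outside [P0] in [R];
    so [r] contracts to a prime strictly above [P0]. The prime given by [goldman R] is lifted as a
    chain of length 1. *)
Lemma goldman_algebraic r g : goldman R -> prime_ideal r -> Q0 `<=` r ->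
  ~ r `<=` Q0 -> ~ Q0 g ->
  exists P, [/\ prime_ideal P, Q0 `<=` P, ~ P `<=` Q0 & ~ P g].
Proof.
move=> gR pr Qr nrQ ng.
have [g' ng' lift] := lifting_algebraic ng.
have [y [ry nQy]] : exists y, r y /\ ~ Q0 y.
  by move/existsNP: nrQ => [y /not_implyP [ry nQy]]; exists y.
have [h [c [nc hc]]] := algebraic_multiple nQy.
have ir := prime_ideal_ideal pr.
have rc : r (psi c).
  have -> : psi c = y * h - (y * h - psi c) by ring.
  by apply: (idealB ir); [apply: (idealMr _ ir) | apply: Qr].
have [||P [pP PP nPP nPg]] := gR P0 [set x | r (psi x)] g' pP0 (prime_preim psi pr) _ _ ng'.
- by move=> x /Qr.
- by move=> /(_ c rc).
have [||Q [Qc Q0E _ nQ]] := lift 1%N (fun i => if i is 0%N then P0 else P) _ erefl.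
- split=> [[|i]//|[|i]//]; by split.
- exact: nPg.
exists (Q 1%N); rewrite -Q0E; split=> //; first exact: Qc.1.
  by case: (Qc.2 0%N isT).
by case: (Qc.2 0%N isT).
Qed.
End Algebraic.

Lemma alg_or_trans : (forall F, Q0 (ev F) -> polyI P0 F) \/
  exists f, Q0 (ev f) /\ ~ P0 (lead_coef f).
Proof.
case: (pselect (forall F, Q0 (ev F) -> polyI P0 F)) => h; [by left | right].
move/existsNP: h => [F /not_implyP [QF /(poly_trim pP0) [F' [_ lF' hF']]]].
exists F'; split=> //.
have -> : ev F' = ev F - ev (F - F') by rewrite evB; ring.
by apply: (idealB iQ0 QF); apply: ev_polyI.
Qed.

End Lifting.

Lemma lifting_simple_ext (R B : comNzRingType) (psi : {rmorphism R -> B}) b :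
  simple_ext psi b -> noetherian B -> lifting psi.
Proof.
move=> sB hB Q0 g1 pQ0 ng1; case: (alg_or_trans psi b pQ0) => [tb|[f [Qf lf]]].
  exact: lifting_transcendental tb _ ng1.
exact: lifting_algebraic Qf lf _ ng1.
Qed.

Lemma goldman_simple_ext (R B : comNzRingType) (psi : {rmorphism R -> B}) b :
  simple_ext psi b -> noetherian B -> goldman R -> goldman B.
Proof.
move=> sB hB gR q r g pq pr qr nrq ng.
case: (alg_or_trans psi b pq) => [tb|[f [Qf lf]]].
  exact: goldman_transcendental tb _ ng.
exact: (goldman_algebraic sB hB pq Qf lf gR pr qr nrq ng).
Qed.

(** * Finitely generated algebras *)

Section Subring.
Variable B : comNzRingType.

Definition is_subring (S : set B) : Prop :=
  [/\ S 1, forall x y, S x -> S y -> S (x - y) & forall x y, S x -> S y -> S (x * y)].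

Definition subring_pred (S : set B) of is_subring S : {pred B} := fun x => `[< S x >].

Variables (S : set B) (hS : is_subring S).

Lemma subring_predP : subring_closed (subring_pred hS).
Proof.
case: (hS) => h1 hB hM; split.
- exact/asboolP.
- by move=> x y /asboolP Sx /asboolP Sy; apply/asboolP/hB.
- by move=> x y /asboolP Sx /asboolP Sy; apply/asboolP/hM.
Qed.

HB.instance Definition _ := GRing.isSubringClosed.Build B (subring_pred hS) subring_predP.

Definition subring_type := {x : B | subring_pred hS x}.

HB.instance Definition _ := SubChoice.on subring_type.
HB.instance Definition _ := [SubChoice_isSubComNzRing of subring_type by <:].


Variables (R : comNzRingType) (f : {rmorphism R -> B}).
Hypothesis hf : forall x, S (f x).

Definition corestrict x : subring_type := exist _ (f x) (asboolT (hf x)).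

Lemma corestrict_zmod : zmod_morphism corestrict.
Proof. by move=> x y; apply: val_inj; rewrite /= rmorphB. Qed.

Lemma corestrict_monoid : monoid_morphism corestrict.
Proof.
by split=> [|x y]; apply: val_inj; rewrite /= ?rmorph1 ?rmorphM.
Qed.

HB.instance Definition _ :=
  GRing.isZmodMorphism.Build R subring_type corestrict corestrict_zmod.
HB.instance Definition _ :=
  GRing.isMonoidMorphism.Build R subring_type corestrict corestrict_monoid.

End Subring.

Section Adjunction.

Definition adj (B : comNzRingType) (X : set B) : set B := smallest (@is_subring B) X.

Lemma adj_subring (B : comNzRingType) (X : set B) : is_subring (adj X).
Proof.
split=> [S [[]]//|x y Hx Hy S SX|x y Hx Hy S SX].
  by case: (SX) => -[_ hB _] _; apply: hB; [apply: Hx | apply: Hy].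
by case: (SX) => -[_ _ hM] _; apply: hM; [apply: Hx | apply: Hy].
Qed.

Lemma adj_sub (B : comNzRingType) (X : set B) : X `<=` adj X.
Proof. exact: sub_gen_smallest. Qed.

Lemma adj_min (B : comNzRingType) (X S : set B) : is_subring S -> X `<=` S ->
  adj X `<=` S.
Proof. exact: smallest_sub. Qed.

Opaque adj.

Definition gens (R B : comNzRingType) (psi : R -> B) (bs : seq B) : set B :=
  [set z | (exists x, z = psi x) \/ z \in bs].

Definition fg (R B : comNzRingType) (psi : R -> B) (bs : seq B) : Prop :=
  forall y, adj (gens psi bs) y.

Lemma subring_ev (R B : comNzRingType) (psi : {rmorphism R -> B}) b :
  is_subring [set y | exists F, y = ev psi b F].
Proof.
split; first by exists 1; rewrite ev1.
  by move=> _ _ [F ->] [G ->]; exists (F - G); rewrite evB.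
by move=> _ _ [F ->] [G ->]; exists (F * G); rewrite evM.
Qed.

Section Restrict.
Variables (R B : comNzRingType) (psi : {rmorphism R -> B}) (bs : seq B).

Let S := adj (gens psi bs).
Let hS : is_subring S := adj_subring (gens psi bs).

Lemma gens_map x : adj (gens psi bs) (psi x).
Proof. by apply: adj_sub; left; exists x. Qed.

Definition generated : comNzRingType := subring_type hS.

Definition generated_map : {rmorphism R -> generated} := corestrict hS gens_map.

Definition generated_val : {rmorphism generated -> B} := val.

Lemma generated_mapE x : generated_val (generated_map x) = psi x.
Proof. by []. Qed.

Lemma generated_val_inj : injective generated_val.
Proof. exact: val_inj. Qed.

Lemma generated_fg : exists cs : seq generated,
  map generated_val cs = bs /\ fg generated_map cs.
Proof.
have hbs x : x \in bs -> `[< S x >].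
  by move=> xb; apply/asboolP; apply: adj_sub; right.
have [cs csE] : exists cs : seq generated, map generated_val cs = bs.
  elim: (bs) hbs => [|x t IH] ht; first by exists [::].
  have [|cs csE] := IH; first by move=> y yt; apply: ht; rewrite inE yt orbT.
  by exists (exist _ x (ht x (mem_head _ _)) :: cs); rewrite /= csE.
exists cs; split=> // y.
have : S (generated_val y) by apply/asboolP; exact: (valP y).
have [h1 hB hM] := adj_subring (gens generated_map cs).
suff sub : S `<=` [set x | exists2 z, generated_val z = x & adj (gens generated_map cs) z].
  by move=> /sub [z /generated_val_inj ->].
apply: adj_min.
  split.
  - by exists 1; rewrite ?rmorph1.
  - by move=> _ _ [x <- hx] [z <- hz]; exists (x - z); [rewrite rmorphB | apply: hB].
  - by move=> _ _ [x <- hx] [z <- hz]; exists (x * z); [rewrite rmorphM | apply: hM].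
move=> y0 [[x ->]|].
  by exists (generated_map x) => //; apply: adj_sub; left; exists x.
rewrite -csE => /mapP [z zcs ->]; exists z => //; apply: adj_sub; by right.
Qed.

End Restrict.

Lemma fg_rcons (R B : comNzRingType) (psi : {rmorphism R -> B}) bs b :
  fg psi (rcons bs b) -> simple_ext (generated_val psi bs) b.
Proof.
move=> h y; apply: (adj_min (subring_ev (generated_val psi bs) b) _ (h y)) => z.
case=> [[x ->]|].
  by exists (generated_map psi bs x)%:P; rewrite evC generated_mapE.
rewrite mem_rcons inE => /orP [/eqP ->|zb]; first by exists 'X; rewrite evX.
have hz : `[< adj (gens psi bs) z >] by apply/asboolP; apply: adj_sub; right.
by exists (exist _ z hz : generated psi bs)%:P; rewrite evC.
Qed.

Lemma fg_nil (R B : comNzRingType) (psi : {rmorphism R -> B}) :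
  fg psi [::] -> simple_ext psi 0.
Proof.
move=> h y; apply: (adj_min (subring_ev psi 0) _ (h y)) => z [[x ->]|//].
by exists x%:P; rewrite evC.
Qed.

(** The last generator is split off: [B] is a simple extension of the subring generated by the
    others. With no generators left, the map is onto and counts as a simple extension by 0.
    Noetherianity is carried along because [T] is known for simple extensions of Noetherian
    rings. *)
Lemma fg_tower (T : forall R B : comNzRingType, {rmorphism R -> B} -> Prop) :
  (forall (R B : comNzRingType) (psi : {rmorphism R -> B}) b, simple_ext psi b ->
     noetherian R -> T R B psi) ->
  (forall (R S B : comNzRingType) (f : {rmorphism R -> S}) (g : {rmorphism S -> B})
     (psi : {rmorphism R -> B}), (forall x, g (f x) = psi x) ->
     T R S f -> T S B g -> T R B psi) ->
  forall (R B : comNzRingType) (psi : {rmorphism R -> B}) bs, fg psi bs ->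
    noetherian R -> noetherian B /\ T R B psi.
Proof.
move=> T1 T2 R B psi bs; have [n] := ubnP (size bs).
elim: n R B psi bs => // n IH R B psi bs; rewrite ltnS.
case/lastP: bs => [|bs b] sb hb hR.
  have s0 := fg_nil hb; split; first exact: noetherian_simple_ext s0 hR.
  exact: T1 s0 hR.
have [cs [csE hcs]] := generated_fg psi bs.
have [|hN hT] := IH _ _ (generated_map psi bs) cs _ hcs hR.
  by rewrite -(size_map (generated_val psi bs)) csE; rewrite size_rcons in sb.
have s1 := fg_rcons hb; split; first exact: noetherian_simple_ext s1 hN.
exact: T2 (generated_mapE psi bs) hT (T1 _ _ _ _ s1 hN).
Qed.


Lemma noetherian_fg (R B : comNzRingType) (psi : {rmorphism R -> B}) bs :
  fg psi bs -> noetherian R -> noetherian B.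
Proof. by move=> h hR; have [] := fg_tower (T := fun _ _ _ => True) _ _ h hR. Qed.

Lemma goldman_fg (R B : comNzRingType) (psi : {rmorphism R -> B}) bs :
  fg psi bs -> noetherian R -> goldman R -> goldman B.
Proof.
move=> h hR; have [||//] := fg_tower (T := fun R B _ => goldman R -> goldman B) _ _ h hR.
  move=> {R B psi bs h hR} R B psi b s hR; apply: (goldman_simple_ext s).
  exact: noetherian_simple_ext s hR.
by move=> {R B psi bs h hR} R S B f g psi _ h1 h2 /h1.
Qed.

Lemma lifting_fg (R B : comNzRingType) (psi : {rmorphism R -> B}) bs :
  fg psi bs -> noetherian R -> lifting psi.
Proof.
move=> h hR; have [||//] := fg_tower (T := fun R B psi => lifting psi) _ _ h hR.
  move=> {R B psi bs h hR} R B psi b s hR; apply: (lifting_simple_ext s).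
  exact: noetherian_simple_ext s hR.
move=> {R B psi bs h hR} R S B f g psi gf lf lg Q0 y pQ0 nQy.
have [y' ny' hy'] := lg Q0 y pQ0 nQy.
have [y0 ny0 hy0] := lf _ y' (prime_preim g pQ0) ny'.
exists y0 => [|n P hP PE nP]; first by rewrite -gf.
have [|P' [hP' P'0 P'E nP']] := hy0 n P hP _ nP.
  by rewrite PE; apply/seteqP; split=> x /=; rewrite gf.
have [Q [hQ Q0E QE nQ]] := hy' n P' hP' P'0 nP'.
exists Q; split=> // i ni; rewrite P'E // QE //.
by apply/seteqP; split=> x /=; rewrite gf.
Qed.

End Adjunction.

(** * The Jacobson property and the transfer of chains *)

Lemma maximal_ideal_prime (R : comPzRingType) (M : set R) :
  maximal_ideal M -> prime_ideal M.
Proof.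
move=> [iM n1 mM]; split=> // x y Mxy; apply: contrapT => /not_orP [nx ny].
have [ME|MT] := mM _ (addp_ideal x iM) (@addp_sub _ M x).
  by apply: nx; rewrite -ME; apply: addp_mem.
have [c hc] : addp M x 1 by rewrite MT.
apply: ny; have -> : y = (1 - c * x) * y + c * (x * y) by ring.
by apply: (idealD iM); [apply: (idealMr _ iM) | apply: (idealM _ iM)].
Qed.

(** [q] is not maximal, as [r] is larger; so a maximal ideal of the family with intersection [q]
    that omits [g] is strictly larger than [q]. *)
Lemma jacobson_goldman (R : comPzRingType) : jacobson R -> goldman R.
Proof.
move=> hR q r g pq pr qr nrq ng; have [F FM qE] := hR q pq.
have [M FMM nMg] : exists2 M, F M & ~ M g.
  apply: contrapT => h; apply: ng; rewrite qE => M FM'.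
  by apply: contrapT => nMg; apply: h; exists M.
have mM := FM _ FMM; have pM := maximal_ideal_prime mM.
have qM : q `<=` M by rewrite qE => x; apply.
exists M; split=> // Mq; have {}qM : q = M by apply/seteqP.
have [_ _ h] := mM; have := h r (prime_ideal_ideal pr); rewrite -qM => /(_ qr) [rE|rT].
  by apply: nrq; rewrite rE.
by apply: (prime_neg1 pr); rewrite rT.
Qed.

Section Transfer.

(** Modulo [q], [g] is a multiple of [g'], so a prime over [q] that avoids [g] avoids [g']: one
    element serves all minimal primes. Prime avoidance finds it in the intersection of the ideals
    [q + (G q)]. *)
Lemma common_multiplier (C : comPzRingType) (I : set C) (Phi : set C -> C -> Prop) :
  noetherian C -> ideal I ->
  (forall q, minprime I q -> exists g, ~ q g /\ Phi q g) ->
  exists g, forall q, minprime I q -> ~ q g /\ exists2 g', Phi q g' & addp q g' g.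
Proof.
move=> hC iI h.
pose G q : C := if pselect (minprime I q) is left mq then sval (cid (h q mq)) else 0.
have GP q : minprime I q -> ~ q (G q) /\ Phi q (G q).
  by move=> mq; rewrite /G; case: pselect => // mq'; exact: (svalP (cid (h q mq'))).
have [Ps [_ hPs]] := minprime_list hC iI.
pose L := [seq q <- Ps | `[< minprime I q >]].
have LP q : q \in L <-> minprime I q.
  rewrite mem_filter; split=> [/andP [/asboolP//]|mq].
  by rewrite hPs // andbT; apply/asboolP.
pose J : set C := [set x | forall q, minprime I q -> addp q (G q) x].
have iG q : minprime I q -> ideal (addp q (G q)).
  by case=> /prime_ideal_ideal iq _ _; apply: addp_ideal.
have iJ : ideal J.
  split=> [q mq|x y Jx Jy q mq|r x Jx q mq].
  - exact: ideal0 (iG q mq).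
  - exact: (idealD (iG q mq) (Jx q mq) (Jy q mq)).
  - exact: (idealM _ (iG q mq) (Jx q mq)).
have [|g Jg ng] := @prime_avoidance _ J L iJ.
  move=> q /LP mq; have [pq Iq mq'] := mq; split=> // Jq.
  (* A product with one factor for each [q']: an element of [q'] outside [q], or [G q] when [q'] is
     [q]. *)
  have [x nx hx] : exists2 x, ~ q x & forall q', q' \in L -> addp q' (G q') x.
    have : forall q', q' \in L -> minprime I q' by move=> q' /LP.
    elim: (L) => [|q' M IH] hM; first by exists 1; first exact: prime_neg1.
    have [|x nx hx] := IH; first by move=> t tM; apply: hM; rewrite inE tM orbT.
    have mt := hM q' (mem_head _ _); have [pt It _] := mt.
    have [y ny hy] : exists2 y, ~ q y & addp q' (G q') y.
      case: (pselect (q' `<=` q)) => [q'q|].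
        have -> : q' = q by apply/seteqP; split=> //; apply: mq'.
        exists (G q); first by case: (GP q mq).
        exact: addp_mem (prime_ideal_ideal pq).
      by move=> /existsNP [y /not_implyP [q'y nqy]]; exists y => //; apply: addp_sub.
    exists (x * y); first exact: prime_mul.
    move=> t; rewrite inE => /orP [/eqP ->|tM]; first exact: (idealM _ (iG _ mt)).
    apply: (idealMr _ (iG t _)); last exact: hx.
    by apply: hM; rewrite inE tM orbT.
  by apply: nx; apply: Jq => q' /LP; apply: hx.
exists g => q mq; split; first by apply: ng; apply/LP.
by exists (G q); [case: (GP q mq) | apply: Jg].
Qed.

(** By injectivity every minimal prime of [C] is contracted from [B], so lifting can start there.
    Contracted to [A], the lifted chain stays strict because its members already differ in [C]. *)
Lemma chain_transfer (C A B : comNzRingType) (f : {rmorphism C -> A})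
    (h : {rmorphism A -> B}) (bs : seq B) s (P : nat -> set C) :
  noetherian C -> goldman C -> injective (h \o f) -> fg (h \o f) bs ->
  prime_chain s.+1 P -> exists Q : nat -> set A, prime_chain s.+1 Q.
Proof.
move=> hC gC injf fgB hP; pose psi : {rmorphism C -> B} := h \o f.
have hB : noetherian B := @noetherian_fg _ _ psi bs fgB hC.
have lift : lifting psi := @lifting_fg _ _ psi bs fgB hC.
pose Phi (q : set C) g := forall n (P : nat -> set C), prime_chain n P -> P 0%N = q ->
  ~ P n g -> exists Q : nat -> set B, prime_chain n Q /\
    forall i, (i <= n)%N -> P i = [set x | Q i (psi x)].
have [||g hg] := @common_multiplier C (lidl [::]) Phi hC.
- exact: lidl_ideal.
- move=> q mq; have [pq _ minq] := mq.
  pose S : set B := [set z | exists2 x, ~ q x & z = psi x].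
  have [|||Q0 [pQ0 _ nQ0]] := @noeth_prime B hB (lidl [::]) S (lidl_ideal _).
  - by exists 1; [exact: prime_neg1 | rewrite rmorph1].
  - move=> _ _ [x nx ->] [y ny ->]; exists (x * y); first exact: prime_mul.
    by rewrite rmorphM.
  - move=> z hz [x nx zE]; apply: nx.
    have z0 : z = 0.
      by apply: (lidl_min (ideal_set0 B) _ hz) => t.
    have -> : x = 0 by apply: injf; rewrite -[LHS]/(psi x) -zE z0 /= !rmorph0.
    exact: ideal0 (prime_ideal_ideal pq).
  have sub : [set x | Q0 (psi x)] `<=` q.
    by move=> x Qx; apply: contrapT => nx; apply: (nQ0 _ Qx); exists x.
  have qE : q = [set x | Q0 (psi x)].
    apply/seteqP; split=> //; apply: minq => //; first exact: prime_preim.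
    by apply: lidl_min => //; apply: ideal_preim; apply: prime_ideal_ideal.
  have [g ng hg] := lift Q0 1 pQ0 (prime_neg1 pQ0).
  exists g; split; first by rewrite qE.
  move=> n P' hP' P'0 nP'; have [|Q [hQ _ QE _]] := hg n P' hP' _ nP'.
    by rewrite P'0.
  by exists Q.
have [Q [r [hQ mQ nQ [pr Qr nrQ]]]] := chain_avoiding hC (fun q mq => (hg q mq).1) hP.
(* [chain_avoiding] returns length [s] only; [r'], which avoids [g] too, restores [s.+1]. *)
have [r' [pr' Qr' nrQ' nr'g]] := gC _ _ g (hQ.1 s (leqnn s)) pr Qr nrQ nQ.
pose Q' i := if (i <= s)%N then Q i else r'.
have hQ' : prime_chain s.+1 Q'.
  split=> i; rewrite /Q'; first by case: (leqP i s) => // /hQ.1.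
  by rewrite ltnS; case: (ltngtP i s) => //= [/hQ.2//|-> _].
have [_ [g' hg' [c hc]]] := hg _ mQ.
have [|T [hT TE]] := hg' s.+1 Q' hQ' erefl.
  have ir' := prime_ideal_ideal pr'.
  rewrite /Q' ltnn => r'g'; apply: nr'g; apply: (ideal_subr ir' (y := c * g')).
    apply: Qr'; exact: (prime_chain_mono hQ (leq0n s) (leqnn s)).
  exact: idealM.
exists (fun i => [set x | T i (h x)]); split=> i hi.
  by apply: prime_preim; apply: hT.1.
have [TT _] := hT.2 i hi; split; first by move=> x /TT.
move=> sub; have [_] := hQ'.2 i hi; apply => x.
by rewrite (TE _ (ltnW hi)) (TE _ hi) => /sub.
Qed.

End Transfer.

(** * Chains of primes and the Krull dimension *)

Section KrullDim.
Variable A : comPzRingType.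

(** Chains can be truncated, so without one of length [s] the number [s.-1] bounds all lengths.
    Where [supremum] takes its default, the value is [-oo]. *)
Lemma krull_dim_ge s : (0 < s)%N -> ((s%:Z)%:E <= krull_dim A)%E ->
  exists P : nat -> set A, prime_chain s P.
Proof.
move=> s0 h; apply: contrapT => nP; move: h; apply/negP; rewrite -ltNge.
rewrite /krull_dim /supremum; case: ifP => _; first by rewrite ltNye.
case: xgetP => [d _ [_ lb]|_]; last by rewrite ltNye.
have ub : ubound [set (n%:Z)%:E | n in [set n | exists P, @prime_chain A n P]]
    ((s.-1)%:Z)%:E.
  move=> _ [n [P hP] <-]; rewrite lee_fin lez_nat -ltnS prednK // ltnNge.
  apply/negP => sn; apply: nP; exists P; exact: prime_chain_trunc sn hP.
by apply: le_lt_trans (lb _ ub) _; rewrite lte_fin ltz_nat prednK.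
Qed.

(** To exclude the default value of [supremum], a least upper bound is constructed: the maximal
    length, or [+oo] if lengths are unbounded. *)
Lemma krull_dim_lt s : (krull_dim A < (s%:Z)%:E)%E ->
  ~ exists P : nat -> set A, prime_chain s P.
Proof.
move=> h hs; move: h; apply/negP; rewrite -leNgt.
set D := [set (n%:Z)%:E | n in [set n | exists P, @prime_chain A n P]].
have Ds : D (s%:Z)%:E by exists s.
have [d [ubd lbd]] : exists d : \bar int, supremums D d.
  case: (pselect (exists N, forall n, (exists P, @prime_chain A n P) -> (n <= N)%N)).
    move=> [N hN]; pose q n := `[< exists P, @prime_chain A n P >].
    have exq : exists n, q n by exists s; apply/asboolP.
    have ubq n : q n -> (n <= N)%N by move=> /asboolP; apply: hN.
    case: (ex_maxnP exq ubq) => m /asboolP hm mm.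
    exists (m%:Z)%:E; split=> [_ [n hn <-]|e]; last by apply; exists m.
    by rewrite lee_fin lez_nat; apply: mm; apply/asboolP.
  move=> nb; exists +oo%E; split=> [e _|e ube]; first exact: leey.
  have Dunb N : exists2 n, (N < n)%N & exists P, @prime_chain A n P.
    apply: contrapT => h; apply: nb; exists N => n hn; rewrite leqNgt.
    by apply/negP => Nn; apply: h; exists n.
  case: e ube => [r|//|] ube; last by have := ube _ Ds.
  have [n rn hn] := Dunb `|r|%N.
  have : ((n%:Z)%:E <= r%:E)%E by apply: ube; exists n.
  rewrite lee_fin => nr; exfalso; move: rn; rewrite ltnNge => /negP; apply.
  by rewrite -lez_nat (le_trans nr) // abszE ler_norm.
have -> : krull_dim A = d.
  rewrite /krull_dim /supremum -/D; case: ifP => [/eqP D0|_].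
    by move: Ds; rewrite D0.
  case: xgetP => [e _ [ube lbe]|]; last by move=> /(_ d) [].
  by apply/eqP; rewrite eq_le (lbe _ ubd) (lbd _ ube).
exact: ubd.
Qed.

End KrullDim.

(** * Polynomials and the main theorem *)

Section Widening.

Lemma cm_big (I : choiceType) (T : Type) (r : seq T) (F : T -> {cmonom I}) j :
  (\big[mmul/mone]_(i <- r) F i) j = (\sum_(i <- r) F i j)%N.
Proof. exact: (big_morph (fun m : {cmonom I} => m j) (fun m1 m2 => cmM j m1 m2) (cm1 j)). Qed.

Lemma cm_exp (I : choiceType) (m : {cmonom I}) k j : expcmn m k j = (k * m j)%N.
Proof.
case: k => [|k]; first by rewrite cm1.
rewrite /expcmn iteropS; elim: k => [|k IH]; first by rewrite mul1n.
by rewrite iterS mulcmE IH -mulSn.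
Qed.

Definition widX n (u : expo n) : {cmonom nat} :=
  \big[mmul/mone]_(i < n) expcmn (ucm (i : nat)) (u i).

Lemma widXE n (u : expo n) (i : 'I_n) : widX u i = u i.
Proof.
rewrite /widX cm_big (bigD1 i) //= cm_exp cmUU muln1 big1 ?addn0 // => j ji.
by rewrite cm_exp cmU (_ : _ == _ = false) ?muln0 //; apply: contraNF ji.
Qed.

Lemma widX_out n (u : expo n) j : (n <= j)%N -> widX u j = 0%N.
Proof.
move=> nj; rewrite /widX cm_big big1 // => i _.
rewrite cm_exp cmU (_ : _ == _ = false) ?muln0 //.
by apply: ltn_eqF; apply: leq_trans nj.
Qed.

Lemma widXD n (u v : expo n) : widX (addX u v) = mmul (widX u) (widX v).
Proof.
apply/eqP/cmP => j; rewrite cmM; case: (ltnP j n) => jn; last by rewrite !widX_out.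
by have := widXE (addX u v) (Ordinal jn); rewrite ffunE -!widXE.
Qed.

Lemma widX0 n : widX (zeroX n) = mone.
Proof.
apply/eqP/cmP => j; rewrite cm1; case: (ltnP j n) => jn; last by rewrite widX_out.
by have := widXE (zeroX n) (Ordinal jn); rewrite ffunE.
Qed.

Lemma widX_inj n (u v : expo n) : widX u = widX v -> u = v.
Proof. by move=> uv; apply/ffunP => i; rewrite -!widXE uv. Qed.

Definition expoX (lt : rel {cmonom nat}) n : rel (expo n) :=
  fun u v => lt (widX u) (widX v).

Lemma expoX_pre (lt : rel {cmonom nat}) n : monomial_preorder lt ->
  mono_pre (@expoX lt n).
Proof.
move=> [swo pos add]; split.
- by move=> u v uv; apply/negP => vu; case: (swo _ _ (widX u) uv) => _; apply.
- by move=> u v z uv; apply/orP; have [h _] := swo _ _ (widX z) uv.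
- by move=> u v z; rewrite /expoX !widXD; apply/idP/idP => h;
    [exact: (add _ _ (widX z)).2 h | exact: (add _ _ (widX z)).1 h].
- move=> u u0; rewrite /expoX widX0; apply: pos.
  by rewrite -(widX0 n) => /widX_inj /eqP; rewrite (negPf u0).
Qed.

Definition pad s (m : {cmonom 'I_s}) (j : nat) : nat :=
  if insub j is Some i then m i else 0%N.

(** Padding with zeros is needed because a generic sequence may be longer than the [s] elements
    taken from it. *)
Definition expo_pad s n (m : {cmonom 'I_s}) : expo n := [ffun i : 'I_n => pad m i].

Lemma padE s (m : {cmonom 'I_s}) (i : 'I_s) : pad m i = m i.
Proof. by rewrite /pad valK. Qed.

Lemma pad_out s (m : {cmonom 'I_s}) j : (s <= j)%N -> pad m j = 0%N.
Proof. by move=> sj; rewrite /pad insubF // ltnNge sj. Qed.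

Lemma widX_pad s n (m : {cmonom 'I_s}) : (s <= n)%N ->
  widX (expo_pad n m) = widen_cmonom m.
Proof.
move=> sn; have -> : widen_cmonom m = widX (expo_pad s m).
  by apply: eq_bigr => i _; rewrite ffunE padE.
apply/eqP/cmP => j; case: (ltnP j s) => js.
  rewrite -[j]/(nat_of_ord (Ordinal js)) widXE ffunE.
  by rewrite -[nat_of_ord _]/(nat_of_ord (Ordinal (leq_trans js sn))) widXE ffunE.
rewrite [RHS]widX_out //; case: (ltnP j n) => jn; last by rewrite widX_out.
by rewrite -[j]/(nat_of_ord (Ordinal jn)) widXE ffunE pad_out.
Qed.

Lemma expo_pad_inj s n (m m' : {cmonom 'I_s}) : (s <= n)%N ->
  expo_pad n m = expo_pad n m' -> m = m'.
Proof.
move=> sn /ffunP h; apply/eqP/cmP => i.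
by have := h (Ordinal (leq_trans (ltn_ord i) sn)); rewrite !ffunE !padE.
Qed.

Lemma mon_pad (C : comPzRingType) s n (x : nat -> C) (m : {cmonom 'I_s}) :
  (s <= n)%N -> mon (fun i : 'I_n => x i) (expo_pad n m) = \prod_(i < s) x i ^+ m i.
Proof.
move=> sn; rewrite /mon.
have -> : \prod_(i < s) x i ^+ m i = \prod_(i < s) x i ^+ pad m i.
  by apply: eq_bigr => i _; rewrite padE.
rewrite (big_ord_widen n (fun i => x i ^+ pad m i) sn) [RHS]big_mkcond.
apply: eq_bigr => i _; rewrite ffunE; case: ltnP => // si.
by rewrite pad_out ?expr0.
Qed.

Definition cm_of s (u : expo s) : {cmonom 'I_s} :=
  \big[mmul/mone]_(i < s) expcmn (ucm i) (u i).

Lemma cm_ofE s (u : expo s) i : cm_of u i = u i.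
Proof.
rewrite /cm_of cm_big (bigD1 i) //= cm_exp cmUU muln1 big1 ?addn0 // => j /negPf ji.
by rewrite cm_exp cmU ji muln0.
Qed.

Lemma cm_ofK s (u : expo s) : expo_pad s (cm_of u) = u.
Proof. by apply/ffunP => i; rewrite ffunE padE cm_ofE. Qed.

End Widening.

Lemma mcoeff_sum_supp (R : comPzRingType) (K : choiceType) (f : {malg R[K]})
    (P : pred K) m :
  (\sum_(k <- msupp f | P k) << f@_k *g k >>)@_m =
    if (m \in msupp f) && P m then f@_m else 0.
Proof.
rewrite raddf_sum /= big_mkcond /=.
rewrite (eq_bigr (fun k => if P k && (k == m) then f@_m else 0)); last first.
  move=> k _; case: (P k) => //=; rewrite mcoeffU.
  by case: eqP => [->|_]; rewrite ?mulr1n ?mulr0n.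
case: (boolP (m \in msupp f)) => [mf|nmf] /=.
  rewrite (bigD1_seq m) ?fset_uniq //= eqxx andbT big1 ?addr0 //.
  by move=> k /negPf ->; rewrite andbF.
rewrite big1_seq // => k /= kf; case: eqP => [km|_]; last by rewrite andbF.
by move: nmf; rewrite -km kf.
Qed.

Lemma initial_formE (R : comPzRingType) s lt (f : {malg R[{cmonom 'I_s}]}) m :
  (initial_form lt f)@_m =
    if (m \in msupp f) &&
       all (fun m' => ~~ lt (widen_cmonom m') (widen_cmonom m)) (msupp f)
    then f@_m else 0.
Proof. exact: mcoeff_sum_supp. Qed.

Section Evaluation.
Variables (R A : comNzRingType) (phi : {rmorphism R -> A}) (s : nat) (a : 'I_s -> A).
Implicit Types f g : {malg R[{cmonom 'I_s}]}.

Let h (m : {cmonom 'I_s}) := \prod_(i < s) a i ^+ m i.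

Lemma mpevalD f g : mpeval phi a (f + g) = mpeval phi a f + mpeval phi a g.
Proof. exact: (@mmapD _ _ _ phi h). Qed.

Lemma mpevalN f : mpeval phi a (- f) = - mpeval phi a f.
Proof. exact: (@mmapN _ _ _ phi h). Qed.

Lemma mpeval0 : mpeval phi a 0 = 0.
Proof. exact: (@mmap0 _ _ _ phi h). Qed.

Lemma mpevalU c m : mpeval phi a << c *g m >> = phi c * \prod_(i < s) a i ^+ m i.
Proof. exact: (@mmapU _ _ _ phi h). Qed.

Lemma mpeval_sum (T : Type) (r : seq T) (F : T -> {malg R[{cmonom 'I_s}]}) :
  mpeval phi a (\sum_(i <- r) F i) = \sum_(i <- r) mpeval phi a (F i).
Proof. by elim/big_rec2: _ => [|i y x _ <-]; [exact: mpeval0 | rewrite mpevalD]. Qed.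

End Evaluation.

Lemma mono_ord_min n (lt : rel (expo n)) (T : eqType) (r : seq T) (F : T -> expo n)
    (Q : T -> Prop) x0 : mono_ord lt -> {in r &, injective F} -> x0 \in r -> Q x0 ->
  exists x, [/\ x \in r, Q x & forall y, y \in r -> Q y -> y != x -> lt (F x) (F y)].
Proof.
move=> [hlt tlt] injF.
have [k] := ubnP (count (lt^~ (F x0)) (undup (map F r))).
elim: k x0 => // k IH x; rewrite ltnS => xk xr Qx.
case: (pselect (exists y, [/\ y \in r, Q y & lt (F y) (F x)])) => [[y [yr Qy yx]]|h].
  apply: (IH y) => //; apply: leq_trans xk.
  apply: (count_rank_lt (mp_irr hlt) (fun _ _ _ => @mp_trans _ _ hlt _ _ _)) yx.
    exact: undup_uniq.
  by rewrite mem_undup map_f.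
exists x; split=> // y yr Qy yx.
have /tlt /orP [h'|//] : F y != F x by apply: contraNneq yx => /injF ->.
by case: h; exists y.
Qed.

(** * The two halves of the theorem for nonzero rings *)

Section Nontrivial.
Variables (R A : comNzRingType) (phi : {rmorphism R -> A}).
Hypothesis hR : noetherian R.

Lemma generated_noetherian bs : noetherian (generated phi bs).
Proof. by have [cs [_ hcs]] := generated_fg phi bs; apply: noetherian_fg hcs hR. Qed.

(** An invertible coefficient is outside [p]. Among the monomials with coefficient outside [p], the
    least one [m1] for the refined order is also minimal for [lt] in the whole support, so some
    weight attains its minimum at [m1]. The relation then has the shape excluded by
    [generic_independent]. *)
Lemma generic_family_independent bs s (l : seq (generated phi bs)) p lt :
  (s <= size l)%N -> (0 < size l)%N -> generic l -> minprime (lidl l) p ->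
  monomial_preorder lt ->
  independent phi lt (fun i : 'I_s => generated_val phi bs (nth 0 l i)).
Proof.
set C := generated phi bs in l p *; set val := generated_val phi bs.
move=> sn n0 gl mp hlt [f f0 [m0]]; have [pp _ _] := mp.
rewrite initial_formE; case: ifP => [/andP [m0f m0min]|_ [d]]; last first.
  by rewrite mul0r => /esym /eqP; rewrite oner_eq0.
move=> [d fd].
have hpre := expoX_pre (size l) hlt; have olt := refine_ord hpre.
pose c m : C := generated_map phi bs f@_m.
pose e := @expo_pad s (size l).
have einj : {in msupp f &, injective e} by move=> m m' _ _; apply: expo_pad_inj.
have nc0 : ~ p (c m0).
  move=> pc; apply: (prime_neg1 pp).
  have -> : 1 = generated_map phi bs d * c m0 by rewrite -rmorphM mulrC fd rmorph1.
  exact: (idealM _ (prime_ideal_ideal pp)).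
have [m1 [m1f nc1 m1min]] := mono_ord_min (Q := fun m => ~ p (c m)) olt einj m0f nc0.
have ltE m m' : expoX lt (e m) (e m') = lt (widen_cmonom m) (widen_cmonom m').
  by rewrite /expoX !widX_pad.
have le1 m : m \in msupp f -> ~~ expoX lt (e m) (e m1).
  move=> mf; apply: (@mp_le_trans _ _ hpre _ (e m0)); last first.
    by rewrite ltE; apply: (allP m0min).
  case: (eqVneq m0 m1) => [<-|m01]; first by rewrite mp_irr.
  have /orP [h|/andP [//]] := m1min _ m0f nc0 m01.
  exact: mp_asym h.
have [|w [w0 hw]] := weight_exists hpre (D := [seq (e m1, e m) | m <- msupp f]).
  by move=> _ /mapP [m mf ->] /=; apply: le1.
have {}hw m : m \in msupp f -> (wt w (e m1) <= wt w (e m))%N.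
  by move=> mf; have [|] := hw (e m1, e m); first exact: map_f.
pose a (i : 'I_(size l)) := nth 0 l i.
have hC : noetherian C := @generated_noetherian bs.
apply: (@generic_independent C hC l p w _ (e m1) (c m1) gl mp n0 w0 olt nc1).
set H := addI _ _.
have iH : ideal H.
  apply: addI_ideal; first exact: spanm_ideal.
  by apply: addI_ideal; [exact: mulI_ideal | exact: wspan_ideal].
have rel : \sum_(m <- msupp f) c m * mon a (e m) = 0.
  apply: (@generated_val_inj _ _ phi bs); rewrite rmorph_sum rmorph0; apply: etrans f0.
  apply: eq_bigr => m _; rewrite rmorphM (mon_pad (nth 0 l)) // rmorph_prod.
  by congr (_ * _); apply: eq_bigr => i _; rewrite rmorphXn.
have -> : c m1 * mon a (e m1) = - \sum_(m <- msupp f | m != m1) c m * mon a (e m).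
  apply/eqP; rewrite -addr_eq0; apply/eqP; apply: etrans rel.
  by rewrite [RHS](bigD1_seq m1) ?fset_uniq.
apply: (idealN iH); rewrite big_seq_cond; apply: (ideal_sum _ iH) => m /andP [mf mm1].
(* The three summands of [H]: coefficient in [p]; same weight but larger monomial; larger weight. *)
case: (pselect (p (c m))) => [pcm|ncm].
  apply: addI_subr; first exact: spanm_ideal.
  apply: addI_subl; first exact: wspan_ideal.
  by apply: mulI_mem => //; apply: spanm_mem; apply: hw.
apply: (idealM _ iH).
have := hw m mf; rewrite leq_eqVlt => /orP [/eqP wE|lw].
  apply: addI_subl; first by apply: addI_ideal; [exact: mulI_ideal | exact: wspan_ideal].
  by apply: spanm_mem; split; [apply: m1min | rewrite wE].
apply: addI_subr; first exact: spanm_ideal.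
by apply: addI_subr; [exact: mulI_ideal | apply: spanm_mem].
Qed.

(** The subalgebra is generated by one [x i] from each difference of consecutive primes, which keeps
    the contracted chain strict. *)
Lemma exists_independent s (P : nat -> set A) : (0 < s)%N -> prime_chain s P ->
  exists a : 'I_s -> A, forall lt, monomial_preorder lt -> independent phi lt a.
Proof.
move=> s0 hP.
have hx i : exists x, (i < s)%N -> P i.+1 x /\ ~ P i x.
  case: (pselect (i < s)%N) => [si|]; last by exists 0.
  have [_ /existsNP [x /not_implyP hx]] := hP.2 i si.
  by exists x.
have [x xP] := choice hx.
pose bs := mkseq x s; pose val := generated_val phi bs.
have [cs [csE _]] := generated_fg phi bs.
have hP' : prime_chain s (fun i => [set c : generated phi bs | P i (val c)]).
  split=> i hi; first exact: prime_preim (hP.1 i hi).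
  have [Pi _] := hP.2 i hi; split=> [c /Pi //|sub].
  have vc : val (nth 0 cs i) = x i.
    have sc : size cs = s by rewrite -(size_map val) csE size_mkseq.
    by rewrite -(nth_map 0 0) ?sc // csE nth_mkseq.
  have [Px nPx] := xP i hi; apply: nPx.
  have h1 : P i.+1 (val (nth 0 cs i)) by rewrite vc.
  have h2 : P i (val (nth 0 cs i)) := sub _ h1.
  by rewrite -vc.
have hC := @generated_noetherian bs.
have [l [sl gl lp]] := generic_of_chain hC hP'.
have [l' [gl' mp']] := generic_extend hC gl (hP'.1 s (leqnn s)) lp.
have sn : (s <= size (l ++ l'))%N by rewrite size_cat sl leq_addr.
exists (fun i => val (nth 0 (l ++ l') i)) => lt hlt.
exact: (generic_family_independent sn (leq_trans s0 sn) gl' mp' hlt).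
Qed.

Section Dependence.
Variables (s : nat) (a : 'I_s -> A).
Let bs := [seq a i | i <- enum 'I_s].
Let C := generated phi bs.
Let val := generated_val phi bs.

(** [spanm] has coefficients in [C]. These are polynomials in the [c i] over [R], and [P] is closed
    under multiplication by their monomials. *)
Lemma spanm_mpeval (c : 'I_s -> C) (P : set (expo s)) :
  (forall i, val (c i) = a i) -> (forall u v, P u -> P (addX u v)) ->
  forall x, spanm c P x -> exists f, mpeval phi a f = val x /\
    forall m, m \in msupp f -> P (expo_pad s m).
Proof.
move=> ca Padd.
pose U : set C := [set x | exists f, mpeval phi a f = val x /\
  forall m, m \in msupp f -> P (expo_pad s m)].
have U0 : U 0.
  exists 0; rewrite mpeval0 rmorph0; split=> // m.
  by rewrite msupp0 inE.
have UD x y : U x -> U y -> U (x + y).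
  move=> [f [fx fP]] [g [gy gP]]; exists (f + g); rewrite mpevalD fx gy rmorphD.
  by split=> // m /(fsubsetP (msuppD_le f g)); rewrite inE => /orP [/fP|/gP].
have UN x : U x -> U (- x).
  move=> [f [fx fP]]; exists (- f); rewrite mpevalN fx rmorphN; split=> // m.
  by rewrite msuppN; apply: fP.
have prodD u (m : {cmonom 'I_s}) : \prod_(i < s) a i ^+ m i * mon a u =
    \prod_(i < s) a i ^+ (mmul m (cm_of u)) i.
  by rewrite -big_split /=; apply: eq_bigr => i _; rewrite cmM cm_ofE exprD.
have Umon x k u : U x -> U (generated_map phi bs k * mon c u * x).
  move=> [f [fx fP]].
  exists (\sum_(m <- msupp f) << k * f@_m *g mmul m (cm_of u) >>); split.
    rewrite mpeval_sum rmorphM rmorphM -/val -fx /mpeval mulr_sumr.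
    apply: eq_bigr => m _; rewrite -/(mpeval _ _ _) mpevalU -prodD rmorphM.
    have -> : generated_val phi bs (mon c u) = mon a u.
      by rewrite rmorph_prod; apply: eq_bigr => i _; rewrite rmorphXn -/val ca.
    rewrite -[generated_val _ _ (generated_map _ _ _)]/(phi k); ring.
  move=> m; rewrite -mcoeff_neq0 raddf_sum /= => h.
  have [m' m'f mm'] : exists2 m', m' \in msupp f & m = mmul m' (cm_of u).
    apply: contrapT => nex; move/eqP: h; apply; rewrite big_seq big1 // => m' m'f.
    rewrite mcoeffU; case: eqP => // mE; case: nex; by exists m'.
  have -> : expo_pad s m = addX (expo_pad s m') u.
    by apply/ffunP => i; rewrite !ffunE !padE mm' cmM cm_ofE.
  by apply: Padd; apply: fP.
have UM y x : U x -> U (y * x).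
  have [cs [csE hcs]] := generated_fg phi bs.
  move: x; apply: (adj_min (S := [set y | forall x, U x -> U (y * x)]) _ _ (hcs y)).
    split=> [x|u v hu hv x Ux|u v hu hv x Ux]; first by rewrite mul1r.
      by rewrite mulrBl; apply: UD; [apply: hu | apply: UN; apply: hv].
    by rewrite -mulrA; apply: hu; apply: hv.
  move=> z [[k ->] x /(Umon _ k (zeroX s))|zcs x]; first by rewrite mon0 mulr1.
  have : val z \in map val cs by rewrite map_f.
  rewrite csE => /mapP [i _ zi] /(Umon _ 1 (unitX i)); rewrite rmorph1 mul1r mon_unit.
  suff -> : c i = z by [].
  by apply: (@generated_val_inj _ _ phi bs); rewrite -/val ca zi.
move=> x; apply: (@spanm_min _ _ _ _ U); first by split.
move=> u Pu; exists << 1 *g cm_of u >>; rewrite mpevalU rmorph1 mul1r; split.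
  rewrite rmorph_prod; apply: eq_bigr => i _.
  by rewrite rmorphXn cm_ofE -/val ca.
by move=> m /(fsubsetP msuppU_le); rewrite inE => /eqP ->; rewrite cm_ofK.
Qed.

(** Monomials above [v] in the refined order are never below it for [lt], so the relation keeps the
    coefficient 1 at [v] in its initial form. *)
Lemma dependent_of_initI (c : 'I_s -> C) lt : (forall i, val (c i) = a i) ->
  monomial_preorder lt -> initI c (refine (@expoX lt s)) 1 -> dependent phi lt a.
Proof.
move=> ca hlt [v]; rewrite mul1r => hv.
have hpre := expoX_pre s hlt; have olt := refine_ord hpre.
have hlt' := mo_pre olt.
have [|f [fv fP]] := spanm_mpeval ca _ hv.
  by move=> u z /= vu; apply: mp_lt_le vu _ => //; apply: mp_addr.
exists (<< 1 *g cm_of v >> - f).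
  rewrite mpevalD mpevalN fv mpevalU rmorph1 mul1r rmorph_prod.
  apply/eqP; rewrite subr_eq0; apply/eqP; apply: eq_bigr => i _.
  by rewrite rmorphXn cm_ofE -/val ca.
have fv0 : f@_(cm_of v) = 0.
  by apply: mcoeff_outdom; apply/negP => /fP; rewrite cm_ofK /= mp_irr.
have gv : (<< 1 *g cm_of v >> - f)@_(cm_of v) = 1.
  by rewrite mcoeffB mcoeffUU fv0 subr0.
exists (cm_of v); rewrite initial_formE -mcoeff_neq0 gv oner_neq0 /=.
case: allP => [_|[]]; first by exists 1; rewrite mulr1.
move=> m /(fsubsetP (msuppB_le _ _)); rewrite inE => /orP [/(fsubsetP msuppU_le)|/fP].
  rewrite inE => /eqP ->; rewrite -(@widX_pad s s) // cm_ofK.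
  by rewrite -/(expoX lt v v) mp_irr.
rewrite -(@widX_pad s s m) // -(@widX_pad s s (cm_of v)) // cm_ofK.
rewrite -/(expoX lt _ v) /= /refine => /orP [/(mp_asym hpre)//|/andP [//]].
Qed.

Lemma dependent_of_dim (B : comNzRingType) (iota : {rmorphism A -> B}) cs lt :
  goldman R -> injective iota -> fg (iota \o phi) cs -> (0 < s)%N ->
  (~ exists P : nat -> set A, prime_chain s P) -> monomial_preorder lt ->
  dependent phi lt a.
Proof.
move=> gR iotaI hB s0 nP hlt.
have hpre := expoX_pre s hlt; have olt := refine_ord hpre.
have [ds [dsE dsG]] := generated_fg phi bs.
have hC : noetherian C := @generated_noetherian bs.
pose c (i : 'I_s) : C := nth 0 ds i.
have ca i : val (c i) = a i.
  have sd : size ds = s by rewrite -(size_map val) dsE size_map size_enum_ord.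
  by rewrite -(nth_map 0 0) ?sd // dsE (nth_map i) ?size_enum_ord // nth_ord_enum.
have iE := initI_ideal c (mo_pre olt).
apply: (dependent_of_initI ca hlt); apply: contrapT => n1; apply: nP.
have [q pq Eq] := noeth_maximal_prime hC iE n1.
have [p mp _] := exists_minprime hC iE pq Eq; have [pp _ _] := mp.
have l0p : lidl [::] `<=` p.
  by apply: lidl_min => //; apply: prime_ideal_ideal.
have [l [gl ml]] := generic_extend hC (@generic_nil C) pp l0p.
have sl := initI_height hC olt mp ml.
have [Q [Qc _ _ _]] := generic_chain hC gl ml.
have gC : goldman C := goldman_fg dsG hR gR.
have Qs := prime_chain_trunc sl Qc.
rewrite -(prednK s0) in Qs *.
apply: (@chain_transfer C A B val iota cs _ Q hC gC) => //.
  by move=> x y /iotaI /generated_val_inj.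
move=> y; apply: (adj_min (adj_subring _) _ (hB y)) => z hz.
apply: adj_sub; case: hz => [[x ->]|]; [left | by right].
by exists (generated_map phi bs x).
Qed.

End Dependence.
End Nontrivial.

Lemma fg_of_mpeval (R B : comNzRingType) (psi : {rmorphism R -> B}) :
  finitely_generated_algebra psi -> exists bs, fg psi bs.
Proof.
move=> [n [b hb]]; exists [seq b i | i <- enum 'I_n] => y; have [f <-] := hb y.
have [h1 hB hM] := adj_subring (gens psi [seq b i | i <- enum 'I_n]).
have h0 : adj (gens psi [seq b i | i <- enum 'I_n]) 0.
  by rewrite -(subrr 1); apply: (hB).
have hD u v : adj (gens psi [seq b i | i <- enum 'I_n]) u ->
    adj (gens psi [seq b i | i <- enum 'I_n]) v ->
    adj (gens psi [seq b i | i <- enum 'I_n]) (u + v).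
  by move=> hu hv; rewrite -(opprK v); apply: (hB) => //; rewrite -sub0r; apply: (hB).
rewrite /mpeval; elim/big_ind: _ => // m _.
apply: (hM); first exact: gens_map.
elim/big_ind: _ => // i _.
have hbi : adj (gens psi [seq b i | i <- enum 'I_n]) (b i).
  by apply: adj_sub; right; apply: map_f; rewrite mem_enum.
by elim: (m i) => [|k IH]; rewrite ?expr0 ?exprS //; apply: (hM).
Qed.

Lemma trivial_dependent (R A : comPzRingType) (phi : {rmorphism R -> A}) s
    (a : 'I_s -> A) lt : monomial_preorder lt -> (1 : A) = 0 -> dependent phi lt a.
Proof.
move=> hlt A0; have all0 (x : A) : x = 0 by rewrite -(mulr1 x) A0 mulr0.
exists << 1 *g mone >>; first exact: all0.
exists mone; exists 1; rewrite mulr1 initial_formE.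
(* If [R] is zero too, the coefficient 0 equals 1 and is invertible. *)
case: (eqVneq (1 : R) 0) => [R0|R1].
  by case: ifP => _; rewrite ?R0 // ?mcoeffUU.
have -> : msupp << (1 : R) *g (mone : {cmonom 'I_s}) >> = [fset mone]%fset.
  by rewrite msuppU (negPf R1).
rewrite in_fset1 eqxx mcoeffUU.
case: allP => [_|[m]]; first by [].
rewrite in_fset1 => /eqP ->; rewrite -(@widX_pad s s) //.
by have := mp_irr (expoX_pre s hlt) (expo_pad s mone); rewrite /expoX => ->.
Qed.

Theorem theorem4p8 (R A : comPzRingType) (phi : {rmorphism R -> A}) (s : nat)
    (hnoeth : noetherian R) (hjac : jacobson R) (hA : subfinite phi)
    (hs : (0 < s)%N) :
  (((s%:Z)%:E <= krull_dim A)%E ->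
     exists a : 'I_s -> A, forall lt : rel {cmonom nat},
       monomial_preorder lt -> independent phi lt a) /\
  ((krull_dim A < (s%:Z)%:E)%E ->
     forall (a : 'I_s -> A) (lt : rel {cmonom nat}),
       monomial_preorder lt -> dependent phi lt a).
Proof.
case: (eqVneq (1 : A) 0) => [A0|A1].
  split=> [/(krull_dim_ge hs) [P hP]|_ a lt hlt]; last exact: trivial_dependent.
  have pP := hP.1 0%N (leq0n s); case: (prime_neg1 pP); rewrite A0.
  exact: ideal0 (prime_ideal_ideal pP).
have R1 : (1 : R) != 0.
  by apply: contra_neq A1 => R0; rewrite -(rmorph1 phi) R0 rmorph0.
have [B [psi [iota [hB iotaI hiota]]]] := hA.
have B1 : (1 : B) != 0.
  by apply: contra_neq A1 => B0; apply: iotaI; rewrite rmorph1 B0 rmorph0.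
(* The same rings, packed with the proof of [1 != 0] that the sections on algebras presuppose. *)
pose R' : comNzRingType := HB.pack (GRing.ComPzRing.sort R)
  (GRing.PzSemiRing_isNonZero.Build R R1).
pose A' : comNzRingType := HB.pack (GRing.ComPzRing.sort A)
  (GRing.PzSemiRing_isNonZero.Build A A1).
pose B' : comNzRingType := HB.pack (GRing.ComPzRing.sort B)
  (GRing.PzSemiRing_isNonZero.Build B B1).
split=> [/(krull_dim_ge hs) [P hP]|/krull_dim_lt nP a lt hlt].
  exact: (@exists_independent R' A' phi hnoeth s P hs hP).
have [bs hbs] := @fg_of_mpeval R' B' psi hB.
have gR := jacobson_goldman hjac.
apply: (@dependent_of_dim R' A' phi hnoeth s a B' iota bs lt gR iotaI _ hs nP hlt).
suff -> : iota \o phi = psi :> (R -> B) by [].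
by apply/funext => x /=; rewrite hiota.
Qed.
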